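(* Let $R$ be a commutative noetherian ring, and let $A$ and $B$ be finite projective $R$-algebras which are derived equivalent. Then $A$ is a Gorenstein $R$-algebra if and only if $B$ is a Gorenstein $R$-algebra.
   Context: A finite projective $R$-algebra is an associative $R$-algebra that is finitely generated and projective as an $R$-module. $\mathbf{D}(\operatorname{Mod}A)$ is the derived category of left $A$-modules and $\mathbf{D}^{\mathrm b}(\operatorname{mod}A)$ the bounded derived category of finitely generated left $A$-modules. $A$ and $B$ are derived equivalent if $\mathbf{D}^{\mathrm b}(\operatorname{mod}A)$ and $\mathbf{D}^{\mathrm b}(\operatorname{mod}B)$ are equivalent as triangulated categories; equivalently, there is a tilting complex $T$ in $\mathbf{D}(\operatorname{Mod}A)$ with a ring isomorphism $\operatorname{End}_{\mathbf{D}(\operatorname{Mod}A)}(T)^{\mathrm{op}}\cong B$. Here $T$ is tilting if $\operatorname{Ext}^i_A(T,T)=0$ for all $i\ne0$ and $T$ and $A$ generate the same thick subcategory of $\mathbf{D}(\operatorname{Mod}A)$. An associative ring is Iwanaga--Gorenstein if it is noetherian on both sides and has finite injective dimension over itself on both sides. An associative ring $A$ is a Gorenstein $R$-algebra if it is a finite projective $R$-algebra and $A_{\mathfrak p}$ is Iwanaga--Gorenstein for each $\mathfrak p\in\operatorname{Spec}R$ with $A_{\mathfrak p}\ne0$. *)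

(* Defs.v *)
From HB Require Import structures.
From mathcomp Require Import all_boot all_order all_algebra.
From mathcomp Require Import boolp zify ring.

Set Implicit Arguments.
Unset Strict Implicit.
Unset Printing Implicit Defensive.

Import GRing.Theory.
Local Open Scope ring_scope.

(* Rings are pzRingTypes throughout, so that the zero ring is allowed.  The   *)
(* library's algType only covers nonzero rings, hence the record below: an    *)
(* R-algebra is a ring with a ring morphism from R to its center.             *)
Record assoc_algebra (R : comPzRingType) := AssocAlgebra {
  alg_ring :> pzRingType;
  alg_map : {rmorphism R -> alg_ring};
  alg_map_central : forall (r : R) (a : alg_ring),
    alg_map r * a = a * alg_map r
}.

Section Modules.
Variable A : pzRingType.

Definition fg_module (M : lmodType A) : Prop :=
  exists (n : nat) (e : 'I_n -> M),
    forall x : M, exists c : 'I_n -> A, x = \sum_(i < n) c i *: e i.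

Definition projective_module (P : lmodType A) : Prop :=
  forall (M N : lmodType A) (f : {linear M -> N}) (g : {linear P -> N}),
    (forall y : N, exists x : M, f x = y) ->
    exists h : {linear P -> M}, forall x : P, f (h x) = g x.

Definition injective_module (I : lmodType A) : Prop :=
  forall (M N : lmodType A) (f : {linear M -> N}) (g : {linear M -> I}),
    injective f ->
    exists h : {linear N -> I}, forall x : M, h (f x) = g x.

(* An exact sequence 0 -> M -> I 0 -> I 1 -> ... -> I N -> 0 with every I n    *)
(* injective, padded by zero modules after I N.                               *)
Definition finite_injdim (M : lmodType A) : Prop :=
  exists (I : nat -> lmodType A) (d : forall n, {linear I n -> I n.+1})
         (e : {linear M -> I 0%N}) (N : nat),
    [/\ forall n, injective_module (I n),
        injective e,
        forall x : I 0%N, d 0%N x = 0 <-> exists m : M, e m = x,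
        forall n (x : I n.+1), d n.+1 x = 0 <-> exists y : I n, d n y = x &
        forall n, (N < n)%N -> forall x : I n, x = 0].

Definition left_ideal (J : A -> Prop) : Prop :=
  [/\ J 0, forall x y, J x -> J y -> J (x + y) &
      forall a x, J x -> J (a * x)].

Definition left_noetherian : Prop :=
  forall J : A -> Prop, left_ideal J ->
    exists (n : nat) (e : 'I_n -> A), (forall i, J (e i)) /\
      forall x, J x -> exists c : 'I_n -> A, x = \sum_(i < n) c i * e i.

End Modules.

(* A^c is the opposite ring: its left ideals and left modules are the right   *)
(* ideals and right modules of A.  A^o is A as a left module over itself.     *)
Definition iwanaga_gorenstein (A : pzRingType) : Prop :=
  [/\ left_noetherian A, left_noetherian A^c,
      @finite_injdim A A^o & @finite_injdim A^c (A^c)^o].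

(* Membership is boolean so that the complement is a choiceType; classically  *)
(* this is no restriction.                                                    *)
Record prime_ideal (R : comPzRingType) := PrimeIdeal {
  prime_mem : pred R;
  prime_mem0 : prime_mem 0;
  prime_memD : forall x y, prime_mem x -> prime_mem y -> prime_mem (x + y);
  prime_memM : forall a x, prime_mem x -> prime_mem (a * x);
  prime_proper : ~~ prime_mem 1;
  prime_memP : forall x y, prime_mem (x * y) -> prime_mem x || prime_mem y
}.

Section AlgebraModule.
Variables (R : comPzRingType) (A : assoc_algebra R).

Definition alg_module : Type := A.

HB.instance Definition _ := GRing.Zmodule.on alg_module.

Definition alg_scale (r : R) (a : alg_module) : alg_module :=
  alg_map A r * (a : A).

Lemma alg_scaleA r s a : alg_scale r (alg_scale s a) = alg_scale (r * s) a.
Proof. by rewrite /alg_scale rmorphM mulrA. Qed.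

Lemma alg_scale1 : left_id 1 alg_scale.
Proof. by move=> a; rewrite /alg_scale rmorph1 mul1r. Qed.

Lemma alg_scaleDr : right_distributive alg_scale +%R.
Proof. by move=> r a b; apply: mulrDr. Qed.

Lemma alg_scaleDl a : {morph alg_scale^~ a : r s / r + s}.
Proof. by move=> r s; rewrite /alg_scale rmorphD; apply: mulrDl. Qed.

HB.instance Definition _ := GRing.Zmodule_isLmodule.Build R alg_module
  alg_scaleA alg_scale1 alg_scaleDr alg_scaleDl.

Lemma alg_scaleM r s (a b : A) :
  (alg_scale r a : A) * alg_scale s b = alg_scale (r * s) (a * b : A).
Proof.
rewrite /alg_scale rmorphM -!mulrA; congr (_ * _).
by rewrite !mulrA -alg_map_central.
Qed.

Lemma alg_scaleD r (a b : A) :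
  alg_scale r (a + b : A) = (alg_scale r a : A) + alg_scale r b.
Proof. exact: mulrDr. Qed.

Lemma alg_scaleAl r (a b : A) :
  alg_scale r (a * b : A) = (alg_scale r a : A) * b.
Proof. exact: mulrA. Qed.

Lemma alg_scaleAr r (a b : A) :
  alg_scale r (a * b : A) = a * (alg_scale r b : A).
Proof. by rewrite /alg_scale mulrA alg_map_central mulrA. Qed.

Lemma alg_scaleN r (a : A) : alg_scale r (- a : A) = - (alg_scale r a : A).
Proof. exact: mulrN. Qed.

End AlgebraModule.

Definition finite_projective (R : comPzRingType) (A : assoc_algebra R) : Prop :=
  fg_module (alg_module A) /\ projective_module (alg_module A).

Section Localization.
Local Open Scope quotient_scope.
Variables (R : comPzRingType) (A : assoc_algebra R) (p : prime_ideal R).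

Definition denom := {s : R | ~~ prime_mem p s}.

Lemma denomM_subproof (s t : denom) : ~~ prime_mem p (val s * val t).
Proof.
apply/negP => /prime_memP.
by rewrite (negPf (valP s)) (negPf (valP t)).
Qed.

Definition denom1 : denom := Sub (1 : R) (prime_proper p).
Definition denomM (s t : denom) : denom :=
  Sub (val s * val t) (denomM_subproof s t).

Local Notation "s ** a" := (alg_scale (val s) (a : A) : A)
  (at level 40, left associativity).

(* The pair (a, s) stands for the fraction a / s. *)
Definition frac := (A * denom)%type.

Definition frac_equiv (x y : frac) : bool :=
  `[< exists u : denom, u ** (y.2 ** x.1) = u ** (x.2 ** y.1) >].

Lemma frac_equiv_refl : reflexive frac_equiv.
Proof. by move=> x; apply/asboolP; exists denom1. Qed.

Lemma frac_equiv_sym : symmetric frac_equiv.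
Proof. by move=> x y; apply/asboolP/asboolP => -[u Hu]; exists u. Qed.

Lemma frac_equiv_trans : transitive frac_equiv.
Proof.
move=> [b t] [a s] [c r] /asboolP[/= u Hu] /asboolP[/= v Hv]; apply/asboolP.
exists (denomM (denomM u v) t) => /=.
transitivity (denomM v r ** (u ** (t ** a))).
  by rewrite !alg_scaleA; congr alg_scale => /=; ring.
rewrite Hu; transitivity (denomM u s ** (v ** (r ** b))).
  by rewrite !alg_scaleA; congr alg_scale => /=; ring.
by rewrite /= Hv !alg_scaleA; congr alg_scale => /=; ring.
Qed.

Canonical frac_equiv_equiv :=
  EquivRel frac_equiv frac_equiv_refl frac_equiv_sym frac_equiv_trans.

Definition localization := {eq_quot frac_equiv}%qT.

HB.instance Definition _ : EqQuotient frac frac_equiv localization :=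
  EqQuotient.on localization.
HB.instance Definition _ := Choice.on localization.

Lemma eq_localization (x y : frac) :
  frac_equiv x y -> \pi_localization x = \pi_localization y.
Proof. by move=> e; apply/eqP; rewrite piE. Qed.

Lemma frac_equiv_repr (x : frac) : frac_equiv x (repr (\pi_localization x)).
Proof. by have /eqP := esym (reprK (\pi_localization x)); rewrite piE. Qed.

Definition frac_add (x y : frac) : frac :=
  (y.2 ** x.1 + x.2 ** y.1, denomM x.2 y.2).
Definition frac_opp (x : frac) : frac := (- x.1, x.2).
Definition frac_mul (x y : frac) : frac := (x.1 * y.1, denomM x.2 y.2).

Definition loc_zero : localization :=
  lift_cst localization ((0, denom1) : frac).
Definition loc_one : localization :=
  lift_cst localization ((1, denom1) : frac).
Definition loc_add := lift_op2 localization frac_add.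
Definition loc_opp := lift_op1 localization frac_opp.
Definition loc_mul := lift_op2 localization frac_mul.

Canonical pi_loc_zero := PiConst loc_zero.
Canonical pi_loc_one := PiConst loc_one.

Lemma pi_loc_opp : {morph \pi : x / frac_opp x >-> loc_opp x}.
Proof.
move=> x; unlock loc_opp; apply: eq_localization.
have /asboolP[/= u Hu] := frac_equiv_repr x.
by apply/asboolP; exists u; rewrite /= !alg_scaleN Hu.
Qed.
Canonical pi_loc_opp_morph := PiMorph1 pi_loc_opp.

Lemma pi_loc_add : {morph \pi : x y / frac_add x y >-> loc_add x y}.
Proof.
move=> x y; unlock loc_add; apply: eq_localization.
have := frac_equiv_repr y; have := frac_equiv_repr x.
move: (repr _) (repr _) => y' x' /asboolP[/= u Hu] /asboolP[/= v Hv].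
apply/asboolP; exists (denomM u v); rewrite /frac_add /= !alg_scaleD.
congr (_ + _).
- transitivity (v ** (y'.2 ** (y.2 ** (u ** (x'.2 ** x.1))))).
    by rewrite !alg_scaleA; congr alg_scale => /=; ring.
  by rewrite /= Hu !alg_scaleA; congr alg_scale => /=; ring.
- transitivity (u ** (x'.2 ** (x.2 ** (v ** (y'.2 ** y.1))))).
    by rewrite !alg_scaleA; congr alg_scale => /=; ring.
  by rewrite /= Hv !alg_scaleA; congr alg_scale => /=; ring.
Qed.
Canonical pi_loc_add_morph := PiMorph2 pi_loc_add.

Lemma pi_loc_mul : {morph \pi : x y / frac_mul x y >-> loc_mul x y}.
Proof.
move=> x y; unlock loc_mul; apply: eq_localization.
have := frac_equiv_repr y; have := frac_equiv_repr x.
move: (repr _) (repr _) => y' x' /asboolP[/= u Hu] /asboolP[/= v Hv].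
apply/asboolP; exists (denomM u v); rewrite /frac_mul /=.
transitivity ((u ** (x'.2 ** x.1)) * (v ** (y'.2 ** y.1))).
  by rewrite !alg_scaleM !alg_scaleA; congr alg_scale => /=; ring.
by rewrite /= Hu Hv !alg_scaleM !alg_scaleA; congr alg_scale => /=; ring.
Qed.
Canonical pi_loc_mul_morph := PiMorph2 pi_loc_mul.

Lemma frac_eq (x y : frac) : x.1 = y.1 -> val x.2 = val y.2 -> x = y.
Proof. by case: x y => [a s] [b t] /= -> /val_inj ->. Qed.

Lemma loc_addA : associative loc_add.
Proof.
move=> x y z; rewrite -[x]reprK -[y]reprK -[z]reprK !piE; congr \pi.
apply: frac_eq => /=; last by ring.
rewrite !alg_scaleD addrA; do 2?[congr (_ + _)]; rewrite !alg_scaleA;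
  by congr alg_scale => /=; ring.
Qed.

Lemma loc_addC : commutative loc_add.
Proof.
move=> x y; rewrite -[x]reprK -[y]reprK !piE; congr \pi.
by apply: frac_eq => /=; [rewrite addrC | ring].
Qed.

Lemma loc_add0 : left_id loc_zero loc_add.
Proof.
move=> x; rewrite -[x]reprK !piE; congr \pi.
by apply: frac_eq; rewrite /= ?mul1r // /alg_scale mulr0 add0r rmorph1 mul1r.
Qed.

Lemma loc_addN : left_inverse loc_zero loc_opp loc_add.
Proof.
move=> x; rewrite -[x]reprK !piE; apply: eq_localization.
apply/asboolP; exists denom1; rewrite /frac_add /= alg_scaleN addNr.
by rewrite /alg_scale !mulr0.
Qed.

Lemma loc_mulA : associative loc_mul.
Proof.
move=> x y z; rewrite -[x]reprK -[y]reprK -[z]reprK !piE; congr \pi.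
by apply: frac_eq; apply: mulrA.
Qed.

Lemma loc_mul1l : left_id loc_one loc_mul.
Proof.
move=> x; rewrite -[x]reprK !piE; congr \pi.
by apply: frac_eq; apply: mul1r.
Qed.

Lemma loc_mul1r : right_id loc_one loc_mul.
Proof.
move=> x; rewrite -[x]reprK !piE; congr \pi.
by apply: frac_eq; apply: mulr1.
Qed.

Lemma loc_mulDl : left_distributive loc_mul loc_add.
Proof.
move=> x y z; rewrite -[x]reprK -[y]reprK -[z]reprK !piE.
move: (repr x) (repr y) (repr z) => {x y z} [a s] [b t] [c r].
apply: eq_localization; apply/asboolP; exists denom1.
rewrite /frac_add /frac_mul /= !alg_scale1 mulrDl -!alg_scaleAl !alg_scaleD.
by congr (_ + _); rewrite !alg_scaleA; congr alg_scale => /=; ring.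
Qed.

Lemma loc_mulDr : right_distributive loc_mul loc_add.
Proof.
move=> z x y; rewrite -[x]reprK -[y]reprK -[z]reprK !piE.
move: (repr x) (repr y) (repr z) => {x y z} [a s] [b t] [c r].
apply: eq_localization; apply/asboolP; exists denom1.
rewrite /frac_add /frac_mul /= !alg_scale1 mulrDr -!alg_scaleAr !alg_scaleD.
by congr (_ + _); rewrite !alg_scaleA; congr alg_scale => /=; ring.
Qed.

HB.instance Definition _ := GRing.isZmodule.Build localization
  loc_addA loc_addC loc_add0 loc_addN.
HB.instance Definition _ := GRing.Zmodule_isPzRing.Build localization
  loc_mulA loc_mul1l loc_mul1r loc_mulDl loc_mulDr.

End Localization.

Definition gorenstein_algebra (R : comPzRingType) (A : assoc_algebra R) :
    Prop :=
  finite_projective A /\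
  forall p : prime_ideal R,
    (1 : localization A p) <> 0 -> iwanaga_gorenstein (localization A p).


(* Categories whose hom-sets are given with an equivalence relation in place  *)
(* of Leibniz equality; composition is written in diagrammatic order.         *)
Record category := Category {
  obj :> Type;
  hom : obj -> obj -> Type;
  hom_eq : forall X Y, hom X Y -> hom X Y -> Prop;
  id_hom : forall X, hom X X;
  comp_hom : forall X Y Z, hom X Y -> hom Y Z -> hom X Z;
  hom_eq_refl : forall X Y (f : hom X Y), hom_eq f f;
  hom_eq_sym : forall X Y (f g : hom X Y), hom_eq f g -> hom_eq g f;
  hom_eq_trans : forall X Y (f g h : hom X Y),
    hom_eq f g -> hom_eq g h -> hom_eq f h;
  comp_hom_eq : forall X Y Z (f f' : hom X Y) (g g' : hom Y Z),
    hom_eq f f' -> hom_eq g g' -> hom_eq (comp_hom f g) (comp_hom f' g');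
  comp_id_hom : forall X Y (f : hom X Y), hom_eq (comp_hom (id_hom X) f) f;
  comp_hom_id : forall X Y (f : hom X Y), hom_eq (comp_hom f (id_hom Y)) f;
  comp_homA : forall X Y Z W (f : hom X Y) (g : hom Y Z) (h : hom Z W),
    hom_eq (comp_hom f (comp_hom g h)) (comp_hom (comp_hom f g) h)
}.

Arguments hom {c} X Y.
Arguments hom_eq {c X Y} f g.
Arguments id_hom {c} X.
Arguments comp_hom {c X Y Z} f g.

Declare Scope derived_scope.
Delimit Scope derived_scope with derived.
Local Open Scope derived_scope.

Notation "f === g" := (hom_eq f g)
  (at level 70, no associativity) : derived_scope.
Notation "f ;; g" := (comp_hom f g)
  (at level 50, left associativity) : derived_scope.

Definition is_iso (C : category) (X Y : C) (f : hom X Y) : Prop :=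
  exists g : hom Y X, f ;; g === id_hom X /\ g ;; f === id_hom Y.

Record functor (C D : category) := Functor {
  fobj :> C -> D;
  fmap : forall X Y : C, hom X Y -> hom (fobj X) (fobj Y);
  fmap_eq : forall (X Y : C) (f g : hom X Y), f === g -> fmap f === fmap g;
  fmap_id : forall X : C, fmap (id_hom X) === id_hom (fobj X);
  fmap_comp : forall (X Y Z : C) (f : hom X Y) (g : hom Y Z),
    fmap (f ;; g) === fmap f ;; fmap g
}.

Arguments fmap {C D} _ {X Y} _.

Definition is_equivalence (C D : category) (F : functor C D) : Prop :=
  exists (G : functor D C)
         (eta : forall X : C, hom X (G (F X)))
         (eps : forall Y : D, hom (F (G Y)) Y),
    [/\ forall X, is_iso (eta X),
        forall Y, is_iso (eps Y),
        forall (X X' : C) (f : hom X X'),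
          eta X ;; fmap G (fmap F f) === f ;; eta X' &
        forall (Y Y' : D) (g : hom Y Y'),
          eps Y ;; g === fmap F (fmap G g) ;; eps Y'].

(* The data of a triangulated category that an equivalence of triangulated    *)
(* categories must respect.  The additive structure is not part of it: it is  *)
(* determined by the category, hence preserved by every equivalence.          *)
Record triangulated := Triangulated {
  tri_cat :> category;
  shift : functor tri_cat tri_cat;
  distinguished : forall X Y Z : tri_cat,
    hom X Y -> hom Y Z -> hom Z (shift X) -> Prop
}.

Definition triangle_equivalent (C D : triangulated) : Prop :=
  exists (F : functor C D)
         (theta : forall X : C, hom (F (shift C X)) (shift D (F X))),
    [/\ is_equivalence F,
        forall X, is_iso (theta X),
        forall (X Y : C) (f : hom X Y),
          fmap F (fmap (shift C) f) ;; theta Y ===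
          theta X ;; fmap (shift D) (fmap F f) &
        forall (X Y Z : C) (u : hom X Y) (v : hom Y Z) (w : hom Z (shift C X)),
          distinguished u v w ->
          distinguished (fmap F u) (fmap F v) (fmap F w ;; theta X)].

Section Complexes.
Variable A : pzRingType.

Record bcomplex := BComplex {
  cx :> int -> lmodType A;
  diff : forall i : int, {linear cx i -> cx (i + 1)};
  diffK : forall (i : int) (x : cx i), diff (i + 1) (diff i x) = 0;
  cx_fg : forall i : int, fg_module (cx i);
  cx_bounded : exists n : nat,
    forall i : int, (n < `|i|)%N -> forall x : cx i, x = 0
}.

Record chain_map (X Y : bcomplex) := ChainMap {
  cmap :> forall i : int, {linear X i -> Y i};
  cmapP : forall (i : int) (x : X i),
    diff Y i (cmap i x) = cmap (i + 1) (diff X i x)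
}.

Lemma chain_id_subproof (X : bcomplex) (i : int) (x : X i) :
  diff X i (idfun x) = idfun (diff X i x).
Proof. by []. Qed.

Definition chain_id (X : bcomplex) : chain_map X X :=
  @ChainMap X X (fun i : int => idfun) (@chain_id_subproof X).

Lemma chain_comp_subproof (X Y Z : bcomplex) (f : chain_map X Y)
    (g : chain_map Y Z) (i : int) (x : X i) :
  diff Z i ((g i \o f i)%FUN x) = (g (i + 1) \o f (i + 1))%FUN (diff X i x).
Proof. by rewrite /= !cmapP. Qed.

Definition chain_comp (X Y Z : bcomplex) (f : chain_map X Y)
    (g : chain_map Y Z) : chain_map X Z :=
  @ChainMap X Z (fun i : int => (g i \o f i)%FUN) (chain_comp_subproof f g).

(* f induces a bijection on H^(i+1) for every integer i, that is, in every    *)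
(* degree; the elements of H^(i+1)(X) are the classes of cocycles x in        *)
(* X^(i+1) modulo the image of X^i.                                           *)
Definition quasi_iso (X Y : bcomplex) (f : chain_map X Y) : Prop :=
  forall i : int,
    (forall x : X (i + 1), diff X (i + 1) x = 0 ->
       (exists y : Y i, diff Y i y = f (i + 1) x) ->
       exists z : X i, diff X i z = x) /\
    (forall y : Y (i + 1), diff Y (i + 1) y = 0 ->
       exists2 x : X (i + 1), diff X (i + 1) x = 0 &
         exists z : Y i, diff Y i z = y - f (i + 1) x).

(* The derived category is the localization of the category of complexes at   *)
(* the quasi-isomorphisms, presented by generators (chain maps and formal     *)
(* inverses of quasi-isomorphisms) and relations.                             *)
Inductive dhom : bcomplex -> bcomplex -> Type :=
| DMap X Y of chain_map X Y : dhom X Y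
| DInv X Y (s : chain_map X Y) of quasi_iso s : dhom Y X
| DComp X Y Z of dhom X Y & dhom Y Z : dhom X Z.

Inductive dhom_eq : forall X Y, dhom X Y -> dhom X Y -> Prop :=
| DRefl X Y (f : dhom X Y) : dhom_eq f f
| DSym X Y (f g : dhom X Y) of dhom_eq f g : dhom_eq g f
| DTrans X Y (f g h : dhom X Y) of dhom_eq f g & dhom_eq g h : dhom_eq f h
| DCompEq X Y Z (f f' : dhom X Y) (g g' : dhom Y Z)
    of dhom_eq f f' & dhom_eq g g' : dhom_eq (DComp f g) (DComp f' g')
| DIdComp X Y (f : dhom X Y) : dhom_eq (DComp (DMap (chain_id X)) f) f
| DCompId X Y (f : dhom X Y) : dhom_eq (DComp f (DMap (chain_id Y))) f
| DCompA X Y Z W (f : dhom X Y) (g : dhom Y Z) (h : dhom Z W) :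
    dhom_eq (DComp f (DComp g h)) (DComp (DComp f g) h)
| DMapEq X Y (f g : chain_map X Y) of (forall i : int, f i =1 g i) :
    dhom_eq (DMap f) (DMap g)
| DMapComp X Y Z (f : chain_map X Y) (g : chain_map Y Z) :
    dhom_eq (DMap (chain_comp f g)) (DComp (DMap f) (DMap g))
| DMapInv X Y (s : chain_map X Y) (qs : quasi_iso s) :
    dhom_eq (DComp (DMap s) (DInv qs)) (DMap (chain_id X))
| DInvMap X Y (s : chain_map X Y) (qs : quasi_iso s) :
    dhom_eq (DComp (DInv qs) (DMap s)) (DMap (chain_id Y)).

Definition derived_cat : category :=
  @Category bcomplex dhom dhom_eq (fun X => DMap (chain_id X)) DComp
    DRefl DSym DTrans DCompEq DIdComp DCompId DCompA.

Lemma shift_diffK (X : bcomplex) (i : int) (x : X (i + 1)) :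
  (\- diff X (i + 1 + 1)) ((\- diff X (i + 1)) x) = 0.
Proof. by rewrite /= linearN diffK !oppr0. Qed.

Lemma shift_bounded (X : bcomplex) : exists n : nat,
  forall i : int, (n < `|i|)%N -> forall x : X (i + 1), x = 0.
Proof.
have [n Xn] := cx_bounded X; exists n.+1 => i ni; apply: Xn; lia.
Qed.

Definition shift_cx (X : bcomplex) : bcomplex :=
  @BComplex (fun i : int => X (i + 1)) (fun i : int => \- diff X (i + 1))
    (@shift_diffK X) (fun i : int => cx_fg X (i + 1)) (shift_bounded X).

Lemma shift_map_subproof (X Y : bcomplex) (f : chain_map X Y) (i : int)
    (x : shift_cx X i) :
  diff (shift_cx Y) i (f (i + 1) x) = f (i + 1 + 1) (diff (shift_cx X) i x).
Proof. by rewrite /= cmapP linearN. Qed.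

Definition shift_map (X Y : bcomplex) (f : chain_map X Y) :
    chain_map (shift_cx X) (shift_cx Y) :=
  @ChainMap (shift_cx X) (shift_cx Y) (fun i : int => f (i + 1))
    (shift_map_subproof f).

Lemma shift_quasi_iso (X Y : bcomplex) (f : chain_map X Y) :
  quasi_iso f -> quasi_iso (shift_map f).
Proof.
move=> qf i; have [inj surj] := qf (i + 1); split=> /=.
- move=> x /eqP; rewrite oppr_eq0 => /eqP dx [y dy].
  have [|z dz] := inj x dx; first by exists (- y); rewrite linearN.
  by exists (- z); rewrite linearN opprK.
- move=> y /eqP; rewrite oppr_eq0 => /eqP dy.
  have [x dx [z dz]] := surj y dy; exists x; first by rewrite dx oppr0.
  by exists (- z); rewrite linearN opprK.
Qed.

Fixpoint shift_dhom X Y (f : dhom X Y) : dhom (shift_cx X) (shift_cx Y) :=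
  match f with
  | DMap _ _ f => DMap (shift_map f)
  | DInv _ _ _ qs => DInv (shift_quasi_iso qs)
  | DComp _ _ _ f g => DComp (shift_dhom f) (shift_dhom g)
  end.

Lemma shift_id X : dhom_eq (DMap (shift_map (chain_id X)))
                           (DMap (chain_id (shift_cx X))).
Proof. exact: DMapEq. Qed.

Lemma shift_dhom_eq X Y (f g : dhom X Y) :
  dhom_eq f g -> dhom_eq (shift_dhom f) (shift_dhom g).
Proof.
elim=> {X Y f g} /=.
- by move=> *; apply: DRefl.
- by move=> *; apply: DSym.
- by move=> X Y f g h _ fg _ gh; apply: DTrans fg gh.
- by move=> *; apply: DCompEq.
- move=> X Y f; apply: DTrans (DIdComp _).
  by apply: DCompEq (shift_id X) (DRefl _).
- move=> X Y f; apply: DTrans (DCompId _).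
  by apply: DCompEq (DRefl _) (shift_id Y).
- by move=> *; apply: DCompA.
- by move=> X Y f g fg; apply: DMapEq => i x; apply: fg.
- move=> X Y Z f g; apply: DTrans (DMapComp _ _).
  by apply: DMapEq => i x.
- by move=> X Y s qs; apply: DTrans (DMapInv _) (DSym (shift_id X)).
- by move=> X Y s qs; apply: DTrans (DInvMap _) (DSym (shift_id Y)).
Qed.

Definition derived_shift : functor derived_cat derived_cat :=
  @Functor derived_cat derived_cat shift_cx shift_dhom shift_dhom_eq shift_id
    (fun X Y Z f g => DRefl (DComp (shift_dhom f) (shift_dhom g))).

Section Cone.
Variables (X Y : bcomplex) (f : chain_map X Y).

Definition cone_obj (i : int) : lmodType A := (X (i + 1)%R * Y i)%type.

Definition cone_diff_fun (i : int) (z : cone_obj i) : cone_obj (i + 1) :=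
  (- diff X (i + 1) z.1, f (i + 1) z.1 + diff Y i z.2).

Lemma cone_diff_linear (i : int) : linear (@cone_diff_fun i).
Proof.
move=> a [x y] [x' y']; rewrite /cone_diff_fun /=; congr (_, _).
  by rewrite linearP /= opprD scalerN.
by rewrite !linearP /= scalerDr addrACA.
Qed.

HB.instance Definition _ (i : int) :=
  GRing.isLinear.Build A (cone_obj i) (cone_obj (i + 1)) *:%R
    (@cone_diff_fun i) (@cone_diff_linear i).

Definition cone_diff (i : int) : {linear cone_obj i -> cone_obj (i + 1)} :=
  @cone_diff_fun i.

Lemma cone_diffK (i : int) (z : cone_obj i) : cone_diff (i + 1) (cone_diff i z) = 0.
Proof.
rewrite /= /cone_diff_fun /=; congr (_, _).
  by rewrite linearN diffK !oppr0.
by rewrite linearN linearD /= diffK addr0 cmapP addNr.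
Qed.

Lemma cone_fg (i : int) : fg_module (cone_obj i).
Proof.
have [m [e He]] := cx_fg X (i + 1); have [n [e' He']] := cx_fg Y i.
pose E (k : 'I_(m + n)) : cone_obj i :=
  match split k with inl j => (e j, 0) | inr j => (0, e' j) end.
exists (m + n)%N, E => -[x y].
have [c ->] := He x; have [c' ->] := He' y.
have splitL j : split (lshift n j) = inl j :> 'I_m + 'I_n.
  exact: (unsplitK (inl j)).
have splitR j : split (rshift m j) = inr j :> 'I_m + 'I_n.
  exact: (unsplitK (inr j)).
exists (fun k => match split k with inl j => c j | inr j => c' j end).
rewrite [RHS]surjective_pairing; congr (_, _).
  rewrite linear_sum /= big_split_ord /= [X in _ = _ + X]big1 ?addr0 => [|j _].
    by apply: eq_bigr => j _; rewrite /E splitL.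
  by rewrite /E splitR /= scaler0.
rewrite linear_sum /= big_split_ord /= [X in _ = X + _]big1 ?add0r => [|j _].
  by apply: eq_bigr => j _; rewrite /E splitR.
by rewrite /E splitL /= scaler0.
Qed.

Lemma cone_bounded : exists n : nat,
  forall i : int, (n < `|i|)%N -> forall z : cone_obj i, z = 0.
Proof.
have [m Xm] := shift_bounded X; have [n Yn] := cx_bounded Y.
exists (maxn m n) => i; rewrite gtn_max => /andP[mi ni] [x y].
by rewrite (Xm i mi x) (Yn i ni y).
Qed.

Definition cone : bcomplex :=
  BComplex cone_diffK cone_fg cone_bounded.

Definition cone_in_fun (i : int) (y : Y i) : cone_obj i := (0, y).

Lemma cone_in_linear (i : int) : linear (@cone_in_fun i).
Proof.
by move=> a y y'; rewrite /cone_in_fun; congr (_, _); rewrite /= scaler0 addr0.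
Qed.

HB.instance Definition _ (i : int) :=
  GRing.isLinear.Build A (Y i) (cone_obj i) *:%R
    (@cone_in_fun i) (@cone_in_linear i).

Lemma cone_in_subproof (i : int) (y : Y i) :
  diff cone i (cone_in_fun y) = cone_in_fun (diff Y i y).
Proof. by rewrite /= /cone_diff_fun /= !linear0 add0r. Qed.

Definition cone_in : chain_map Y cone :=
  @ChainMap Y cone (fun i : int => @cone_in_fun i) cone_in_subproof.

Lemma cone_out_subproof (i : int) (z : cone i) :
  diff (shift_cx X) i (fst z) = fst (diff cone i z).
Proof. by []. Qed.

Definition cone_out : chain_map cone (shift_cx X) :=
  @ChainMap cone (shift_cx X) (fun i : int => fst) cone_out_subproof.

End Cone.

(* The triangles isomorphic to X' -> Y' -> cone(f) -> X'[1] for some chain    *)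
(* map f : X' -> Y'.                                                          *)
Definition derived_distinguished (X Y Z : derived_cat)
    (u : hom X Y) (v : hom Y Z) (w : hom Z (derived_shift X)) : Prop :=
  exists (X' Y' : bcomplex) (f : chain_map X' Y')
         (a : @hom derived_cat X X') (b : @hom derived_cat Y Y')
         (c : @hom derived_cat Z (cone f)),
    [/\ is_iso a, is_iso b & is_iso c] /\
    [/\ u ;; b === a ;; (DMap f : @hom derived_cat X' Y'),
        v ;; c === b ;; (DMap (cone_in f) : @hom derived_cat Y' (cone f)) &
        w ;; fmap derived_shift a ===
        c ;; (DMap (cone_out f) :
                @hom derived_cat (cone f) (derived_shift X'))].

(* This is D^b(mod A) when A is left noetherian, so that the finitely         *)
(* generated left A-modules form an abelian category.                         *)
Definition Db_mod : triangulated :=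
  @Triangulated derived_cat derived_shift derived_distinguished.

End Complexes.

Definition derived_equivalent (A B : pzRingType) : Prop :=
  triangle_equivalent (Db_mod A) (Db_mod B).

(* Main.v *)
Require Import Defs.
From HB Require Import structures.
From mathcomp Require Import all_boot all_order all_algebra.
From mathcomp Require Import boolp classical_sets zify.
From Corelib Require Import Setoid Morphisms.
(* Again, since mathcomp's [hom] of vector spaces shadows the one of Defs.     *)
Require Import Defs.

(******************************************************************************)
(* Gorenstein algebras are recognized in the triangulated category            *)
(* D^b(mod A).  Call X a brick if every endomorphism of X is zero or          *)
(* invertible, and call Y left (right) bounded if for every brick X the group *)
(* Hom(Y, X[n]) (resp. Hom(X, Y[n])) vanishes for n large.  An equivalence of *)
(* triangulated categories respects these notions, and A is Gorenstein if and *)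
(* only if the left and the right bounded objects are the same.               *)
(*                                                                            *)
(* The elements of R outside some maximal ideal m act invertibly on a nonzero *)
(* brick, so everything may be computed up to multiplication by such          *)
(* elements.  The simple modules are bricks; by Nakayama's lemma and          *)
(* noetherian induction, Ext vanishes locally at m against all finitely       *)
(* generated modules once it does against the simple ones.  So a left bounded *)
(* complex is perfect locally at m.  A high syzygy N of a right bounded       *)
(* complex satisfies Ext^i(M, N)_m = 0 for all M and all large i, if A_m has  *)
(* finite left injective dimension.  If A_m has finite right injective        *)
(* dimension too, the A-duals of right resolutions are exact in high degrees, *)
(* hence Tor against N vanishes locally and N is again perfect locally.       *)
(*                                                                            *)
(* Conversely, A is left bounded, hence right bounded when the two notions    *)
(* agree, which bounds the left injective dimension of A_m; a linear form on  *)
(* A with a value outside m transfers the bound to R_m.  Then the dual        *)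
(* Hom_R(A, R) is right bounded, hence left bounded, so Tor against it        *)
(* vanishes locally in high degrees.  Dualizing into R and using that A is    *)
(* reflexive over R bounds the right injective dimension of A_m.              *)
(******************************************************************************)

Set Implicit Arguments.
Unset Strict Implicit.
Unset Printing Implicit Defensive.

Import Order.TTheory GRing.Theory Num.Theory.
Local Open Scope ring_scope.

(** * A decision procedure for abelian groups *)

(** For a finite projective algebra over a noetherian ring, being Gorenstein is equivalent to
    [balanced], a property of the triangulated category alone ([gorenstein_algebra_balanced]). That
    property involves only shifts, isomorphisms and trivial Hom sets, so an equivalence carries it
    over ([triangle_equivalent_balanced]).

    Bricks do the localizing. An element of R acts on a brick as zero or invertibly, so by
    Nakayama's lemma the annihilator of a nonzero cohomology module is a maximal ideal m, outside of
    which R acts invertibly ([loc_dichotomy]). Conversely simple modules are bricks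
    ([simple_brick]), and [noetherian_induction] spreads the vanishing of Ext in high degrees from
    the simple modules killed by m to all finitely generated modules, with one bound for all. Hence
    the free resolution of a left bounded object splits at m in low degrees ([left_bounded_split]).

    Suppose that each A_m has finite injective dimension on both sides. A resolution that splits at
    m in low degrees gives a right bounded object, since Ext into A vanishes in high degrees
    ([split_right_bounded]). For the converse ([right_bounded_split]), a high syzygy N of a right
    bounded object satisfies Ext^i(M, N)_m = 0 for all M and large i. The A-dual of a free right
    resolution is exact at m far out, so Hom(-, N) keeps it exact there; but Hom(-, N) of that dual
    computes Tor against N. Vanishing of Tor against one well chosen right module splits the
    resolution.

    Suppose that the category is balanced. Hom(A, X[n]) is the n-th cohomology of X, so A is left
    bounded, hence right bounded, which bounds the left injective dimension ([balanced_inj_bound]).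
    Where A_m is nonzero, R_m inherits a bound because A is projective over R ([inj_bound_base]). As
    Hom_A(-, Hom_R(A, R)) = Hom_R(-, R), the module Hom_R(A, R) is right bounded
    ([dual_right_bounded]), hence left bounded, hence perfect at m. Tensoring a right resolution
    with it and dualizing into R gives Hom into A, and this bounds the right injective dimension
    ([dual_inj_bound]).

    Ext and Tor are not constructed: [hom_exact], [ext1_zero] and [tor_zero] express their vanishing
    up to a central multiplicative set, and Hom in the derived category is computed by homotopy
    classes of chain maps out of a free resolution ([dhom_trivialP]). *)

Inductive zexp := ZVar of nat | ZZero | ZAdd of zexp & zexp | ZOpp of zexp.

Section ZExp.
Variable V : zmodType.

Fixpoint zeval (s : seq V) e : V :=
  match e with
  | ZVar i => nth 0 s i
  | ZZero => 0
  | ZAdd e f => zeval s e + zeval s f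
  | ZOpp e => - zeval s e
  end.

(** Written with the raw operations of [int], so that the comparison of coefficients in [zexp_eq] is
    decided by conversion. *)
Fixpoint zcoef e (i : nat) : int :=
  match e with
  | ZVar j => if i == j then 1%Z else 0%Z
  | ZZero => 0%Z
  | ZAdd e f => intZmod.addz (zcoef e i) (zcoef f i)
  | ZOpp e => intZmod.oppz (zcoef e i)
  end.

Fixpoint zwf n e : bool :=
  match e with
  | ZVar j => (j < n)%N
  | ZZero => true
  | ZAdd e f => zwf n e && zwf n f
  | ZOpp e => zwf n e
  end.

Lemma zevalE s e : zwf (size s) e ->
  zeval s e = \sum_(i < size s) s`_i *~ zcoef e i.
Proof.
elim: e => [j|_|e IHe f IHf|e IHe] /=.
- move=> jn; rewrite (bigD1 (Ordinal jn)) //= eqxx mulr1z big1 ?addr0 // => i.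
  by rewrite -val_eqE /= => /negbTE ->; rewrite mulr0z.
- by rewrite big1 // => i _; rewrite mulr0z.
- move=> /andP[we wf]; rewrite IHe // IHf // -big_split.
  by apply: eq_bigr => i _; rewrite /= -mulrzDr.
- move=> we; rewrite IHe // -sumrN; apply: eq_bigr => i _.
  by rewrite -mulrNz.
Qed.

Lemma zexp_eq s e f : let n := size s in
  [&& zwf n e, zwf n f & all (fun i => zcoef e i == zcoef f i) (iota 0 n)] ->
  zeval s e = zeval s f.
Proof.
move=> n /and3P[we wf /allP ef]; rewrite !zevalE //; apply: eq_bigr => i _.
by have /eqP -> : zcoef e i == zcoef f i by apply: ef; rewrite mem_iota /= add0n.
Qed.

End ZExp.

Ltac zindex x s :=
  lazymatch s with
  | ?y :: ?s =>
    match goal with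
    | _ => let _ := match goal with _ => unify x y end in constr:(0%N)
    | _ => let n := zindex x s in constr:(S n)
    end
  end.
Ltac zinsert x s :=
  match goal with
  | _ => let _ := zindex x s in s
  | _ => constr:(x :: s)
  end.
Ltac zatoms V e s :=
  lazymatch e with
  | @GRing.add _ ?a ?b => let s := zatoms V a s in zatoms V b s
  | @GRing.opp _ ?a => zatoms V a s
  | @GRing.zero _ => s
  | _ => zinsert e s
  end.
Ltac zquote e s :=
  lazymatch e with
  | @GRing.add _ ?a ?b =>
      let a := zquote a s in let b := zquote b s in constr:(ZAdd a b)
  | @GRing.opp _ ?a => let a := zquote a s in constr:(ZOpp a)
  | @GRing.zero _ => constr:(ZZero)
  | _ => let n := zindex e s in constr:(ZVar n)
  end.
Ltac abel :=
  lazymatch goal with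
  | |- @eq ?T ?a ?b =>
    let s := zatoms T a (@nil T) in let s := zatoms T b s in
    let e := zquote a s in let f := zquote b s in
    exact: (@zexp_eq _ s e f isT)
  end.

(** * Submodules, quotients and linear maps *)

Record submod (A : pzRingType) (M : lmodType A) := Submod {
  sm :> M -> Prop;
  sm0 : sm 0;
  smD : forall x y, sm x -> sm y -> sm (x + y);
  smZ : forall a x, sm x -> sm (a *: x)
}.

Definition Lin (A : pzRingType) (U V : lmodType A) (F : U -> V)
    (HF : linear F) : {linear U -> V} :=
  HB.pack F (GRing.isLinear.Build A U V *:%R F HF).

Section Submodules.
Variable A : pzRingType.
Implicit Types (M N U V W : lmodType A).

Lemma smN M (D : submod M) x : D x -> D (- x).
Proof. by move=> Dx; rewrite -scaleN1r; apply: smZ. Qed.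

Lemma smB M (D : submod M) x y : D x -> D y -> D (x - y).
Proof. by move=> Dx Dy; apply: smD => //; apply: smN. Qed.

Lemma sm_sum M (D : submod M) (I : finType) (F : I -> M) :
  (forall i, D (F i)) -> D (\sum_i F i).
Proof. by move=> DF; elim/big_ind: _ => //; [apply: sm0 | apply: smD]. Qed.

Definition sm_bot M : submod M.
Proof.
exists (fun x => x = 0) => // [x y -> ->|a x ->]; by rewrite ?addr0 ?scaler0.
Defined.

Definition sm_top M : submod M.
Proof. by exists (fun=> True). Defined.

Definition sm_preim M N (f : {linear M -> N}) (D : submod N) : submod M.
Proof.
exists (fun x => D (f x)); first by rewrite linear0; apply: sm0.
- by move=> x y Dx Dy; rewrite linearD; apply: smD.
- by move=> a x Dx; rewrite linearZ; apply: smZ.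
Defined.

Definition sm_ker M N (f : {linear M -> N}) := sm_preim f (sm_bot N).

Definition sm_range M N (f : {linear M -> N}) : submod N.
Proof.
exists (fun y => exists x, f x = y); first by exists 0; rewrite linear0.
- by move=> _ _ [x <-] [y <-]; exists (x + y); rewrite linearD.
- by move=> a _ [x <-]; exists (a *: x); rewrite linearZ.
Defined.

Definition sm_cap M (D E : submod M) : submod M.
Proof.
exists (fun x => D x /\ E x); first by split; apply: sm0.
- by move=> x y [? ?] [? ?]; split; apply: smD.
- by move=> a x [? ?]; split; apply: smZ.
Defined.

Definition sm_add M (D E : submod M) : submod M.
Proof.
exists (fun x => exists2 y, E y & D (x - y)).
- by exists 0; [apply: sm0 | rewrite subr0; apply: sm0].
- move=> x x' [y Ey Dx] [y' Ey' Dx']; exists (y + y'); first exact: smD.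
  have -> : x + x' - (y + y') = (x - y) + (x' - y') by abel.
  exact: smD.
- move=> a x [y Ey Dx]; exists (a *: y); first exact: smZ.
  by rewrite -scalerBr; apply: smZ.
Defined.

Definition sm_prod M N (D : submod M) (E : submod N) :
  submod (M * N)%type.
Proof.
exists (fun z => D z.1 /\ E z.2); first by split; apply: sm0.
- by move=> x y [? ?] [? ?]; split; apply: smD.
- by move=> a x [? ?]; split; apply: smZ.
Defined.

End Submodules.

Section SubmoduleType.
Variables (A : pzRingType) (M : lmodType A) (D : submod M).

Definition subm := {x : M | `[< D x >]}.

HB.instance Definition _ := SubType.on subm.
HB.instance Definition _ := Choice.on subm.

Lemma submP (x : subm) : D (val x).
Proof. by apply/asboolP; apply: (valP x). Qed.

Definition subm_of x (Dx : D x) : subm := Sub x (asboolT Dx).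

Definition subm_zero := subm_of (sm0 D).
Definition subm_add (x y : subm) := subm_of (smD (submP x) (submP y)).
Definition subm_opp (x : subm) := subm_of (smN (submP x)).
Definition subm_scale a (x : subm) := subm_of (smZ a (submP x)).

Fact subm_addA : associative subm_add.
Proof. by move=> x y z; apply: val_inj; apply: addrA. Qed.
Fact subm_addC : commutative subm_add.
Proof. by move=> x y; apply: val_inj; apply: addrC. Qed.
Fact subm_add0 : left_id subm_zero subm_add.
Proof. by move=> x; apply: val_inj; apply: add0r. Qed.
Fact subm_addN : left_inverse subm_zero subm_opp subm_add.
Proof. by move=> x; apply: val_inj; apply: addNr. Qed.

HB.instance Definition _ := GRing.isZmodule.Build subm
  subm_addA subm_addC subm_add0 subm_addN.

Fact subm_scaleA a b (x : subm) :
  subm_scale a (subm_scale b x) = subm_scale (a * b) x.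
Proof. by apply: val_inj; apply: scalerA. Qed.
Fact subm_scale1 : left_id 1 subm_scale.
Proof. by move=> x; apply: val_inj; apply: scale1r. Qed.
Fact subm_scaleDr : right_distributive subm_scale +%R.
Proof. by move=> a x y; apply: val_inj; apply: scalerDr. Qed.
Fact subm_scaleDl (x : subm) : {morph subm_scale^~ x : a b / a + b}.
Proof. by move=> a b; apply: val_inj; apply: scalerDl. Qed.

HB.instance Definition _ := GRing.Zmodule_isLmodule.Build A subm
  subm_scaleA subm_scale1 subm_scaleDr subm_scaleDl.

Fact subm_val_linear : linear (val : subm -> M).
Proof. by []. Qed.

Fact subm_val_key : {f : {linear subm -> M} | f =1 val}.
Proof. by exists (Lin subm_val_linear). Qed.

(* Sealed, so that simplification does not unfold it. *)
Definition subm_val := sval subm_val_key.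

Lemma subm_valE x : subm_val x = val x.
Proof. exact: (svalP subm_val_key). Qed.

Lemma subm_val_inj : injective subm_val.
Proof. by move=> x y; rewrite !subm_valE; apply: val_inj. Qed.

Lemma subm_valP (x : M) : D x <-> exists y, subm_val y = x.
Proof.
split=> [Dx|[y <-]]; last by rewrite subm_valE; apply: submP.
by exists (subm_of Dx); rewrite subm_valE.
Qed.

End SubmoduleType.

Section Quotient.
Local Open Scope quotient_scope.
Variables (A : pzRingType) (M : lmodType A) (D : submod M).

Definition quot_rel (x y : M) := `[< D (x - y) >].

Fact quot_rel_equiv : equiv_class_of quot_rel.
Proof.
split=> [x|x y|y x z].
- by apply/asboolP; rewrite subrr; apply: sm0.
- by apply/asboolP/asboolP => /smN; rewrite opprB.
- move=> /asboolP xy /asboolP yz; apply/asboolP.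
  by have := smD xy yz; rewrite addrA subrK.
Qed.

Canonical quot_equiv := EquivRelPack quot_rel_equiv.

Definition quot := {eq_quot quot_rel}.
HB.instance Definition _ := Choice.on quot.

Definition qpi (x : M) : quot := \pi_({eq_quot quot_rel}) x.

Lemma qpiE x y : qpi x = qpi y <-> D (x - y).
Proof.
split=> [/eqP|Dxy]; first by rewrite /qpi eqmodE => /asboolP.
by apply/eqP; rewrite /qpi eqmodE; apply/asboolP.
Qed.

Definition qrepr (u : quot) : M := repr (u : {eq_quot quot_rel}).

Lemma qreprK u : qpi (qrepr u) = u.
Proof. exact: reprK. Qed.

Definition quot_add u v := qpi (qrepr u + qrepr v).
Definition quot_opp u := qpi (- qrepr u).
Definition quot_scale a u := qpi (a *: qrepr u).

Fact quot_addE x y : quot_add (qpi x) (qpi y) = qpi (x + y).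
Proof.
apply/qpiE; rewrite opprD addrACA.
by apply: smD; apply/qpiE; rewrite qreprK.
Qed.

Fact quot_oppE x : quot_opp (qpi x) = qpi (- x).
Proof. by apply/qpiE; rewrite -opprD; apply: smN; apply/qpiE; rewrite qreprK. Qed.

Fact quot_scaleE a x : quot_scale a (qpi x) = qpi (a *: x).
Proof. by apply/qpiE; rewrite -scalerBr; apply: smZ; apply/qpiE; rewrite qreprK. Qed.

Fact quot_addA : associative quot_add.
Proof.
move=> u v w; rewrite -[u]qreprK -[v]qreprK -[w]qreprK.
by rewrite !quot_addE addrA.
Qed.
Fact quot_addC : commutative quot_add.
Proof. by move=> u v; rewrite -[u]qreprK -[v]qreprK !quot_addE addrC. Qed.
Fact quot_add0 : left_id (qpi 0) quot_add.
Proof. by move=> u; rewrite -[u]qreprK quot_addE add0r. Qed.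
Fact quot_addN : left_inverse (qpi 0) quot_opp quot_add.
Proof. by move=> u; rewrite -[u]qreprK quot_oppE quot_addE addNr. Qed.

HB.instance Definition _ := GRing.isZmodule.Build quot
  quot_addA quot_addC quot_add0 quot_addN.

Fact quot_scaleA a b (u : quot) :
  quot_scale a (quot_scale b u) = quot_scale (a * b) u.
Proof. by rewrite -[u]qreprK !quot_scaleE scalerA. Qed.
Fact quot_scale1 : left_id 1 quot_scale.
Proof. by move=> u; rewrite -[u]qreprK !quot_scaleE scale1r. Qed.
Fact quot_scaleDr : right_distributive quot_scale +%R.
Proof.
move=> a u v; rewrite -[u]qreprK -[v]qreprK.
by rewrite [X in quot_scale _ X]quot_addE !quot_scaleE scalerDr [RHS]quot_addE.
Qed.
Fact quot_scaleDl (u : quot) : {morph quot_scale^~ u : a b / a + b}.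
Proof.
by move=> a b; rewrite -[u]qreprK !quot_scaleE scalerDl [RHS]quot_addE.
Qed.

HB.instance Definition _ := GRing.Zmodule_isLmodule.Build A quot
  quot_scaleA quot_scale1 quot_scaleDr quot_scaleDl.

Fact qpi_linear : linear qpi.
Proof. by move=> a x y; rewrite -quot_addE -quot_scaleE. Qed.

Fact qproj_key : {f : {linear M -> quot} | f =1 qpi}.
Proof. by exists (Lin qpi_linear). Qed.

Definition qproj := sval qproj_key.

Lemma qprojE x : qproj x = qpi x.
Proof. exact: (svalP qproj_key). Qed.

Lemma qproj_surj (u : quot) : exists x, qproj x = u.
Proof. by exists (qrepr u); rewrite qprojE qreprK. Qed.

Lemma qproj_eq x y : qproj x = qproj y <-> D (x - y).
Proof. by rewrite !qprojE; apply: qpiE. Qed.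

Lemma qproj_eq0 x : qproj x = 0 <-> D x.
Proof. by have := qproj_eq x 0; rewrite linear0 subr0. Qed.

End Quotient.

Section LinearMaps.
Variable A : pzRingType.
Implicit Types (C I M N P U V W : lmodType A).

Lemma linZ U V (f : {linear U -> V}) a x : f (a *: x) = a *: f x.
Proof. exact: linearZ. Qed.

Lemma surj_factor U V W (p : {linear U -> V}) (f : {linear U -> W}) :
  (forall y, exists x, p x = y) -> (forall x, p x = 0 -> f x = 0) ->
  exists g : {linear V -> W}, forall x, g (p x) = f x.
Proof.
move=> p_surj pf; have [s sP] := choice p_surj.
have fs x : f (s (p x)) = f x.
  by apply/eqP; rewrite -subr_eq0 -linearB pf // linearB sP subrr.
have lin : linear (f \o s).
  move=> a x y /=; rewrite -linearP -[RHS]fs; congr (f (s _)).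
  by rewrite linearP !sP.
by exists (Lin lin); apply: fs.
Qed.

Lemma inj_corestrict C I W (e : {linear C -> I}) (f : {linear W -> I}) :
  injective e -> (forall x, exists y, e y = f x) ->
  exists c : {linear W -> C}, forall x, e (c x) = f x.
Proof.
move=> e_inj /choice[c cP].
have lin : linear c by move=> a x y; apply: e_inj; rewrite linearP !cP linearP.
by exists (Lin lin).
Qed.

(** Both maps factor through the quotient by the kernel of [d], which embeds in [W]. *)
Lemma inj_factor I V W (d : {linear V -> W}) (a : {linear V -> I}) :
  injective_module I -> (forall x, d x = 0 -> a x = 0) ->
  exists g : {linear W -> I}, forall x, g (d x) = a x.
Proof.
move=> I_inj da; pose K := sm_ker d.
have [d' d'E] : exists d' : {linear quot K -> W}, forall x, d' (qproj K x) = d x.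
  by apply: surj_factor (@qproj_surj _ _ K) _ => x /qproj_eq0.
have [a' a'E] : exists a' : {linear quot K -> I}, forall x, a' (qproj K x) = a x.
  by apply: surj_factor (@qproj_surj _ _ K) _ => x /qproj_eq0; apply: da.
have d'_inj : injective d'.
  move=> u v; have [x <-] := qproj_surj u; have [y <-] := qproj_surj v.
  rewrite !d'E => dxy; apply/qproj_eq => /=.
  by rewrite linearB dxy subrr.
have [g gE] := I_inj _ _ d' a' d'_inj.
by exists g => x; rewrite -d'E gE a'E.
Qed.

(** The finite form of the dual basis criterion for projectivity; see [dual_basis_lift] and
    [projective_dual_basis]. *)
Definition dual_basis P := exists (n : nat) (e : 'I_n -> P)
  (l : 'I_n -> {linear P -> A^o}), forall x, x = \sum_k (l k x : A) *: e k.

Lemma dual_basis_lift P U V (f : {linear U -> V}) (g : {linear P -> V}) :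
  dual_basis P -> (forall x, exists u, f u = g x) ->
  exists h : {linear P -> U}, forall x, f (h x) = g x.
Proof.
move=> [n [e [l lP]]] fg; have [s sP] := choice (fun k => fg (e k)).
have lin : linear (fun x => \sum_k (l k x : A) *: s k).
  move=> a x y; rewrite scaler_sumr -big_split; apply: eq_bigr => k _ /=.
  by rewrite linearP scalerDl scalerA.
exists (Lin lin) => x /=; rewrite linear_sum [in RHS](lP x) linear_sum.
by apply: eq_bigr => k _; rewrite !linearZ sP.
Qed.

Lemma rv_basis n (x : 'rV[A]_n) : x = \sum_i x 0 i *: delta_mx 0 i.
Proof. exact: row_sum_delta. Qed.

Fact rvlin_subproof M n (e : 'I_n -> M) :
  linear (fun x : 'rV[A]_n => \sum_i x 0 i *: e i).
Proof.
move=> a x y; rewrite scaler_sumr -big_split; apply: eq_bigr => k _ /=.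
by rewrite !mxE scalerDl scalerA.
Qed.

Definition rvlin M n (e : 'I_n -> M) : {linear 'rV[A]_n -> M} :=
  Lin (rvlin_subproof e).

Lemma rv_dual_basis n : dual_basis 'rV[A]_n.
Proof.
have lin k : linear (fun x : 'rV[A]_n => x 0 k : A^o).
  by move=> a x y; rewrite !mxE.
exists n, (fun k => delta_mx 0 k), (fun k => Lin (lin k)) => x.
exact: rv_basis.
Qed.

Lemma fg_rv n : fg_module 'rV[A]_n.
Proof. by exists n, (delta_mx 0) => x; exists (x 0); apply: rv_basis. Qed.

Lemma fg_surj M N (f : {linear M -> N}) :
  (forall y, exists x, f x = y) -> fg_module M -> fg_module N.
Proof.
move=> f_surj [n [e eP]]; exists n, (fun i => f (e i)) => y.
have [x <-] := f_surj y; have [c ->] := eP x; exists c.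
by rewrite linear_sum; apply: eq_bigr => i _; rewrite linearZ.
Qed.

Lemma fgP M : fg_module M <->
  exists (n : nat) (f : {linear 'rV[A]_n -> M}), forall y, exists x, f x = y.
Proof.
split=> [[n [e eP]]|[n [f fP]]]; last exact: fg_surj fP (fg_rv n).
exists n, (rvlin e) => y; have [c ->] := eP y; exists (\row_i c i) => /=.
by apply: eq_bigr => i _; rewrite mxE.
Qed.

Lemma dual_basis_prod P U : dual_basis P -> dual_basis U ->
  dual_basis (P * U)%type.
Proof.
move=> [m [e [l lP]]] [n [e' [l' l'P]]].
have linL k : linear (fun z : P * U => l k z.1).
  by move=> a x y; rewrite /= linearP.
have linR k : linear (fun z : P * U => l' k z.2).
  by move=> a x y; rewrite /= linearP.
exists (m + n)%N, (fun k => match split k with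
  inl j => (e j, 0) | inr j => (0, e' j) end),
  (fun k => match split k with inl j => Lin (linL j) | inr j => Lin (linR j) end).
move=> [x y]; rewrite big_split_ord /=.
have splitL j : split (lshift n j) = inl j :> 'I_m + 'I_n.
  exact: (unsplitK (inl j)).
have splitR j : split (rshift m j) = inr j :> 'I_m + 'I_n.
  exact: (unsplitK (inr j)).
under eq_bigr do rewrite splitL; under [X in _ + X]eq_bigr do rewrite splitR.
rewrite [LHS]surjective_pairing [RHS]surjective_pairing /= !(linear_sum fst) !(linear_sum snd) /=.
congr (_, _).
  by rewrite [X in _ + X]big1 ?addr0 => [|j _]; [apply: lP | rewrite scaler0].
by rewrite [X in X + _]big1 ?add0r => [|j _]; [apply: l'P | rewrite scaler0].
Qed.

Lemma fg_dual_basis P : dual_basis P -> fg_module P.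
Proof. by move=> [n [e [l lP]]]; exists n, e => x; exists (l^~ x); apply: lP. Qed.

Lemma fg_prod M N : fg_module M -> fg_module N -> fg_module (M * N)%type.
Proof.
move=> /fgP[m [f fP]] /fgP[n [g gP]].
have lin : linear (fun z : 'rV[A]_m * 'rV[A]_n => (f z.1, g z.2)).
  by move=> a x y; rewrite /= !linearP.
apply: (@fg_surj _ _ (Lin lin)) => [[x y]|].
  by have [u <-] := fP x; have [v <-] := gP y; exists (u, v).
exact: fg_dual_basis (dual_basis_prod (rv_dual_basis m) (rv_dual_basis n)).
Qed.

End LinearMaps.

(** * Noetherian rings *)

Section Noetherian.
Variable A : pzRingType.
Hypothesis A_noetherian : left_noetherian A.

(** Finite generation of [D] modulo [B]; [B] is not asked to lie in [D]. *)
Definition fg_mod (V : lmodType A) (D B : submod V) :=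
  exists (I : finType) (v : I -> V), (forall i, D (v i)) /\
    forall x, D x -> exists c : I -> A, B (x - \sum_i c i *: v i).

(* Induction on the number of generators of the ambient module: the last      *)
(* coefficients of the elements of [D] form a left ideal.                     *)
Lemma noetherian_fg_mod (V : lmodType A) (D B : submod V) n (e : 'I_n -> V) :
  (forall x, D x -> exists c : 'I_n -> A, B (x - \sum_i c i *: e i)) ->
  fg_mod D B.
Proof.
elim: n D e => [|n IHn] D e De.
  exists void, (fun i : void => match i with end).
  split=> [[]|x Dx]; exists (fun=> 0); have [c] := De x Dx.
  by congr (B (_ - _)); rewrite big_ord0 big1 // => -[].
pose e' (i : 'I_n) := e (widen_ord (leqnSn n) i).
pose J (a : A) := exists x (c : 'I_n -> A),
  D x /\ B (x - (\sum_i c i *: e' i + a *: e ord_max)).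
have J_ideal : left_ideal J.
  split.
  - exists 0, (fun=> 0); split; first exact: sm0.
    rewrite big1 ?scale0r ?addr0 ?subr0; first exact: sm0.
    by move=> i _; rewrite scale0r.
  - move=> a b [x [c [Dx Bx]]] [y [d [Dy By]]].
    exists (x + y), (fun i => c i + d i); split; first exact: smD.
    have := smD Bx By; rewrite addrACA -opprD addrACA -big_split -scalerDl /=.
    by under eq_bigr do rewrite -scalerDl.
  - move=> a b [x [c [Dx Bx]]]; exists (a *: x), (fun i => a * c i).
    split; first exact: smZ.
    have := smZ a Bx; rewrite scalerBr scalerDr scaler_sumr scalerA.
    by under eq_bigr do rewrite scalerA.
have [t [a [Ja aP]]] := A_noetherian J_ideal.
have [x xP] := choice Ja; have [c cP] := choice xP.
(* These elements of [D] need only the first n generators modulo [B]; the [x k] take care of the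
   last coefficient. *)
pose D' := sm_cap D (sm_add B (sm_range (rvlin e'))).
have [|I [v [Dv vP]]] := IHn D' e'.
  by move=> y [_ [_ [u <-] Bu]]; exists (u 0).
exists ('I_t + I)%type, (fun k => match k with inl k => x k | inr i => v i end).
split=> [[k|i]|y Dy]; first by have [] := cP k.
  by have [] := Dv i.
have [d Bd] := De y Dy.
have Jd : J (d ord_max).
  exists y, (fun i => d (widen_ord (leqnSn n) i)); split=> //.
  by move: Bd; rewrite big_ord_recr.
have [k kE] := aP _ Jd.
have Bz : B (\sum_i k i *: x i - (\sum_i (\sum_j k j * c j i) *: e' i
             + d ord_max *: e ord_max)).
  have -> : \sum_i (\sum_j k j * c j i) *: e' i + d ord_max *: e ord_max =
      \sum_j k j *: (\sum_i c j i *: e' i + a j *: e ord_max).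
    rewrite kE scaler_suml; under [X in X + _]eq_bigr do rewrite scaler_suml.
    rewrite exchange_big -big_split /=; apply: eq_bigr => j _.
    rewrite scalerDr scaler_sumr scalerA; congr (_ + _).
    by apply: eq_bigr => i _; rewrite scalerA.
  rewrite -sumrB; apply: sm_sum => j; rewrite -scalerBr; apply: smZ.
  by have [] := cP j.
have D'y : D' (y - \sum_j k j *: x j).
  split.
    by apply: smB => //; apply: sm_sum => j; apply: smZ; have [] := cP j.
  exists (\sum_i (d (widen_ord (leqnSn n) i) - \sum_j k j * c j i) *: e' i).
    exists (\row_i (d (widen_ord (leqnSn n) i) - \sum_j k j * c j i)).
    by apply: eq_bigr => i _; rewrite mxE.
  move: Bd; rewrite big_ord_recr /= => /smB - /(_ _ Bz).
  congr (B _); under [X in _ = _ - X]eq_bigr do rewrite scalerBl.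
  by rewrite sumrB; abel.
have [l lP] := vP _ D'y.
exists (fun i => match i with inl i => k i | inr i => l i end).
by rewrite big_sumType /= opprD addrA.
Qed.

Lemma fg_submod (M : lmodType A) (D : submod M) : fg_module M ->
  exists (n : nat) (v : 'I_n -> M), (forall i, D (v i)) /\
    forall x, D x -> exists c : 'I_n -> A, x = \sum_i c i *: v i.
Proof.
move=> [n [e eP]].
have [|I [v [Dv vP]]] := @noetherian_fg_mod M D (sm_bot M) n e.
  by move=> x _; have [c ->] := eP x; exists c; rewrite /= subrr.
exists #|I|, (fun i => v (enum_val i)); split=> // x Dx.
have [c /eqP] := vP x Dx; rewrite subr_eq0 => /eqP ->.
by exists (fun i => c (enum_val i)); rewrite [LHS](reindex_onto enum_val enum_rank)
  => [|i _]; [apply: eq_bigl => i; rewrite enum_valK eqxx | rewrite enum_rankK].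
Qed.

Lemma fg_subm (M : lmodType A) (D : submod M) : fg_module M -> fg_module (subm D).
Proof.
move=> /(fg_submod D)[n [v [Dv vP]]]; exists n, (fun i => subm_of (Dv i)) => x.
have [c cE] := vP _ (submP x); exists c.
apply: (@subm_val_inj _ _ D); rewrite linear_sum subm_valE cE.
by apply: eq_bigr => i _; rewrite linZ subm_valE.
Qed.

(** Otherwise dependent choice yields a strictly ascending chain in [F]; its union is finitely
    generated, so it is reached at a finite stage. *)
Lemma noetherian_max (M : lmodType A) (F : submod M -> Prop) (D0 : submod M) :
  fg_module M -> F D0 ->
  exists2 D, F D & forall E, F E -> (forall x, D x -> E x) -> forall x, E x -> D x.
Proof.
move=> M_fg FD0; apply: contrapT => noMax.
have next (D : {D | F D}) : exists E : {D | F D},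
    (forall x, sval D x -> sval E x) /\ exists2 x, sval E x & ~ sval D x.
  apply: contrapT => noE; apply: noMax; exists (sval D) => [|E FE DE x Ex].
    exact: svalP D.
  by apply: contrapT => nDx; apply: noE; exists (exist _ E FE); split=> //; exists x.
have [f fP] := choice next.
pose c i : submod M := sval (iter i f (exist _ D0 FD0)).
have c_le i j x : (i <= j)%N -> c i x -> c j x.
  move=> /subnK <-; elim: (j - i)%N => // k IHk /IHk.
  by case: (fP (iter (k + i) f (exist _ D0 FD0))) => + _; apply.
have [U UE] : exists U : submod M, forall x, U x <-> exists i, c i x.
  unshelve eexists (Submod (sm := fun x => exists i, c i x) _ _ _) => //.
  - by exists 0%N; apply: sm0.
  - move=> x y [i cx] [j cy]; exists (maxn i j); apply: smD.
      exact: c_le (leq_maxl i j) cx.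
    exact: c_le (leq_maxr i j) cy.
  - by move=> a x [i cx]; exists i; apply: smZ.
have [n [v [Uv vP]]] := fg_submod U M_fg.
have [i iP] := choice (fun k => (UE _).1 (Uv k)).
pose N := \max_k i k.
have [_ [x cx]] := fP (iter N f (exist _ D0 FD0)); apply.
have [k ->] : exists k : 'I_n -> A, x = \sum_i k i *: v i.
  by apply: vP; apply/UE; exists N.+1.
by apply: sm_sum => k'; apply: smZ; apply: c_le (iP k'); apply: leq_bigmax.
Qed.

End Noetherian.

(** * Enough injective modules *)

Section Baer.
Variables (A : pzRingType) (C : lmodType A).
Hypothesis C_baer : forall (J : A -> Prop) (phi : A -> C), left_ideal J ->
  (forall x y, J x -> J y -> phi (x + y) = phi x + phi y) ->
  (forall a x, J x -> phi (a * x) = a *: phi x) ->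
  exists c, forall x, J x -> phi x = x *: c.

(* Zorn's lemma on the partial extensions, represented by their graphs. *)
Lemma baer : injective_module C.
Proof.
move=> M N f g f_inj.
pose good (G : submod (N * C)%type) :=
  (forall m, G (f m, g m)) /\ (forall y, G (0, y) -> y = 0).
have lin : linear (fun m => (f m, g m) : N * C) by move=> a x y; rewrite !linearP.
have G0 : good (sm_range (Lin lin)).
  split=> [m|y [m /= [fm0 <-]]]; first by exists m.
  by rewrite (f_inj m 0) ?linear0.
pose R (G H : {G | good G}) := `[< forall z, sval G z -> sval H z >].
have [||F Ftot|[G [Gfg G0y]] Gmax] := @ZL_preorder {G | good G} (exist _ _ G0) R.
- by move=> G; apply/asboolP.
- by move=> G H K /asboolP HG /asboolP GK; apply/asboolP => z /HG /GK.
- have [[H FH]|noF] := pselect (exists H, F H); last first.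
    by exists (exist _ _ G0) => H FH; case: noF; exists H.
  have comp (G K : {G | good G}) : F G -> F K -> exists L : {G | good G},
      [/\ F L, forall z, sval G z -> sval L z & forall z, sval K z -> sval L z].
    move=> FG FK; have [/asboolP GK|/asboolP KG] := Ftot G K FG FK.
      by exists K.
    by exists G.
  unshelve epose (U := @Submod A (N * C)%type
    (fun z => exists2 G, F G & sval G z) _ _ _).
  + by exists H => //; apply: sm0.
  + move=> x y [G FG Gx] [K FK Ky]; have [L [FL GL KL]] := comp G K FG FK.
    by exists L => //; apply: smD; [apply: GL | apply: KL].
  + by move=> a x [G FG Gx]; exists G => //; apply: smZ.
  have Ugood : good U.
    split=> [m|y [G FG Gy]]; last by have [_] := svalP G; apply.
    by exists H => //; have [+ _] := svalP H; apply.
  by exists (exist _ U Ugood) => G FG; apply/asboolP => z Gz; exists G.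
have Gfun x y y' : G (x, y) -> G (x, y') -> y = y'.
  move=> Gy Gy'; apply/eqP; rewrite -subr_eq0; apply/eqP/G0y.
  by have := smB Gy Gy'; rewrite /= -[_ - _]/(x - x, y - y') subrr.
have Gtot n : exists y, G (n, y).
  (* The ideal of multipliers of [n] into the domain of [G]. The hypothesis on ideals provides a
     value [c] for [n], and [H] below is the graph enlarged by (n, c). *)
  pose J a := exists y, G (a *: n, y).
  have J_ideal : left_ideal J.
    split; first by exists 0; rewrite scale0r; apply: (sm0 G).
      by move=> a b [y Gy] [z Gz]; exists (y + z); rewrite scalerDl; apply: (smD Gy Gz).
    by move=> a b [y Gy]; exists (a *: y); rewrite -scalerA; apply: (smZ a Gy).
  have [phi phiP] : exists phi, forall a, J a -> G (a *: n, phi a).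
    have : forall a, exists y, J a -> G (a *: n, y).
      move=> a; have [[y Gy]|nJ] := pselect (J a); first by exists y.
      by exists 0 => /nJ.
    by move=> /choice[phi phiP]; exists phi.
  have [_ JD JM] := J_ideal.
  have [|a x Jx|c cP] := C_baer J_ideal (phi := phi).
  - move=> a b Ja Jb; apply: Gfun (phiP _ (JD _ _ Ja Jb)) _.
    by rewrite scalerDl; apply: (smD (phiP _ Ja) (phiP _ Jb)).
  - apply: Gfun (phiP _ (JM a x Jx)) _.
    by rewrite -scalerA; apply: (smZ a (phiP _ Jx)).
  have linc : linear (fun a : A^o => ((a : A) *: n, (a : A) *: c) : N * C).
    move=> a x y; rewrite /= -[RHS]/(_ + _, _ + _) /=.
    by rewrite !scalerDl -!scalerA.
  pose H := sm_add G (sm_range (Lin linc)).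
  have GH z : G z -> H z.
    by move=> Gz; exists 0; [exists 0; rewrite linear0 | rewrite subr0].
  have Hgood : good H.
    split=> [m|y [_ [a0 <-]]]; first exact: GH.
    pose a : A := a0; rewrite -/a.
    rewrite /= -[_ - _]/(0 - a *: n, y - a *: c) sub0r => Gay.
    have := smN Gay; rewrite -[- _]/(- - (a *: n), - (y - a *: c)) opprK opprB => Gay'.
    have Ja : J a by exists (a *: c - y).
    have := smD Gay (phiP _ Ja); rewrite (cP _ Ja).
    by rewrite -[_ + _]/(_ + _, _ + _) /= addNr subrK => /G0y.
  have /asboolP HG : R (exist _ H Hgood) (exist _ G (conj Gfg G0y)).
    by apply: Gmax; apply/asboolP => z /GH.
  exists c; apply: HG; exists (n, c); first by exists 1; rewrite /= !scale1r.
  by rewrite subrr; apply: sm0.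
have [h hP] := choice Gtot.
have h_lin : linear h.
  move=> a x y; apply: Gfun (hP _) _.
  exact: (smD (smZ a (hP x)) (hP y)).
by exists (Lin h_lin) => m; apply: Gfun (hP _) (Gfg m).
Qed.

End Baer.

(** * Q/Z, an injective cogenerator of abelian groups *)

Definition rat_int : submod (zmodule rat).
Proof.
exists (fun q => exists z : int, q = z%:~R :> rat); first by exists 0.
- by move=> _ _ [x ->] [y ->]; exists (x + y); rewrite rmorphD.
- by move=> a _ [x ->]; exists (x * a); rewrite rmorphM /= mulrzr.
Defined.

Definition QZ : lmodType int := quot rat_int.

Lemma int_ideal (J : int -> Prop) : left_ideal J ->
  (forall x, J x -> x = 0) \/
  exists d : nat, [/\ (0 < d)%N, J d & forall x, J x -> exists k : int, x = k * d%:Z].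
Proof.
move=> [J0 JD JM].
have [[x [Jx x0]]|no] := pselect (exists x, J x /\ x <> 0); last first.
  by left=> x Jx; apply: contrapT => x0; apply: no; exists x.
right; pose P (d : nat) := (0 < d)%N && `[< J d >].
have exP : exists d, P d.
  exists `|x|%N; rewrite /P absz_gt0; apply/andP; split; first exact/eqP.
  apply/asboolP; rewrite abszE; have [_|_] := ger0P x => //.
  by rewrite -mulN1r; apply: JM.
case: (ex_minnP exP) => d /andP[d0 /asboolP Jd] dmin; exists d; split=> // y Jy.
exists (y %/ d%:Z)%Z; have Jm : J (y %% d%:Z)%Z.
  by rewrite /modz -mulNr; apply: JD => //; apply: JM.
have dn0 : d%:Z != 0 by rewrite -lt0n.
rewrite {1}(divz_eq y d); have := modz_ge0 y dn0; have := ltz_mod y dn0.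
case: (y %% d)%Z Jm => // m Jm; rewrite ltz_nat => md _.
case: (posnP m) => [->|m0]; first by rewrite addr0.
by have := dmin m; rewrite /P m0 asboolT // => /(_ isT); rewrite leqNgt md.
Qed.

Lemma QZ_divisible (n : nat) (u : QZ) : (0 < n)%N -> exists v : QZ, n%:Z *: v = u.
Proof.
move=> n0; have [q <-] := qproj_surj u.
exists (qproj rat_int ((q : rat) / n%:R)); rewrite -linearZ; congr (qproj _ _).
rewrite -[LHS]/((q : rat) / n%:R *~ n%:Z) -mulrzr mulfVK //.
by rewrite pnatr_eq0 -lt0n.
Qed.

Lemma QZ_injective : injective_module QZ.
Proof.
apply: baer => J phi J_ideal phiD phiZ.
have [J0|[d [d0 Jd dP]]] := int_ideal J_ideal.
  exists 0 => x Jx; rewrite scaler0 (J0 _ Jx).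
  by have := phiZ 0 x Jx; rewrite mul0r scale0r.
have [v vE] := QZ_divisible (phi d) d0; exists v => x /dP[k ->].
by rewrite phiZ // -vE scalerA.
Qed.

Lemma QZ_linear (U : zmodType) (f : U -> QZ) :
  {morph f : x y / x + y} -> linear (f : zmodule U -> QZ).
Proof.
move=> fD a x y; rewrite fD; congr (_ + _).
have f0 : f 0 = 0 by have := fD 0 0; rewrite addr0 => /eqP;
  rewrite -subr_eq0 opprD addrA subrr sub0r oppr_eq0 => /eqP.
have fn (n : nat) z : f (z *+ n) = n%:Z *: f z.
  elim: n => [|n IHn]; first by rewrite mulr0n scale0r.
  by rewrite mulrS fD IHn -[n.+1]addn1 PoszD scalerDl scale1r addrC.
case: a => n; first exact: fn.
apply/eqP; rewrite NegzE !scaleNr -addr_eq0 -fn -fD.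
by rewrite [X in f X](_ : _ = 0) ?f0 //; apply: addNr.
Qed.

(** On the multiples of [x], send [x] to 1/d with d its order, or to 1/2 if the order is infinite;
    injectivity of Q/Z extends this to [U]. *)
Lemma QZ_cogenerator (U : zmodType) (x : U) : x <> 0 ->
  exists2 f : U -> QZ, {morph f : x y / x + y} & f x <> 0.
Proof.
move=> x0.
have lin_x : linear (fun n : int^o => (n : int) *: (x : zmodule U)).
  by move=> a b c; rewrite scalerDl -scalerA.
have frac_n0 (d : nat) : (1 < d)%N -> qproj rat_int ((d%:R)^-1 : rat) <> 0.
  move=> d1 /qproj_eq0[z /eqP]; have dn0 : d%:R != 0 :> rat.
    by rewrite pnatr_eq0 -lt0n ltnW.
  rewrite -(inj_eq (mulIf dn0)) mulVf // -[d%:R]/(d%:~R) -intrM.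
  rewrite -[1]/(1%:~R) eqr_int => /eqP zd; move: d1.
  have /dvdzP : exists k, 1 = k * d%:Z by exists z.
  by rewrite dvdzE absz1 absz_nat dvdn1 => /eqP ->.
have [q [q0 qP]] : exists q : QZ, q <> 0 /\ forall n : int, x *~ n = 0 -> n *: q = 0.
  have [|J0|[d [d0 Jd dP]]] := @int_ideal (fun n => x *~ n = 0).
  - split=> [|a b|a b] /=; first exact: mulr0z.
      by rewrite mulrzDr => -> ->; rewrite addr0.
    by rewrite mulrC mulrzA => ->; rewrite mul0rz.
  - exists (qproj rat_int (2%:R^-1 : rat)); split; first exact: (frac_n0 2).
    by move=> n /J0 ->; rewrite scale0r.
  exists (qproj rat_int (d%:R^-1 : rat)); split.
    by apply: frac_n0; case: d d0 Jd {dP} => [|[|]].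
  move=> n /dP[k ->]; rewrite -linearZ; apply/qproj_eq0; exists k.
  rewrite -[LHS]/((d%:R^-1 : rat) *~ (k * d%:Z)) -mulrzr intrM mulrC mulfK //.
  by rewrite pnatr_eq0 -lt0n.
have lin_q : linear (fun n : int^o => (n : int) *: q).
  by move=> a b c; rewrite scalerDl -scalerA.
have [f fE] := @inj_factor _ _ _ _ (Lin lin_x) (Lin lin_q) QZ_injective qP.
exists f; first exact: (linearD f).
by have := fE 1; rewrite /= !scale1r => ->.
Qed.

(** * Embedding a module in an injective one; cosyzygies *)

Section Hull.
Variables (A : pzRingType) (M : lmodType A).

Definition hull_index := {f : M -> QZ | {morph f : x y / x + y}}.

(* The product over the characters of M of the coinduced modules              *)
(* Hom_Z(A, Q/Z).                                                             *)
Definition hull :=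
  {f : hull_index -> A -> QZ | forall i x y, f i (x + y) = f i x + f i y}.

HB.instance Definition _ := gen_eqMixin hull.
HB.instance Definition _ := gen_choiceMixin hull.

Lemma hull_eq (f g : hull) : (forall i x, sval f i x = sval g i x) -> f = g.
Proof.
case: f g => f fP [g gP] /= fg; have eq_fg : f = g.
  by apply/funext => i; apply/funext => x.
by move: gP; rewrite -eq_fg => gP; congr exist; apply: Prop_irrelevance.
Qed.

Definition hull_zero : hull.
Proof. by exists (fun _ _ => 0) => *; rewrite addr0. Defined.
Definition hull_add (f g : hull) : hull.
Proof.
exists (fun i x => sval f i x + sval g i x) => i x y.
by rewrite !(svalP f) !(svalP g) addrACA.
Defined.
Definition hull_opp (f : hull) : hull.
Proof. by exists (fun i x => - sval f i x) => i x y; rewrite (svalP f) opprD. Defined.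
Definition hull_scale (a : A) (f : hull) : hull.
Proof. by exists (fun i x => sval f i (x * a)) => i x y; rewrite mulrDl (svalP f). Defined.

Fact hull_addA : associative hull_add.
Proof. by move=> f g h; apply: hull_eq => i x; apply: addrA. Qed.
Fact hull_addC : commutative hull_add.
Proof. by move=> f g; apply: hull_eq => i x; apply: addrC. Qed.
Fact hull_add0 : left_id hull_zero hull_add.
Proof. by move=> f; apply: hull_eq => i x; apply: add0r. Qed.
Fact hull_addN : left_inverse hull_zero hull_opp hull_add.
Proof. by move=> f; apply: hull_eq => i x; apply: addNr. Qed.
HB.instance Definition _ := GRing.isZmodule.Build hull
  hull_addA hull_addC hull_add0 hull_addN.

Fact hull_scaleA a b f : hull_scale a (hull_scale b f) = hull_scale (a * b) f.
Proof. by apply: hull_eq => i x /=; rewrite mulrA. Qed.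
Fact hull_scale1 : left_id 1 hull_scale.
Proof. by move=> f; apply: hull_eq => i x /=; rewrite mulr1. Qed.
Fact hull_scaleDr : right_distributive hull_scale +%R.
Proof. by move=> a f g; apply: hull_eq. Qed.
Fact hull_scaleDl f : {morph hull_scale^~ f : a b / a + b}.
Proof. by move=> a b; apply: hull_eq => i x /=; rewrite mulrDr (svalP f). Qed.
HB.instance Definition _ := GRing.Zmodule_isLmodule.Build A hull
  hull_scaleA hull_scale1 hull_scaleDr hull_scaleDl.

Definition hull_emb_fun (m : M) : hull.
Proof.
exists (fun i x => sval i (x *: m)) => i x y.
by rewrite scalerDl (svalP i).
Defined.

Fact hull_emb_linear : linear hull_emb_fun.
Proof.
by move=> a m n; apply: hull_eq => i x /=; rewrite scalerDr (svalP i) scalerA.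
Qed.

Fact hull_emb_key : {f : {linear M -> hull} | f =1 hull_emb_fun}.
Proof. by exists (Lin hull_emb_linear). Qed.

Definition hull_emb := sval hull_emb_key.

Lemma hull_embE x : hull_emb x = hull_emb_fun x.
Proof. exact: (svalP hull_emb_key). Qed.

Lemma hull_emb_inj : injective hull_emb.
Proof.
move=> m n; rewrite !hull_embE => emn; apply/eqP; rewrite -subr_eq0; apply/eqP.
apply: contrapT => mn0.
have [f fD fmn0] := QZ_cogenerator mn0; apply: fmn0.
have /(congr1 (fun h : hull => sval h (exist _ f fD) 1)) := emn.
rewrite /= !scale1r => fmn; apply: (addIr (f n)).
by rewrite -fD subrK add0r.
Qed.

(** By the coinduction adjunction, a linear map into this product is a family of additive maps into
    Q/Z, read off at 1, and each of them extends separately. *)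
Lemma hull_injective : injective_module hull.
Proof.
move=> U V f g f_inj.
have ext i : exists h : V -> QZ, {morph h : x y / x + y} /\
    forall u, h (f u) = sval (g u) i 1.
  have lin_f : linear (f : zmodule U -> zmodule V).
    by move=> a x y; rewrite -[LHS]/(f ((x : U) *~ a + y)) raddfD raddfMz.
  have lin_g : linear ((fun u => sval (g u) i 1) : zmodule U -> QZ).
    by apply: QZ_linear => x y; rewrite linearD.
  have [h hE] := QZ_injective (f := Lin lin_f) (Lin lin_g) f_inj.
  by exists h; split; [apply: (linearD h) | apply: hE].
have [h hP] := choice ext.
have hx i v x y : h i ((x + y) *: v) = h i (x *: v) + h i (y *: v).
  by rewrite scalerDl; have [-> _] := hP i.
pose H v : hull := exist (fun f : hull_index -> A -> QZ => forall i x y,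
  f i (x + y) = f i x + f i y) (fun i x => h i (x *: v)) (fun i => hx i v).
have lin_H : linear H.
  move=> a v w; apply: hull_eq => i x /=.
  by rewrite scalerDr (proj1 (hP i)) scalerA.
exists (Lin lin_H) => u; apply: hull_eq => i x /=.
by rewrite -linearZ (proj2 (hP i)) linearZ /= mul1r.
Qed.

(** The cosyzygy. Iterating it shifts degrees: Ext^(i+1)(N, M) is Ext^1 of N with values in the i-th
    cosyzygy of M. *)
Definition cosyz : lmodType A := quot (sm_range hull_emb).
Definition cosyz_proj : {linear hull -> cosyz} := qproj _.

Lemma cosyz_surj (y : cosyz) : exists x, cosyz_proj x = y.
Proof. exact: qproj_surj. Qed.

Lemma cosyz_ker (x : hull) : cosyz_proj x = 0 <-> exists y, hull_emb y = x.
Proof. exact: qproj_eq0. Qed.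

Lemma cosyz_emb (y : M) : cosyz_proj (hull_emb y) = 0.
Proof. by apply/cosyz_ker; exists y. Qed.

End Hull.

(** * Vanishing of Ext up to a central multiplicative set *)

Record central_set (A : pzRingType) := CentralSet {
  cs :> A -> Prop;
  cs1 : cs 1;
  csM : forall s t, cs s -> cs t -> cs (s * t);
  csC : forall s, cs s -> forall a, s * a = a * s
}.

(** For this set, statements up to [S] are statements that hold exactly. *)
Definition central_unit (A : pzRingType) : central_set A.
Proof.
exists (fun s => s = 1) => // [s t -> ->|s -> a]; by rewrite ?mulr1 ?mul1r.
Defined.

Section LocalExt.
Variables (A : pzRingType) (S : central_set A).
Implicit Types (C I M N P U V W X : lmodType A).

Definition is_central (s : A) := forall a : A, s * a = a * s.

Fact scale_fun_subproof V W (f : {linear V -> W}) s :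
  is_central s -> linear (fun x => s *: f x).
Proof. by move=> sC a x y; rewrite linearP scalerDr !scalerA sC. Qed.

Definition scale_fun V W (f : {linear V -> W}) s (sC : is_central s) :
  {linear V -> W} := Lin (scale_fun_subproof f sC).

Lemma scaleC s M (x : M) a : S s -> s *: (a *: x) = a *: (s *: x).
Proof. by move=> Ss; rewrite !scalerA (csC Ss). Qed.

Lemma cs_prod (J : finType) (s : J -> A) : (forall j, S (s j)) ->
  exists2 t, S t & forall j, exists2 u, S u & t = u * s j.
Proof.
move=> Ss.
have [t St tP] : exists2 t, S t & forall j, j \in enum J -> exists2 u, S u & t = u * s j.
  elim: (enum J) => [|j l [t St tP]]; first by exists 1; [apply: cs1|].
  exists (t * s j) => [|i]; first exact: csM.
  rewrite inE => /orP[/eqP ->|/tP[u Su ->]]; first by exists t.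
  by exists (u * s j); [exact: csM | rewrite -!mulrA; congr (_ * _); apply: csC (Ss i) _].
by exists t => // j; apply: tP; rewrite mem_enum.
Qed.

Definition loc_exact U V W (d : {linear U -> V}) (d' : {linear V -> W}) :=
  exists2 s, S s & forall x, d' x = 0 -> exists y, s *: x = d y.

Lemma exact_loc_exact U V W (d : {linear U -> V}) (d' : {linear V -> W}) :
  (forall x, d' x = 0 -> exists y, x = d y) -> loc_exact d d'.
Proof. by move=> dd'; exists 1 => [|x /dd'[y yE]]; [apply: cs1 | exists y; rewrite scale1r]. Qed.

(** The kernel is finitely generated, so a common multiple of the denominators of its generators
    serves all its elements. *)
Lemma loc_exact_fg U V W (d : {linear U -> V}) (d' : {linear V -> W}) :
  left_noetherian A -> fg_module V ->
  (forall x, d' x = 0 -> exists2 s, S s & exists y, s *: x = d y) ->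
  loc_exact d d'.
Proof.
move=> A_noeth V_fg dd'; have [n [v [v0 vP]]] := fg_submod A_noeth (sm_ker d') V_fg.
have [s sP] : exists s : 'I_n -> A, forall i, S (s i) /\ exists y, s i *: v i = d y.
  have sP i : exists s, S s /\ exists y, s *: v i = d y.
    by have [s Ss sv] := dd' _ (v0 i); exists s.
  by have [s ?] := choice sP; exists s.
have [t St tP] := cs_prod (fun i => (sP i).1).
have tv i : exists y, t *: v i = d y.
  have [u _ ->] := tP i; have [_ [y sy]] := sP i.
  by exists (u *: y); rewrite linZ -sy scalerA.
have [y yE] := choice tv; exists t => // x /vP[c ->].
exists (\sum_i c i *: y i); rewrite scaler_sumr linear_sum.
by apply: eq_bigr => i _; rewrite linZ -yE scaleC.
Qed.

(* Up to [S], the cohomology of Hom(-, C) vanishes at the middle term of      *)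
(* U -> V -> W.                                                               *)
Definition hom_exact U V W (d : {linear U -> V}) (d' : {linear V -> W}) C :=
  forall b : {linear V -> C}, (forall x, b (d x) = 0) ->
  exists2 s, S s & exists c : {linear W -> C}, forall x, s *: b x = c (d' x).

(* Up to [S], Ext^1(N, C) vanishes. *)
Definition ext1_zero N C :=
  forall f : {linear N -> cosyz C}, exists2 s, S s &
  exists g : {linear N -> hull C}, forall x, s *: f x = cosyz_proj C (g x).

Lemma hull_corestrict W C (f : {linear W -> hull C}) :
  (forall x, cosyz_proj C (f x) = 0) ->
  exists c : {linear W -> C}, forall x, hull_emb C (c x) = f x.
Proof.
move=> pf; apply: inj_corestrict (@hull_emb_inj _ C) _ => x.
exact/cosyz_ker.
Qed.

Lemma hull_factor V W C (d : {linear V -> W}) (a : {linear V -> hull C}) :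
  (forall x, d x = 0 -> a x = 0) ->
  exists g : {linear W -> hull C}, forall x, g (d x) = a x.
Proof. exact/inj_factor/hull_injective. Qed.

Lemma hull_extend U V W (d : {linear U -> V}) (d' : {linear V -> W}) C
    (b : {linear V -> C}) :
  loc_exact d d' -> (forall x, b (d x) = 0) ->
  exists2 s, S s & exists g : {linear W -> hull C},
    forall x, g (d' x) = s *: hull_emb C (b x).
Proof.
move=> [s Ss dd'] bd; exists s => //.
apply: (@hull_factor _ _ _ d' (scale_fun (hull_emb C \o b) (csC Ss))) => x /=.
by move=> /dd'[y sy]; rewrite -!linZ sy /= bd linear0.
Qed.

(** Dimension shift along 0 -> C -> hull C -> cosyz C -> 0: [b] extends to a map into the hull, and
    the vanishing for [cosyz C] corrects that map so that it lands in [C]. *)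
Lemma hom_exact_step U V W X (d : {linear U -> V}) (d' : {linear V -> W})
    (d'' : {linear W -> X}) C :
  loc_exact d d' -> (forall x, d'' (d' x) = 0) -> dual_basis X ->
  hom_exact d' d'' (cosyz C) -> hom_exact d d' C.
Proof.
move=> dd' d'K X_proj HL b bd.
have [s Ss [g gE]] := hull_extend dd' bd.
have [|t St [c cE]] := HL (cosyz_proj C \o g).
  by move=> x /=; rewrite gE linZ cosyz_emb scaler0.
have [h hE] := dual_basis_lift X_proj (fun x => cosyz_surj (c x)).
have [|k kE] := @hull_corestrict _ _ (scale_fun g (csC St) \- (h \o d'')).
  by move=> x; rewrite linearB /= hE -cE linZ subrr.
exists (t * s); first exact: csM.
exists k => x; apply: (@hull_emb_inj _ C).
by rewrite kE /= d'K linear0 subr0 gE linZ scalerA.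
Qed.

(** After extending [b] to a map into the hull, the obstruction to landing in [C] is a map from the
    cokernel of [d'] to [cosyz C], a class in Ext^1. *)
Lemma hom_exact_base U V W (d : {linear U -> V}) (d' : {linear V -> W}) C :
  loc_exact d d' -> fg_module W -> (forall N, fg_module N -> ext1_zero N C) ->
  hom_exact d d' C.
Proof.
move=> dd' W_fg E b bd.
have [s Ss [g gE]] := hull_extend dd' bd.
pose D := sm_range d'.
have [f fE] : exists f : {linear quot D -> cosyz C},
    forall x, f (qproj D x) = cosyz_proj C (g x).
  apply: (@surj_factor _ _ _ _ (qproj D) (cosyz_proj C \o g)).
    exact: qproj_surj.
  by move=> x /qproj_eq0[y <-] /=; rewrite gE linZ cosyz_emb scaler0.
have [t St [h hE]] := E _ (fg_surj (@qproj_surj _ _ D) W_fg) f.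
have [|k kE] := @hull_corestrict _ _ (scale_fun g (csC St) \- (h \o qproj D)).
  by move=> x; rewrite linearB /= -hE -[t *: g x]/(t *: g x) linZ fE subrr.
exists (t * s); first exact: csM.
exists k => x; apply: (@hull_emb_inj _ C); rewrite kE /=.
have -> : qproj D (d' x) = 0 by apply/qproj_eq0; exists x.
by rewrite linear0 subr0 gE linZ scalerA.
Qed.

(** The dimension shift from [C] to [cosyz C]. Here [d''] is the next differential in
    [hom_exact_cosyz] and the augmentation of a resolution in [hom_exact_ext1]. *)
Lemma hom_exact_lift U V W X (d : {linear U -> V}) (d' : {linear V -> W})
    (d'' : {linear W -> X}) C (b : {linear W -> cosyz C}) :
  hom_exact d d' C -> dual_basis W -> (forall x, d' (d x) = 0) ->
  loc_exact d' d'' -> (forall x, b (d' x) = 0) ->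
  exists2 s, S s & exists h : {linear X -> hull C},
    forall x, s *: b x = cosyz_proj C (h (d'' x)).
Proof.
move=> HL W_proj dK d'd'' bd'.
have [g gE] := dual_basis_lift W_proj (fun x => cosyz_surj (b x)).
have [|a aE] := @hull_corestrict _ _ (g \o d'); first by move=> x /=; rewrite gE.
have [|s Ss [c cE]] := HL a.
  by move=> x; apply: (@hull_emb_inj _ C); rewrite aE /= dK !linear0.
pose f : {linear W -> hull C} := scale_fun g (csC Ss) \- (hull_emb C \o c).
have fd' x : f (d' x) = 0 by rewrite /= -cE -[g _]aE linZ subrr.
have [t St tP] := d'd''.
have [|h hE] := @hull_factor _ _ _ d'' (scale_fun f (csC St)).
  by move=> x /tP[y ty]; rewrite -[LHS]linZ ty fd'.
exists (t * s); first exact: csM.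
exists h => x; have -> : h (d'' x) = t *: (s *: g x - hull_emb C (c x)) by rewrite hE.
by rewrite linZ linearB linZ cosyz_emb subr0 gE scalerA.
Qed.

Lemma hom_exact_cosyz U V W X (d : {linear U -> V}) (d' : {linear V -> W})
    (d'' : {linear W -> X}) C :
  hom_exact d d' C -> dual_basis W -> (forall x, d' (d x) = 0) ->
  loc_exact d' d'' -> hom_exact d' d'' (cosyz C).
Proof.
move=> HL W_proj dK d'd'' b bd'.
have [s Ss [h hE]] := hom_exact_lift HL W_proj dK d'd'' bd'.
by exists s => //; exists (cosyz_proj C \o h).
Qed.

Lemma hom_exact_ext1 U V W N (d : {linear U -> V}) (d' : {linear V -> W})
    (p : {linear W -> N}) C :
  hom_exact d d' C -> dual_basis W -> (forall x, d' (d x) = 0) ->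
  loc_exact d' p -> (forall x, p (d' x) = 0) -> (forall y, exists x, p x = y) ->
  ext1_zero N C.
Proof.
move=> HL W_proj dK d'p pd' p_surj f.
have [|s Ss [h hE]] := @hom_exact_lift _ _ _ _ d d' p C (f \o p) HL W_proj dK d'p.
  by move=> x /=; rewrite pd' linear0.
by exists s => //; exists h => y; have [x <-] := p_surj y; apply: hE.
Qed.

Lemma ext1_zero_extension N' N N'' C (f : {linear N' -> N}) (g : {linear N -> N''}) :
  injective f -> (forall y, exists x, g x = y) ->
  (forall x, g x = 0 <-> exists y, f y = x) ->
  ext1_zero N' C -> ext1_zero N'' C -> ext1_zero N C.
Proof.
move=> f_inj g_surj fg E' E'' phi.
have [s Ss [h hE]] := E' (phi \o f).
have [|h' h'E] := @hull_factor _ _ _ f h.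
  by move=> x; rewrite -[0](linear0 f) => /f_inj ->; rewrite linear0.
have [|psi psiE] := @surj_factor _ _ _ _ g
    (scale_fun phi (csC Ss) \- (cosyz_proj C \o h')) g_surj.
  by move=> _ /fg[y <-]; rewrite /= h'E -hE subrr.
have [t St [k kE]] := E'' psi.
exists (t * s); first exact: csM.
exists (scale_fun h' (csC St) \+ (k \o g)) => x.
by rewrite linearD linZ -kE psiE /= scalerBr addrC subrK scalerA.
Qed.

Lemma ext1_zero_kill N C s : S s -> (forall x : N, s *: x = 0) -> ext1_zero N C.
Proof.
move=> Ss sN f; exists s => //; exists \0 => x /=.
by rewrite -linZ sN !linear0.
Qed.

(** The long exact sequence of Hom(-, cosyz C) on 0 -> N -> N -> N/aN -> 0. It prepares the use of
    Nakayama's lemma in [ext1_zero_rmul]. *)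
Lemma ext1_zero_mul N C (a : A) (aC : is_central a) :
  injective (fun x : N => a *: x) ->
  ext1_zero (quot (sm_range (scale_fun (idfun : {linear N -> N}) aC))) (cosyz C) ->
  forall f : {linear N -> cosyz C}, exists2 s, S s &
  exists g : {linear N -> cosyz C}, forall x, s *: f x = a *: g x.
Proof.
set m := scale_fun _ aC; set p := cosyz_proj (cosyz C) => a_inj E f.
have [|g gE] := @hull_factor _ _ _ m (hull_emb _ \o f).
  move=> x mx0; have -> : x = 0 by apply: a_inj; rewrite scaler0.
  exact: linear0.
have [|h hE] := @surj_factor _ _ _ _ (qproj (sm_range m)) (p \o g) (@qproj_surj _ _ _).
  by move=> x /qproj_eq0[y <-] /=; rewrite -[a *: y]/(m y) gE /= [p _]cosyz_emb.
have [s Ss [k kE]] := E h.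
have [|c cE] := @hull_corestrict _ _ (scale_fun g (csC Ss) \- (k \o qproj (sm_range m))).
  by move=> x; rewrite linearB linZ -kE hE subrr.
exists s => //; exists c => x; apply: (@hull_emb_inj _ (cosyz C)).
have ax : qproj (sm_range m) (m x) = 0 by apply/qproj_eq0; exists x.
have <- : c (m x) = a *: c x by exact: linZ.
have gmx : g (m x) = hull_emb _ (f x) by exact: gE.
by rewrite cE [LHS]linZ -gmx -[RHS]/(s *: g (m x) - k (qproj _ (m x))) ax linear0 subr0.
Qed.

End LocalExt.

Lemma hom_exact_mono (A : pzRingType) (S T : central_set A) (U V W : lmodType A)
    (d : {linear U -> V}) (d' : {linear V -> W}) C :
  (forall s, S s -> T s) -> hom_exact S d d' C -> hom_exact T d d' C.
Proof. by move=> ST HL b /HL[s Ss ?]; exists s => //; apply: ST. Qed.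

(** * Modules over a finite algebra, localized at a prime of the base ring *)

Section Nakayama.
Variables (R : comPzRingType) (V : lmodType R) (B : submod V) (I : R -> Prop).
Hypothesis I_ideal : left_ideal I.

Fact ideal_trans x y z : I (x - y) -> I (y - z) -> I (x - z).
Proof. by have [_ ID _] := I_ideal => xy /(ID _ _ xy); rewrite addrA subrK. Qed.

(* Elimination of the last generator; [s] is replaced by a power modulo [I]. *)
Lemma nakayama n (e : 'I_n -> V) (s : R) :
  (forall k, exists2 c : 'I_n -> R, forall l, I (c l) &
     B (s *: e k - \sum_l c l *: e l)) ->
  exists2 u, (exists j, I (u - s ^+ j)) & forall k, B (u *: e k).
Proof.
have [I0 ID IM] := I_ideal.
have IB x y : I x -> I y -> I (x - y).
  by move=> Ix Iy; apply: (ID) => //; rewrite -mulN1r; apply: (IM).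
elim: n e s => [|n IHn] e s.
  by move=> _; exists 1 => [|[] //]; exists 0%N; rewrite subrr.
move=> eP; have [c cI cB] := eP ord_max.
pose w (i : 'I_n) := widen_ord (leqnSn n) i.
pose u1 := s - c ord_max.
have u1e : B (u1 *: e ord_max - \sum_l c (w l) *: e (w l)).
  by move: cB; rewrite big_ord_recr /= scalerBl; congr (B _); abel.
have [k|u [j uj] uB] := IHn (fun i => e (w i)) (u1 * s).
  have [d dI dB] := eP (w k).
  exists (fun l => u1 * d (w l) + d ord_max * c (w l)) => [l|].
    by apply: (ID); apply: (IM).
  have := smD (smZ u1 dB) (smZ (d ord_max) u1e); congr (B _).
  rewrite big_ord_recr /= -/(w _) -/w !scalerBr scalerDr !scalerA !scaler_sumr.
  rewrite [u1 * d _]mulrC; under [in RHS]eq_bigr do rewrite scalerDl -!scalerA.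
  by rewrite big_split /=; abel.
exists (u * u1).
  exists (j.*2.+1); rewrite exprS -muln2 mulnC exprM expr2.
  apply: (@ideal_trans _ (u * s)).
    rewrite -mulrBr; apply: (IM); rewrite /u1 addrAC subrr sub0r.
    by rewrite -mulN1r; apply: (IM).
  rewrite mulrC -mulrBr; apply: (IM); apply: (ideal_trans uj).
  rewrite subrXX mulrC; apply: (IM); rewrite -mulrBl mulrC; apply: (IM).
  by rewrite /u1 addrAC subrr sub0r -mulN1r; apply: (IM).
have u1uB i : B (u * u1 *: e (w i)) by rewrite mulrC -scalerA; apply: smZ.
move=> k; have [kn|kn] := ltnP k n.
  by have -> : k = w (Ordinal kn) by apply: val_inj.
have -> : k = ord_max by apply: val_inj; apply/eqP; rewrite eqn_leq kn -ltnS ltn_ord.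
rewrite -scalerA -[u1 *: _](subrK (\sum_l c (w l) *: e (w l))) scalerDr.
apply: smD; first exact: smZ.
rewrite scaler_sumr; apply: sm_sum => l.
by rewrite scalerA mulrC -scalerA; apply: smZ.
Qed.

End Nakayama.

Lemma prime_ideal_ideal (R : comPzRingType) (p : prime_ideal R) :
  left_ideal (prime_mem p).
Proof. by split; [apply: prime_mem0 | apply: prime_memD | apply: prime_memM]. Qed.

(** The powers of [s] stay outside the prime, hence so does the element [u] congruent to one of
    them. *)
Lemma prime_nakayama (R : comPzRingType) (p : prime_ideal R) (V : lmodType R)
    (B : submod V) n (e : 'I_n -> V) (s : R) : ~~ prime_mem p s ->
  (forall k, exists2 c : 'I_n -> R, forall l, prime_mem p (c l) &
     B (s *: e k - \sum_l c l *: e l)) ->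
  exists2 u, ~~ prime_mem p u & forall k, B (u *: e k).
Proof.
move=> ps eP; have [u [j uj] uB] := nakayama (prime_ideal_ideal p) eP.
exists u => //; apply/negP => pu.
have : prime_mem p (s ^+ j).
  rewrite -[_ ^+ _](subKr u); apply: prime_memD => //.
  by rewrite -mulN1r; apply: prime_memM.
elim: j {uj} => [|j IHj]; first exact/negP/prime_proper.
by rewrite exprS => /prime_memP; rewrite (negPf ps).
Qed.

Definition maximal_ideal (R : comPzRingType) (m : prime_ideal R) :=
  forall x, ~~ prime_mem m x -> exists y, prime_mem m (1 - x * y).

Lemma fg_regular (A : pzRingType) : fg_module A^o.
Proof.
by exists 1%N, (fun=> 1) => x; exists (fun=> x); rewrite big_ord1 -[LHS]mulr1.
Qed.

(** Primality: if 1 - xz lies in the ideal, then y = y(1 - xz) + z(xy) does as soon as xy does. *)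
Lemma maximal_prime (R : comPzRingType) (D : submod R^o) : ~ D 1 ->
  (forall x, ~ D x -> exists y, D (1 - (x : R) * y)) ->
  exists2 m : prime_ideal R, maximal_ideal m & forall x, D x <-> prime_mem m x.
Proof.
move=> D1 Dmax.
have P0 : `[< D 0 >] by apply/asboolP; apply: sm0.
have PD x y : `[< D x >] -> `[< D y >] -> `[< D (x + y) >].
  by move=> /asboolP Dx /asboolP Dy; apply/asboolP; apply: smD.
have PM a x : `[< D x >] -> `[< D ((a : R) * x) >].
  by move=> /asboolP Dx; apply/asboolP; apply: (smZ a Dx).
have P1 : ~~ `[< D 1 >] by apply/asboolP.
have PP (x y : R) : `[< D (x * y) >] -> `[< D x >] || `[< D y >].
  move=> /asboolP Dxy; apply/orP.
  have [Dx|/Dmax[z Dz]] := pselect (D x); first by left; apply/asboolP.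
  right; apply/asboolP; have := smD (smZ y Dz) (smZ z Dxy); congr (D _).
  have E (a b c : R) : a * (1 - b * c) + c * (b * a) = a.
    by rewrite mulrBr mulr1 mulrCA [c * (_ * _)]mulrCA [c * a]mulrC subrK.
  exact: E.
exists (@PrimeIdeal R (fun x : R => `[< D x >]) P0 PD PM P1 PP) => [x /asboolP/Dmax[y Dy]|x].
  by exists y; apply/asboolP.
by split=> [Dx|/asboolP]; [apply/asboolP|].
Qed.

Lemma exists_maximal_ideal (R : comPzRingType) (p : prime_ideal R) :
  left_noetherian R -> exists2 m : prime_ideal R, maximal_ideal m &
  forall x, prime_mem p x -> prime_mem m x.
Proof.
move=> R_noeth; have [p0 pD pM] := prime_ideal_ideal p.
pose D0 : submod R^o := @Submod R R^o (prime_mem p) p0 pD pM.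
have [|D [D1 pD'] Dmax] := @noetherian_max R R_noeth R^o
  (fun D => ~ D 1 /\ forall x, prime_mem p x -> D x) D0 (fg_regular R).
  by split=> //=; apply/negP; apply: prime_proper.
have [x Dx|m m_max mE] := maximal_prime D1.
  apply: contrapT => noy; apply: Dx; pose X := sm_add D (sm_range (rvlin (fun _ : 'I_1 => x))).
  have DX y : D y -> X y.
    by move=> Dy; exists 0; [exists 0; rewrite linear0 | rewrite subr0].
  apply: (Dmax X) => //; last first.
    exists x; last by rewrite subrr; apply: sm0.
    by exists (\row_i 1); rewrite /= big_ord1 mxE scale1r.
  split=> [[_ [u <-]]|y /pD' /DX //]; rewrite /= big_ord1 => D1u.
  by apply: noy; exists (u 0 0); rewrite mulrC.
by exists m => // x /pD' /mE.
Qed.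

(** * Modules over a finite algebra, seen over the base ring *)

Section Algebra.
Variables (R : comPzRingType) (A : assoc_algebra R).
Implicit Types (M N : lmodType A).

Lemma alg_central (r : R) : is_central (alg_map A r : A).
Proof. by move=> a; apply: alg_map_central. Qed.

Definition restr (N : lmodType A) : Type := N.
HB.instance Definition _ N := GRing.Zmodule.on (restr N).

Definition restr_scale N (r : R) (x : restr N) : restr N := (alg_map A r : A) *: (x : N).

Fact restr_scaleA N r s (x : restr N) :
  restr_scale r (restr_scale s x) = restr_scale (r * s) x.
Proof. by rewrite /restr_scale scalerA rmorphM. Qed.
Fact restr_scale1 N : left_id 1 (@restr_scale N).
Proof. by move=> x; rewrite /restr_scale rmorph1 scale1r. Qed.
Fact restr_scaleDr N : right_distributive (@restr_scale N) +%R.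
Proof. by move=> r x y; apply: scalerDr. Qed.
Fact restr_scaleDl N (x : restr N) : {morph (@restr_scale N)^~ x : r s / r + s}.
Proof. by move=> r s; rewrite /restr_scale rmorphD; apply: scalerDl. Qed.

HB.instance Definition _ N := GRing.Zmodule_isLmodule.Build R (restr N)
  (@restr_scaleA N) (@restr_scale1 N) (@restr_scaleDr N) (@restr_scaleDl N).

Lemma restrZ N r (x : restr N) : r *: x = (alg_map A r : A) *: (x : N) :> N.
Proof. by []. Qed.

Fact restr_fun_linear M N (f : {linear M -> N}) : linear (f : restr M -> restr N).
Proof. by move=> r x y; rewrite -[LHS]/(f (_ *: (x : M) + (y : M))) linearP. Qed.

Definition restr_fun M N (f : {linear M -> N}) : {linear restr M -> restr N} :=
  Lin (restr_fun_linear f).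

Definition restr_sub N (D : submod N) : submod (restr N).
Proof.
exists (fun x : restr N => D (x : N)); first exact: (sm0 D).
- by move=> x y; apply: (@smD _ _ D).
- by move=> r x; apply: (@smZ _ _ D (alg_map A r)).
Defined.

Lemma fg_fin (B : pzRingType) (M : lmodType B) (I : finType) (v : I -> M) :
  (forall x, exists c : I -> B, x = \sum_i c i *: v i) -> fg_module M.
Proof.
move=> vP; exists #|I|, (fun i => v (enum_val i)) => x; have [c ->] := vP x.
exists (fun i => c (enum_val i)); rewrite (reindex_onto enum_val enum_rank) => [|i _].
  by apply: eq_bigl => i; rewrite enum_valK eqxx.
by rewrite enum_rankK.
Qed.

Hypothesis A_fg : fg_module (alg_module A).

Lemma fg_restr N : fg_module N -> fg_module (restr N).
Proof.
move=> [n [e eP]]; have [g [a aP]] := A_fg.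
apply: (@fg_fin _ _ ('I_g * 'I_n)%type (fun k => (a k.1 : A) *: e k.2 : restr N)) => x.
have [c ->] := eP x; have [d dP] := choice (fun i => aP (c i)).
exists (fun k => d k.2 k.1); rewrite [RHS](eq_bigr (fun k =>
  (alg_map A (d k.2 k.1) * (a k.1 : A)) *: e k.2)) => [|k _]; last by rewrite -scalerA.
rewrite -(pair_bigA _ (fun k i => (alg_map A (d i k) * (a k : A)) *: e i)) /=.
rewrite exchange_big; apply: eq_bigr => i _ /=.
have -> : c i = \sum_k alg_map A (d i k) * (a k : A) by exact: dP.
exact: (@scaler_suml A N (e i)).
Qed.

Hypothesis R_noeth : left_noetherian R.

Lemma algebra_noetherian : left_noetherian A.
Proof.
move=> J [J0 JD JM].
have J0' : J (0 : alg_module A) by [].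
pose D : submod (alg_module A) := @Submod _ (alg_module A) J J0' JD (fun r => JM (alg_map A r)).
have [n [v [Jv vP]]] := fg_submod R_noeth D A_fg.
exists n, v; split=> // x /vP[c ->]; exists (fun i => alg_map A (c i)).
by [].
Qed.

(** It contains 0 exactly when A_p = 0, and then all vanishing up to this set is automatic. *)
Definition loc_set (p : prime_ideal R) : central_set A.
Proof.
exists (fun a => exists2 s, ~~ prime_mem p s & a = alg_map A s).
- by exists 1; [apply: prime_proper | rewrite rmorph1].
- move=> _ _ [s ps ->] [t pt ->]; exists (s * t); last by rewrite rmorphM.
  by apply/negP => /prime_memP; rewrite (negPf ps) (negPf pt).
- by move=> _ [s _ ->]; apply: alg_central.
Defined.

Definition rmul (r : R) N : {linear N -> N} := scale_fun (idfun : {linear N -> N}) (alg_central r).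

Definition killed (m : prime_ideal R) N :=
  forall r, prime_mem m r -> forall x : N, rmul r N x = 0.

Definition simple_module N :=
  (exists x : N, x <> 0) /\
  forall D : submod N, (forall x, D x -> x = 0) \/ (forall x, D x).

Lemma exists_simple_quotient N : fg_module N -> (exists x : N, x <> 0) ->
  exists2 D : submod N, (exists x, ~ D x) & simple_module (quot D).
Proof.
move=> N_fg [x0 x0P].
have [|D [x Dx] Dmax] := @noetherian_max _ algebra_noetherian N
    (fun D => exists x, ~ D x) (sm_bot N) N_fg; first by exists x0.
exists D; first by exists x.
split; first by exists (qproj D x) => /qproj_eq0.
move=> E; pose E' := sm_preim (qproj D) E.
have DE' y : D y -> E' y by move=> /qproj_eq0 /= ->; apply: sm0.
have [[y E'y]|E'T] := pselect (exists y, ~ E' y).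
  left=> u; have [z <-] := qproj_surj u => Ez; apply/qproj_eq0.
  by apply: (Dmax E') => //; exists y.
right=> u; have [z <-] := qproj_surj u.
by apply: contrapT => nEz; apply: E'T; exists z.
Qed.

End Algebra.

Arguments loc_set {R} A p.
Arguments rmul {R A} r N.

(** * Noetherian induction for modules over a finite algebra *)

Section Rank.
Variables (R : comPzRingType) (m : prime_ideal R) (M : lmodType R).
Hypothesis m_max : maximal_ideal m.
Hypothesis mM : forall r, prime_mem m r -> forall x : M, r *: x = 0.

Definition spanned (D : submod M) (n : nat) :=
  exists f : {linear 'rV[R]_n -> M}, forall x, D x <-> exists u, f u = x.

Lemma spanned_add (D D1 : submod M) n w : D w -> (forall x, D1 x -> D x) ->
  (forall x, D x -> exists c, D1 (x - c *: w)) -> spanned D1 n -> spanned D n.+1.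
Proof.
move=> Dw D1D Dx [f fE].
have lin : linear (fun u : 'rV[R]_(1 + n) => f (rsubmx u) + u 0 0 *: w).
  by move=> a x y; rewrite !linearP !mxE scalerDl scalerDr scalerA /=; abel.
exists (Lin lin) => x; split=> [/Dx[c /fE[u uE]]|[u <-] /=].
  exists (row_mx (c%:M) u : 'rV[R]_(1 + n)); rewrite /= row_mxKr.
  have -> : (row_mx c%:M u : 'rV[R]_(1 + n)) 0 0 = c.
    have -> : 0 = lshift n 0 :> 'I_(1 + n) by apply: val_inj.
    by rewrite row_mxEl mxE.
  by rewrite uE subrK.
by apply: smD; [apply/D1D/fE; exists (rsubmx (u : 'rV[R]_(1 + n))) | apply: smZ].
Qed.

(** Elimination over the field R/m. Either [D] lies in the span [E1] of all generators but the
    first, or [D] is spanned by its intersection with [E1] and one vector [w] congruent to the first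
    generator. The number of generators thus serves as a measure in [killed_ind]. *)
Lemma spanned_sub n (E D : submod M) : spanned E n -> (forall x, D x -> E x) ->
  spanned D n /\ ((exists x, E x /\ ~ D x) -> exists2 k, n = k.+1 & spanned D k).
Proof.
elim: n E D => [|n IHn] E D [f fE] DE.
  have E0 x : E x -> x = 0 by move=> /fE[u <-]; rewrite [u]thinmx0 linear0.
  split; last by move=> [x [/E0 -> []]]; apply: sm0.
  exists f => x; split=> [/DE/fE //|[u <-]].
  by rewrite [u]thinmx0 linear0; apply: sm0.
have lin1 : linear (fun u : 'rV[R]_n => f (row_mx 0 u : 'rV[R]_(1 + n))).
  move=> a x y; have -> : row_mx 0 (a *: x + y) =
      a *: row_mx 0 x + row_mx 0 y :> 'rV[R]_(1 + n).
    by rewrite scale_row_mx add_row_mx scaler0 addr0.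
  exact: linearP.
pose E1 := sm_range (Lin lin1); pose e := f (row_mx 1%:M 0 : 'rV[R]_(1 + n)).
have E1E x : E1 x -> E x by move=> [u <-]; apply/fE; eexists.
have E1s : spanned E1 n by exists (Lin lin1).
have Edec x : E x -> exists c, E1 (x - c *: e).
  move=> /fE[u0 <-]; pose u : 'rV[R]_(1 + n) := u0; rewrite -[u0]/u.
  exists (u 0 0), (rsubmx u).
  have uE : u = row_mx 0 (rsubmx u) + u 0 0 *: row_mx 1%:M 0 :> 'rV[R]_(1 + n).
    rewrite -{1}[u](@hsubmxK _ 1 1 n) scale_row_mx scaler0 add_row_mx addr0 add0r.
    congr row_mx; apply/rowP => i; rewrite !ord1 !mxE mulr1 /=.
    by congr (u _ _); apply: val_inj.
  by rewrite {2}uE /e linearD linZ addrK.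
pose D1 := sm_cap D E1.
have [D1s D1s'] := IHn E1 D1 E1s (fun x => @proj2 _ _).
have [DE1|] := pselect (forall x, D x -> E1 x).
  have DD1 k : spanned D1 k -> spanned D k.
    by move=> [g gE]; exists g => x; rewrite -gE /=; split=> [Dx|[]//]; split=> //; apply: DE1.
  split; last by move=> _; exists n => //; apply: DD1.
  apply: (@spanned_add D D1 n 0) => //; first exact: sm0.
    by move=> x [].
  by move=> x Dx; exists 0; rewrite scaler0 subr0; split=> //; apply: DE1.
move=> /existsNP[w0 /not_implyP[Dw0 nE1]].
have [c E1c] := Edec _ (DE _ Dw0).
have [d md] : exists d, prime_mem m (1 - c * d).
  apply: m_max; apply/negP => mc; apply: nE1.
  by move: E1c; rewrite (mM mc) subr0.
pose w := d *: w0.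
have Dw : D w by apply: smZ.
have E1w : E1 (w - e).
  have := smZ d E1c; rewrite scalerBr scalerA mulrC.
  by rewrite -[in X in E1 (_ - X)](subKr 1 (c * d)) scalerBl (mM md) subr0 scale1r.
have Edec' x : E x -> exists c, E1 (x - c *: w).
  move=> /Edec[k E1k]; exists k; have := smB E1k (smZ k E1w).
  by rewrite scalerBr opprB addrA subrK.
have Ddec x : D x -> exists c, D1 (x - c *: w).
  move=> Dx; have [k E1k] := Edec' _ (DE _ Dx); exists k; split=> //.
  by apply: smB => //; apply: smZ.
have add k : spanned D1 k -> spanned D k.+1.
  by apply: spanned_add Dw _ Ddec => x [].
split; first exact: add.
move=> [x [Ex nDx]]; have [|k -> /add D1k] := D1s'; last by exists k.+1.
have [k E1k] := Edec' _ Ex; exists (x - k *: w); split=> // -[Dxk _].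
by apply: nDx; rewrite -[x](subrK (k *: w)); apply: smD => //; apply: smZ.
Qed.

End Rank.

Section NoetherianInduction.
Variables (R : comPzRingType) (A : assoc_algebra R) (m : prime_ideal R).
Hypothesis R_noeth : left_noetherian R.
Hypothesis A_fg : fg_module (alg_module A).
Hypothesis m_max : maximal_ideal m.
Implicit Types (N : lmodType A).

Lemma killed_subm N (D : submod N) : killed m N -> killed m (subm D).
Proof.
by move=> mN r mr x; apply: (@subm_val_inj _ _ D); rewrite linear0 linZ; apply: mN.
Qed.

Lemma killed_quot N (D : submod N) : killed m N -> killed m (quot D).
Proof.
move=> mN r mr u; have [x <-] := qproj_surj u.
by rewrite /= -linZ [_ *: x](mN r mr) linear0.
Qed.

Lemma restr_killed N : killed m N ->
  forall r, prime_mem m r -> forall x : restr N, r *: x = 0.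
Proof. by move=> mN r mr x; apply: mN. Qed.

(* Induction on the dimension over R/m, peeling off a simple quotient. *)
Lemma killed_ind (Q : lmodType A -> Prop) :
  (forall N, (forall x : N, x = 0) -> Q N) ->
  (forall N (D : submod N), killed m N -> (exists x, ~ D x) -> simple_module (quot D) ->
     Q (subm D) -> Q N) ->
  forall N, fg_module N -> killed m N -> Q N.
Proof.
move=> Q0 QS N /(fg_restr A_fg)/fgP[n [f fP]] mN.
elim/ltn_ind: n N mN f fP => n IHn N mN f fP.
have [x0|/existsNP[x0 x0P]] := pselect (forall x : N, x = 0); first exact: Q0.
have N_fg : fg_module N.
  have [k [e eP]] := (fgP (restr N)).2 (ex_intro _ n (ex_intro _ f fP)).
  by exists k, e => x; have [c ->] := eP x; exists (fun i => alg_map A (c i)).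
have [|D Dx Dsimple] := exists_simple_quotient A_fg R_noeth N_fg; first by exists x0.
apply: (QS N D) => //.
have Ns : spanned (sm_top (restr N)) n by exists f.
have [_ []] := @spanned_sub R m (restr N) m_max (restr_killed mN) n (sm_top _)
  (restr_sub D) Ns (fun _ _ => I).
  by have [x nDx] := Dx; exists x.
move=> k nk [g gE].
have [h hE] := @inj_corestrict _ _ _ _ (restr_fun (subm_val D)) g
  (@subm_val_inj _ _ D) (fun u => (subm_valP D _).1 ((gE _).2 (ex_intro _ u erefl))).
apply: (IHn k _ (subm D) (killed_subm mN) h); first by rewrite nk.
move=> x; have [u uE] := (gE _).1 ((subm_valP D _).2 (ex_intro _ x erefl)).
by exists u; apply: (@subm_val_inj _ _ D); rewrite -uE; apply: hE.
Qed.

(** [V n N] stands for a vanishing statement about [N] from degree n on; the aim is a bound n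
    independent of [N]. *)
Variable V : nat -> lmodType A -> Prop.
Hypothesis V_mono : forall n k N, (n <= k)%N -> V n N -> V k N.
Hypothesis V_extension : forall n N' N N'' (f : {linear N' -> N}) (g : {linear N -> N''}),
  injective f -> (forall y, exists x, g x = y) ->
  (forall x, g x = 0 <-> exists y, f y = x) -> fg_module N ->
  V n N' -> V n N'' -> V n N.
Hypothesis V_mul : forall n N r, prime_mem m r -> fg_module N ->
  injective (rmul r N) -> V n (quot (sm_range (rmul r N))) -> V n N.
Hypothesis V_loc_zero : forall n N s, ~~ prime_mem m s ->
  (forall x : N, rmul s N x = 0) -> V n N.
Hypothesis V_simple : forall N, fg_module N -> simple_module N -> killed m N ->
  exists n, V n N.

Lemma V_zero n N : (forall x : N, x = 0) -> V n N.
Proof. by move=> N0; apply: V_loc_zero (prime_proper m) _ => x; apply: N0. Qed.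

Lemma V_iso n N N' (g : {linear N -> N'}) : injective g ->
  (forall y, exists x, g x = y) -> fg_module N -> V n N' -> V n N.
Proof.
move=> g_inj g_surj N_fg.
have bot0 (x : subm (sm_bot N)) : x = 0.
  by apply: (@subm_val_inj _ _ (sm_bot N)); rewrite linear0 subm_valE; apply: (submP x).
apply: (V_extension (f := subm_val (sm_bot N)) _ g_surj _ N_fg (V_zero n bot0)).
  exact: subm_val_inj.
move=> x; split=> [gx0|[y <-]]; last by rewrite [y]bot0 !linear0.
by exists 0; rewrite linear0; apply: g_inj; rewrite gx0 linear0.
Qed.

(** A nonzero map from [N] to a simple module is nonzero on [D] or factors through an isomorphism
    from the simple quotient N/D, so only the finitely many composition factors of [N] matter. *)
Lemma uniform_simple_from N : fg_module N -> killed m N ->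
  exists n, forall N', fg_module N' -> simple_module N' ->
    (exists f : {linear N -> N'}, exists x, f x <> 0) -> V n N'.
Proof.
pose Q N := fg_module N -> exists n, forall N', fg_module N' -> simple_module N' ->
    (exists f : {linear N -> N'}, exists x, f x <> 0) -> V n N'.
move=> N_fg mN; have : Q N; last exact.
apply: killed_ind N_fg mN => {N} [N N0 _|N D mN _ D_simple IH N_fg].
  by exists 0%N => N' _ _ [f [x []]]; rewrite (N0 x) linear0.
have [n1 n1P] := IH (fg_subm (algebra_noetherian A_fg R_noeth) D N_fg).
have qD_fg := fg_surj (@qproj_surj _ _ D) N_fg.
have [n2 n2P] := V_simple qD_fg D_simple (killed_quot (D := D) mN).
exists (maxn n1 n2) => N' N'_fg N'_simple [f [x fx]].
have [[y fy]|fD] := pselect (exists y : subm D, f (subm_val D y) <> 0).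
  apply: V_mono (leq_maxl _ _) _; apply: n1P => //.
  by exists (f \o subm_val D), y.
apply: V_mono (leq_maxr _ _) _.
have [|g gE] := @surj_factor _ _ _ _ (qproj D) f (@qproj_surj _ _ D).
  move=> y /qproj_eq0/subm_valP[z <-]; apply: contrapT => fz.
  by apply: fD; exists z.
have g_inj : injective g.
  have [_ /(_ (sm_ker g))[ker0|kerT]] := D_simple.
    move=> u v guv; apply/eqP; rewrite -subr_eq0; apply/eqP; apply: ker0.
    by rewrite /= linearB guv subrr.
  by case: fx; rewrite -gE; apply: kerT.
have g_surj y : exists u, g u = y.
  have [_ /(_ (sm_range g))[r0|]] := N'_simple; last exact.
  by case: fx; apply: r0; exists (qproj D x); rewrite gE.
have [h hE] := choice g_surj.
have h_lin : linear h by move=> a u v; apply: g_inj; rewrite linearP !hE.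
apply: (V_iso (g := Lin h_lin)) n2P => // [u v /= huv|u].
  by rewrite -(hE u) huv hE.
by exists (g u); apply: g_inj; rewrite hE.
Qed.

(* A modulo this left ideal is the largest quotient of A killed by m. *)
Definition killed_radical : submod A^o.
Proof.
exists (fun x => forall S : lmodType A, killed m S ->
  forall f : {linear A^o -> S}, f x = 0).
- by move=> S _ f; rewrite linear0.
- by move=> x y Dx Dy S mS f; rewrite linearD Dx // Dy // addr0.
- by move=> a x Dx S mS f; rewrite linZ Dx // scaler0.
Defined.

(** A simple module killed by m receives a nonzero map from A modulo [killed_radical], which is
    itself finitely generated and killed by m. *)
Lemma uniform_simple : exists n, forall N, fg_module N -> simple_module N ->
  killed m N -> V n N.
Proof.
pose D := killed_radical.
have mD : killed m (quot D).
  move=> r mr u; have [x <-] := qproj_surj u.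
  rewrite /= -linZ; apply/qproj_eq0 => S mS f; rewrite linZ; exact: mS.
have [n nP] := uniform_simple_from (fg_surj (@qproj_surj _ _ D) (fg_regular A)) mD.
exists n => N N_fg N_simple mN; apply: nP => //.
have [[x x0] _] := N_simple.
have lin : linear (fun a : A^o => (a : A) *: x) by move=> a b c; rewrite scalerDl -scalerA.
have [|g gE] := @surj_factor _ _ _ _ (qproj D) (Lin lin) (@qproj_surj _ _ D).
  by move=> a /qproj_eq0 Da; apply: Da mN _.
by exists g, (qproj D 1); rewrite gE /= scale1r.
Qed.

(** Let [Q] be a minimal quotient of [N] for which the claim fails; it holds for the proper
    quotients of [Q]. If r in R acted neither as zero nor injectively, [Q] would be an extension of
    Q/rQ by Q/ker(r), both proper quotients. So either some s outside m kills [Q], or m kills [Q],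
    or some r in m acts injectively and [V_mul] reduces the claim to Q/rQ. *)
Lemma noetherian_induction : exists n, forall N, fg_module N -> V n N.
Proof.
have [n V_simple_n] := uniform_simple.
have V_killed N : fg_module N -> killed m N -> V n N.
  move=> N_fg mN; move: (N_fg).
  apply: (killed_ind (Q := fun N => fg_module N -> V n N)) (N_fg) mN => {N N_fg} [N N0 _|N D mN _ D_simple IH N_fg].
    exact: V_zero.
  have D_fg := fg_subm (algebra_noetherian A_fg R_noeth) D N_fg.
  apply: (V_extension (f := subm_val D) (g := qproj D)) (IH D_fg) _ => //.
  - exact: subm_val_inj.
  - exact: qproj_surj.
  - by move=> x; split=> [/qproj_eq0/subm_valP|/subm_valP/qproj_eq0].
  apply: V_simple_n => //; last exact: killed_quot.
  exact: fg_surj (@qproj_surj _ _ D) N_fg.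
exists n => N N_fg; apply: contrapT => nVN.
have A_noeth := algebra_noetherian A_fg R_noeth.
pose bad (D : submod N) := ~ V n (quot D).
have bot_bad : bad (sm_bot N).
  move=> V0; apply: nVN; apply: (V_iso (g := qproj (sm_bot N))) V0 => //.
    by move=> x y /qproj_eq/subr0_eq.
  exact: qproj_surj.
have [D D_bad D_max] := noetherian_max A_noeth N_fg bot_bad.
apply: D_bad; set Q := quot D.
have Q_fg : fg_module Q := fg_surj (@qproj_surj _ _ D) N_fg.
have VQ (E : submod Q) : (exists2 u, E u & u <> 0) -> V n (quot E).
  move=> [u Eu u0]; apply: contrapT => nVE.
  pose E' := sm_preim (qproj D) E.
  have [x xu] := qproj_surj u.
  apply: u0; rewrite -xu; apply/qproj_eq0; apply: (D_max E') => /=; last by rewrite xu.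
  - move=> VE'; apply: nVE.
    have [|g gE] := @surj_factor _ _ _ _ (qproj D) (qproj E') (@qproj_surj _ _ D).
      by move=> y /qproj_eq0 Dy; apply/qproj_eq0; rewrite /= (qproj_eq0 D y).2 //; apply: sm0.
    have [|h hE] := @surj_factor _ _ _ _ (qproj E) g (@qproj_surj _ _ E).
      by move=> v; have [y <-] := qproj_surj v; rewrite gE => /qproj_eq0 Ey; apply/qproj_eq0.
    have hqE y : h (qproj E (qproj D y)) = qproj E' y by rewrite hE gE.
    apply: (V_iso (g := h)) VE' => [v w|v|].
    + have [v' <-] := qproj_surj v; have [w' <-] := qproj_surj w.
      have [v1 <-] := qproj_surj v'; have [w1 <-] := qproj_surj w'.
      rewrite !hqE => /qproj_eq; rewrite /= linearB => Evw.
      by apply/qproj_eq.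
    + by have [y <-] := qproj_surj v; exists (qproj E (qproj D y)); rewrite hqE.
    + exact: fg_surj (@qproj_surj _ _ E) Q_fg.
  - by move=> y Dy; rewrite (qproj_eq0 D y).2 //; apply: sm0.
have inj_ker r : ~ (exists2 u : Q, rmul r Q u = 0 & u <> 0) -> injective (rmul r Q).
  move=> no u v ruv; apply/eqP; rewrite -subr_eq0; apply/eqP; apply: contrapT => uv0.
  by apply: no; exists (u - v) => //; rewrite linearB ruv subrr.
have [[r [rker rim]]|dich] := pselect (exists r,
    (exists2 u : Q, rmul r Q u = 0 & u <> 0) /\ (exists u : Q, rmul r Q u <> 0)).
  have [|f fE] := @surj_factor _ _ _ _ (qproj (sm_ker (rmul r Q))) (rmul r Q)
      (@qproj_surj _ _ _); first by move=> u /qproj_eq0.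
  apply: (V_extension (f := f) (g := qproj (sm_range (rmul r Q)))) => //.
  - move=> u v; have [x <-] := qproj_surj u; have [y <-] := qproj_surj v.
    by rewrite !fE => rxy; apply/qproj_eq; rewrite /sm_ker /sm_preim /= -[_ *: _]/(rmul r Q _) linearB rxy subrr.
  - exact: qproj_surj.
  - move=> u; split=> [/qproj_eq0[v <-]|[v <-]].
      by exists (qproj _ v); rewrite fE.
    have [w <-] := qproj_surj v; rewrite fE; apply/qproj_eq0.
    by exists w.
  - exact: VQ.
  - by apply: VQ; have [u ru] := rim; exists (rmul r Q u) => //; exists u.
have dich' r : (forall u : Q, rmul r Q u = 0) \/ injective (rmul r Q).
  have [r0|/existsNP[u ru]] := pselect (forall u : Q, rmul r Q u = 0); first by left.
  right; apply: inj_ker => rker; apply: dich; exists r; split=> //.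
  by exists u.
have [[s [ms sQ]]|nos] := pselect (exists s, ~~ prime_mem m s /\ forall u : Q, rmul s Q u = 0).
  exact: V_loc_zero ms sQ.
have [mQ|] := pselect (killed m Q); first exact: V_killed Q_fg mQ.
move=> /existsNP[r /not_implyP[mr /existsNP[u ru]]].
have [r0|r_inj] := dich' r; first by case: ru.
apply: (V_mul mr Q_fg r_inj); apply: VQ.
by exists (rmul r Q u) => //; exists u.
Qed.

End NoetherianInduction.

(** * Local vanishing of Ext from vanishing on simple modules *)

Section HomModule.
Variables (R : comPzRingType) (A : assoc_algebra R) (N C : lmodType A).

Definition homm := {f : N -> C | linear f}.
HB.instance Definition _ := gen_eqMixin homm.
HB.instance Definition _ := gen_choiceMixin homm.

Lemma homm_eq (f g : homm) : (forall x, sval f x = sval g x) -> f = g.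
Proof.
case: f g => f fP [g gP] /= fg; have eq_fg : f = g by apply/funext.
by move: gP; rewrite -eq_fg => gP; congr exist; apply: Prop_irrelevance.
Qed.

Definition hlin (f : homm) : {linear N -> C} := Lin (svalP f).
Definition hm (f : {linear N -> C}) : homm := exist (fun f => linear f) f (linearP f).

Definition homm_zero := hm \0.
Definition homm_add (f g : homm) := hm (hlin f \+ hlin g).
Definition homm_opp (f : homm) := hm (\- hlin f).
Definition homm_scale (r : R) (f : homm) := hm (scale_fun (hlin f) (@alg_central _ A r)).

Fact homm_addA : associative homm_add.
Proof. by move=> f g h; apply: homm_eq => x; apply: addrA. Qed.
Fact homm_addC : commutative homm_add.
Proof. by move=> f g; apply: homm_eq => x; apply: addrC. Qed.
Fact homm_add0 : left_id homm_zero homm_add.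
Proof. by move=> f; apply: homm_eq => x; apply: add0r. Qed.
Fact homm_addN : left_inverse homm_zero homm_opp homm_add.
Proof. by move=> f; apply: homm_eq => x; apply: addNr. Qed.
HB.instance Definition _ := GRing.isZmodule.Build homm
  homm_addA homm_addC homm_add0 homm_addN.

Fact homm_scaleA r s f : homm_scale r (homm_scale s f) = homm_scale (r * s) f.
Proof. by apply: homm_eq => x /=; rewrite scalerA rmorphM. Qed.
Fact homm_scale1 : left_id 1 homm_scale.
Proof. by move=> f; apply: homm_eq => x /=; rewrite rmorph1 scale1r. Qed.
Fact homm_scaleDr : right_distributive homm_scale +%R.
Proof. by move=> r f g; apply: homm_eq => x; apply: scalerDr. Qed.
Fact homm_scaleDl f : {morph homm_scale^~ f : r s / r + s}.
Proof. by move=> r s; apply: homm_eq => x /=; rewrite rmorphD; apply: scalerDl. Qed.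
HB.instance Definition _ := GRing.Zmodule_isLmodule.Build R homm
  homm_scaleA homm_scale1 homm_scaleDr homm_scaleDl.

Lemma hommD (f g : homm) x : sval (f + g) x = sval f x + sval g x.
Proof. by []. Qed.
Lemma hommB (f g : homm) x : sval (f - g) x = sval f x - sval g x.
Proof. by []. Qed.
Lemma hommZ r (f : homm) x : sval (r *: f) x = rmul r C (sval f x).
Proof. by []. Qed.
Lemma homm_sum (I : finType) (F : I -> homm) x :
  sval (\sum_i F i) x = \sum_i sval (F i) x.
Proof. by elim/big_ind2: _ => // a f b g <- <-. Qed.

(** Evaluation at generators of [N] embeds Hom(N, C) in a power of [C], which is finitely generated
    over R. *)
Lemma fg_homm : left_noetherian R -> fg_module (alg_module A) ->
  fg_module N -> fg_module C -> fg_module homm.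
Proof.
move=> R_noeth A_fg [g [e eP]] /(fg_restr A_fg)[n [v vP]].
have ev_lin : linear (fun f : homm => [ffun k => sval f (e k)] : {ffun 'I_g -> restr C}).
  by move=> r f h; apply/ffunP => k; rewrite !ffunE.
pose ev := Lin ev_lin.
have ev_inj : injective ev.
  move=> f h /ffunP fh; apply: homm_eq => x; have [c ->] := eP x.
  rewrite -[sval f]/(hlin f : _ -> _) -[sval h]/(hlin h : _ -> _) !linear_sum.
  apply: eq_bigr => k _; rewrite !linZ; congr (_ *: _).
  by have := fh k; rewrite !ffunE.
have ffun_fg : fg_module {ffun 'I_g -> restr C}.
  apply: (@fg_fin _ _ ('I_g * 'I_n)%type (fun k => [ffun i => if i == k.1 then v k.2 else 0])).
  move=> f; have [c cP] := choice (fun k => vP (f k)).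
  exists (fun k => c k.1 k.2); apply/ffunP => i; rewrite sum_ffunE cP.
  rewrite -(pair_bigA _ (fun k j => (c k j *: [ffun i => if i == k then v j else 0] : {ffun 'I_g -> restr C}) i)) /=.
  rewrite (bigD1 i) //= [X in _ + X]big1 ?addr0 => [|k /negbTE ki].
    by apply: eq_bigr => j _; rewrite !ffunE eqxx.
  by rewrite big1 // => j _; rewrite !ffunE eq_sym ki scaler0.
have [k [w [Dw wP]]] := fg_submod R_noeth (sm_range ev) ffun_fg.
have [h hE] := choice Dw; exists k, h => f.
have [|c cE] := wP (ev f); first by exists f.
exists c; apply: ev_inj; rewrite cE linear_sum.
by apply: eq_bigr => i _; rewrite linZ hE.
Qed.

End HomModule.

Lemma fg_mod_ord (A : pzRingType) (V : lmodType A) (D B : submod V) :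
  fg_mod D B -> exists n (v : 'I_n -> V), (forall i, D (v i)) /\
    forall x, D x -> exists c : 'I_n -> A, B (x - \sum_i c i *: v i).
Proof.
move=> [I [v [Dv vP]]]; exists #|I|, (fun i => v (enum_val i)); split=> // x Dx.
have [c Bx] := vP x Dx; exists (fun i => c (enum_val i)); move: Bx.
rewrite (reindex_onto enum_val enum_rank) => [|i _]; last by rewrite enum_rankK.
by congr (B (_ - _)); apply: eq_bigl => i; rewrite enum_valK eqxx.
Qed.

Lemma fg_mod_sub (A : pzRingType) (A_noeth : left_noetherian A) (V : lmodType A)
    (D D' B : submod V) : fg_mod D B -> (forall x, D' x -> D x) -> fg_mod D' B.
Proof.
move=> /fg_mod_ord[n [v [Dv vP]]] D'D; apply: (noetherian_fg_mod A_noeth (e := v)).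
by move=> x /D'D /vP.
Qed.

Section LocalVanishing.
Variables (R : comPzRingType) (A : assoc_algebra R) (m : prime_ideal R).
Hypothesis R_noeth : left_noetherian R.
Hypothesis A_fg : fg_module (alg_module A).
Local Notation S := (loc_set A m).
Implicit Types (C M N U V W X : lmodType A).

Let A_noeth : left_noetherian A := algebra_noetherian A_fg R_noeth.

(** Nakayama's lemma at m for D/B, on which r in m is onto up to elements outside m; [t] is a common
    multiple of the denominators occurring for the generators. *)
Lemma loc_nakayama (H : lmodType R) (D B : submod H) r : prime_mem m r ->
  (forall f, B f -> D f) -> fg_mod D B ->
  (forall f, D f -> exists2 s, ~~ prime_mem m s & exists2 g, D g & B (s *: f - r *: g)) ->
  exists2 u, ~~ prime_mem m u & forall f, D f -> B (u *: f).
Proof.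
move=> mr BD /fg_mod_ord[n [v [Dv vP]]] Dr.
have [s sP] : exists s : 'I_n -> R, forall i, ~~ prime_mem m (s i) /\
    exists2 g, D g & B (s i *: v i - r *: g).
  have sP i : exists s, ~~ prime_mem m s /\ exists2 g, D g & B (s *: v i - r *: g).
    by have [s ms sr] := Dr _ (Dv i); exists s.
  by have [s ?] := choice sP; exists s.
have [t mt tP] := @cs_prod R (CentralSet (prime_proper m) (fun s t ms mt =>
  valP (denomM (Sub s ms : denom m) (Sub t mt))) (fun s _ a => mulrC s a)) _ s (fun i => (sP i).1).
have [|u mu uB] := prime_nakayama (B := B) (e := v) mt.
  move=> k; have [a _ ta] := tP k; have [_ [g Dg Bg]] := sP k.
  have [c cB] := vP _ Dg.
  exists (fun l => r * a * c l) => [l|]; first by rewrite -mulrA mulrC; apply: prime_memM.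
  have := smD (smZ a Bg) (smZ (r * a) cB); congr (B _).
  rewrite ta !scalerBr !scalerA scaler_sumr [r * a]mulrC.
  by under [in RHS]eq_bigr do rewrite -scalerA; abel.
exists u => // f Df; have [c cB] := vP _ Df.
rewrite -[f](subrK (\sum_i c i *: v i)) scalerDr; apply: smD; first exact: smZ.
rewrite scaler_sumr; apply: sm_sum => i.
by rewrite scalerA mulrC -scalerA; apply: smZ.
Qed.

Lemma loc_setP s : ~~ prime_mem m s -> S (alg_map A s).
Proof. by move=> ms; exists s. Qed.

Section HomExact.
Variables (U V W : lmodType A) (d : {linear U -> V}) (d' : {linear V -> W}).
Hypothesis dK : forall x, d' (d x) = 0.
Hypothesis W_proj : dual_basis W.
Hypothesis V_proj : dual_basis V.

Lemma hom_exact_extension N' N N'' (f : {linear N' -> N}) (g : {linear N -> N''}) :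
  injective f -> (forall y, exists x, g x = y) ->
  (forall x, g x = 0 <-> exists y, f y = x) ->
  hom_exact S d d' N' -> hom_exact S d d' N'' -> hom_exact S d d' N.
Proof.
move=> f_inj g_surj fg E' E'' b bd.
have [|s Ss [c cE]] := E'' (g \o b); first by move=> x /=; rewrite bd linear0.
have [h hE] := dual_basis_lift W_proj (fun x => g_surj (c x)).
have [|b' b'E] := @inj_corestrict _ _ _ _ f (scale_fun b (csC Ss) \- (h \o d')) f_inj.
  by move=> x; apply/fg; rewrite linearB linZ /= hE -cE subrr.
have [|t St [k kE]] := E' b'.
  by move=> x; apply: f_inj; rewrite b'E /= bd dK !(linear0, scaler0, subr0, addr0).
exists (t * s); first exact: csM.
exists (scale_fun h (csC St) \+ (f \o k)) => x /=.
by rewrite -kE linZ b'E /= scalerBr scalerA addrC subrK.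
Qed.

Lemma hom_exact_kill N s : ~~ prime_mem m s -> (forall x : N, rmul s N x = 0) ->
  hom_exact S d d' N.
Proof.
move=> ms sN b _; exists (alg_map A s); first exact: loc_setP.
by exists \0 => x; apply: sN.
Qed.

(** Nakayama's lemma for the cocycles [D] modulo the coboundaries [B] in Hom(V, N): the vanishing
    for N/rN makes r onto on this cohomology. *)
Lemma hom_exact_mul N r : prime_mem m r -> fg_module N -> injective (rmul r N) ->
  hom_exact S d d' (quot (sm_range (rmul r N))) -> hom_exact S d d' N.
Proof.
move=> mr N_fg r_inj E; pose H := homm V N.
unshelve epose (D := @Submod R H (fun f => forall x, sval f (d x) = 0) _ _ _).
- by [].
- by move=> f g Df Dg x; rewrite hommD Df Dg addr0.
- by move=> a f Df x; rewrite hommZ Df linear0.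
unshelve epose (B := @Submod R H (fun f => exists c : {linear W -> N}, forall x,
  sval f x = c (d' x)) _ _ _).
- by exists \0.
- by move=> f g [b bE] [c cE]; exists (b \+ c) => x; rewrite hommD bE cE.
- by move=> a f [b bE]; exists (rmul a N \o b) => x; rewrite hommZ bE.
have [||f Df|u mu uB] := @loc_nakayama H D B r mr.
- by move=> f [c cE] x; rewrite cE dK linear0.
- have [k [v vP]] := fg_homm R_noeth A_fg (fg_dual_basis V_proj) N_fg.
  apply: (noetherian_fg_mod R_noeth (e := v)) => f _; have [c ->] := vP f.
  by exists c; rewrite subrr; apply: sm0.
- pose q := qproj (sm_range (rmul r N)).
  have [|_ [s ms ->] [c cE]] := E (q \o hlin f).
    by move=> x; rewrite /= Df linear0.
  have [h hE] := dual_basis_lift W_proj (fun x => qproj_surj (c x)).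
  have [|g gE] := @inj_corestrict _ _ _ _ (rmul r N)
      (scale_fun (hlin f) (@alg_central _ A s) \- (h \o d')) r_inj.
    move=> x; apply: (qproj_eq0 (sm_range (rmul r N)) _).1.
    by rewrite -/q linearB linZ /= hE -cE subrr.
  exists s => //; exists (hm g).
    move=> x; apply: r_inj; rewrite [RHS]linear0 [LHS]gE /= dK -[sval f _]/(sval f (d x)) Df.
    by rewrite linear0 scaler0 subr0.
  exists h => x; rewrite hommB hommZ [X in _ - X](gE x).
  by rewrite /= opprB addrC subrK.
- move=> b bd; have [|c cE] := uB (hm b); first by move=> x; apply: bd.
  by exists (alg_map A u); [exact: loc_setP | exists c].
Qed.

End HomExact.

(** * Finiteness of Ext over the base ring *)

Section Ext1.
Variable M : lmodType A.
Hypothesis M_fg : fg_module M.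

(** The maps whose class in Ext^i(N, M) is zero; in degree 0 this leaves only the zero map. *)
Definition hom_zero i N : submod (homm N (iter i (@cosyz A) M)).
Proof.
case: i => [|i]; first exact: sm_bot.
exists (fun f => exists g : {linear N -> hull (iter i (@cosyz A) M)},
  forall x, sval f x = cosyz_proj _ (g x)).
- by exists \0 => x; rewrite linear0.
- by move=> f h [b bE] [c cE]; exists (b \+ c) => x; rewrite linearD hommD bE cE.
- by move=> a f [b bE]; exists (rmul a _ \o b) => x; rewrite hommZ bE /= linZ.
Defined.

Lemma hom_zero_extend i (K F : lmodType A) (k : {linear K -> F}) f : injective k ->
  hom_zero i K f ->
  exists g : {linear F -> iter i (@cosyz A) M}, forall x, g (k x) = sval f x.
Proof.
case: i f => [|i] f k_inj /= => [-> |[g gE]]; first by exists \0.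
have [|h hE] := @hull_factor _ _ _ _ k g.
  by move=> x; rewrite -[0](linear0 k) => /k_inj ->; rewrite linear0.
by exists (cosyz_proj _ \o h) => x; rewrite /= hE gE.
Qed.

(** Iterated cosyzygies need not be finitely generated, but Ext^i(N, M) is. Dimension shift along 0
    -> K -> A^n -> N -> 0: [rel] is the graph of the connecting map from Hom(K, C) to Hom(N, cosyz
    C) modulo maps that lift to the hull. *)
Lemma homm_iter_fg i N : fg_module N -> fg_mod (sm_top _) (hom_zero i N).
Proof.
elim: i N => [|i IHi] N N_fg.
  have [k [v vP]] := fg_homm R_noeth A_fg N_fg M_fg.
  apply: (noetherian_fg_mod R_noeth (e := v)) => f _; have [c ->] := vP f.
  by exists c; rewrite subrr; apply: sm0.
have [n [f f_surj]] := (fgP N).1 N_fg.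
pose K := subm (sm_ker f); pose k : {linear K -> _} := subm_val (sm_ker f).
have fk y : f (k y) = 0 by apply: ((subm_valP (sm_ker f) (k y)).2 (ex_intro _ y erefl)).
have K_fg : fg_module K := fg_subm A_noeth _ (fg_rv A n).
set C := iter i (@cosyz A) M; pose p := cosyz_proj C.
pose rel (chi : homm K C) (phi : homm N (cosyz C)) (g : {linear 'rV[A]_n -> hull C}) :=
  (forall x, p (g x) = sval phi (f x)) /\ (forall y, hull_emb C (sval chi y) = g (k y)).
have [D DE] : exists D : submod (homm K C), forall chi, D chi <-> exists phi g, rel chi phi g.
  unshelve eexists (@Submod R (homm K C) (fun chi => exists phi g, rel chi phi g) _ _ _) => //.
- by exists 0, \0; split=> x; rewrite /= linear0.
- move=> a b [phi [g [gphi ag]]] [psi [h [hpsi bh]]]; exists (phi + psi), (g \+ h).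
  split=> x; first by rewrite hommD linearD gphi hpsi.
  by rewrite hommD linearD ag bh.
- move=> r a [phi [g [gphi ag]]]; exists (r *: phi), (rmul r _ \o g).
  split=> x; first by rewrite hommZ /= linZ gphi.
  by rewrite hommZ /= linZ ag.
have [t [v [Dv vP]]] := fg_mod_ord (@fg_mod_sub R R_noeth _ _ D _ (IHi K K_fg) (fun _ _ => I)).
have [phi phiP] := choice (fun i => (DE _).1 (Dv i)); have [g gP] := choice phiP.
exists 'I_t, phi; split=> // psi _.
have [h hE] := @dual_basis_lift _ _ _ _ p (hlin psi \o f) (rv_dual_basis A n)
  (fun x => cosyz_surj _).
have [|chi chiE] := @hull_corestrict _ _ _ (h \o k).
  move=> x; apply: etrans (hE (k x)) _.
  exact: etrans (congr1 (hlin psi) (fk x)) (linear0 _).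
have [|c cP] := vP (hm chi); first by apply/DE; exists psi, h; split.
have [tau tauE] := hom_zero_extend (@subm_val_inj _ _ _) cP.
have lin : linear (fun u => h u - \sum_j rmul (c j) _ (g j u) - hull_emb C (tau u)).
  move=> a x y; rewrite !linearP !scalerBr scaler_sumr.
  under eq_bigr do rewrite !linearP; rewrite big_split /=.
  by rewrite !scalerN; abel.
have [|b bE] := @surj_factor _ _ _ _ f (Lin lin) f_surj.
  move=> u /(subm_valP (sm_ker f))[y <-] /=; rewrite tauE -/k.
  suff -> : hull_emb C (sval (hm chi - \sum_j c j *: v j) y) =
      h (k y) - \sum_j rmul (c j) _ (g j (k y)) by rewrite subrr.
  rewrite hommB homm_sum linearB linear_sum; congr (_ - _); first exact: chiE.
  by apply: eq_bigr => j _; rewrite hommZ linZ (proj2 (gP j)).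
exists c, b => x; have [u <-] := f_surj x.
rewrite bE hommB homm_sum /= -/p [RHS]linearB cosyz_emb subr0 [RHS]linearB [X in _ = _ - X]linear_sum.
congr (_ - _); first exact: esym (hE u).
apply: eq_bigr => j _; apply: esym; apply: etrans (linZ p _ _) _.
by congr (_ *: _); apply: (proj1 (gP j) u).
Qed.

(** By [ext1_zero_mul], r is onto up to [S] on Ext^(i+1)(N, M), a finitely generated R-module, so
    Nakayama's lemma applies. *)
Lemma ext1_zero_rmul i N r : prime_mem m r -> fg_module N -> injective (rmul r N) ->
  ext1_zero S (quot (sm_range (rmul r N))) (iter i.+1 (@cosyz A) M) ->
  ext1_zero S N (iter i (@cosyz A) M).
Proof.
move=> mr N_fg r_inj E; set C := iter i _ M.
have Er := @ext1_zero_mul A S N C _ (@alg_central _ A r) r_inj E.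
have [|f _|u mu uB] := loc_nakayama mr (D := sm_top (homm N (cosyz C)))
  (B := hom_zero i.+1 N) _ (@homm_iter_fg i.+1 N N_fg).
- by [].
- have [_ [s ms ->] [g gE]] := Er (hlin f).
  exists s => //; exists (hm g) => //; exists \0 => x.
  by rewrite linear0 hommB !hommZ /= gE subrr.
- move=> f; have [g gE] := uB (hm f) I.
  by exists (alg_map A u); [exact: loc_setP | exists g].
Qed.

End Ext1.

Hypothesis m_max : maximal_ideal m.

Lemma ext1_zero_local M : fg_module M ->
  (forall N, fg_module N -> simple_module N -> killed m N ->
     exists n, forall i, (n <= i)%N -> ext1_zero S N (iter i (@cosyz A) M)) ->
  exists n, forall N, fg_module N ->
    forall i, (n <= i)%N -> ext1_zero S N (iter i (@cosyz A) M).
Proof.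
move=> M_fg simpleE.
apply: (noetherian_induction R_noeth A_fg m_max (V := fun n N =>
  forall i, (n <= i)%N -> ext1_zero S N (iter i (@cosyz A) M))) => //.
- by move=> n k N nk E i ki; apply: E; apply: leq_trans ki.
- move=> n N' N N'' f g f_inj g_surj fg _ E' E'' i ni.
  exact: ext1_zero_extension f_inj g_surj fg (E' i ni) (E'' i ni).
- move=> n N r mr N_fg r_inj E i ni; apply: (ext1_zero_rmul M_fg mr) => //.
  by apply: E; apply: leqW.
- move=> n N s ms sN i _; exact: ext1_zero_kill (loc_setP ms) sN.
Qed.

Lemma hom_exact_local (P : int -> lmodType A) (d : forall i, {linear P i -> P (i + 1)}) :
  (forall i x, d (i + 1) (d i x) = 0) -> (forall i, dual_basis (P i)) ->
  (forall N, fg_module N -> simple_module N -> killed m N ->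
     exists n : nat, forall i : int, (i <= - n%:Z) -> hom_exact S (d i) (d (i + 1)) N) ->
  exists n : nat, forall N, fg_module N ->
    forall i : int, (i <= - n%:Z) -> hom_exact S (d i) (d (i + 1)) N.
Proof.
move=> dK P_proj simpleE.
apply: (noetherian_induction R_noeth A_fg m_max (V := fun n N =>
  forall i : int, (i <= - n%:Z) -> hom_exact S (d i) (d (i + 1)) N)) => //.
- by move=> n k N nk E i ki; apply: E; apply: le_trans ki _; rewrite lerN2 lez_nat.
- move=> n N' N N'' f g f_inj g_surj fg _ E' E'' i ni.
  exact (hom_exact_extension (dK i) (P_proj _) f_inj g_surj fg (E' i ni) (E'' i ni)).
- move=> n N r mr N_fg r_inj E i ni.
  exact (hom_exact_mul (dK i) (P_proj _) (P_proj _) mr N_fg r_inj (E i ni)).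
- by move=> n N s ms sN i _; apply: hom_exact_kill ms sN.
Qed.

End LocalVanishing.

(** * Families indexed by the integers *)

Section IntFamilies.
Variable T : int -> Type.

(** Degrees such as (j - 1) + 1 and j are equal without being convertible, so families over the
    integers are built with explicit transport. *)
Definition icast i j (e : i = j) (t : T i) : T j := eq_rect i T t j e.

Lemma icastK i j (e : i = j) (e' : j = i) t : icast e' (icast e t) = t.
Proof. by case: j / e e' => e'; rewrite (eq_irrelevance e' erefl). Qed.

Lemma reindex_succ (f : forall i, T (i + 1)) :
  exists F : forall j, T j, forall i, F (i + 1) = f i.
Proof.
exists (fun j => icast (subrK 1 j) (f (j - 1))) => i.
move: (subrK _ _); rewrite -[X in forall e, icast e (f X) = _]/(i + 1 - 1).
have -> : i + 1 - 1 = i by rewrite addrK.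
by move=> e; rewrite (eq_irrelevance e erefl).
Qed.

Lemma single_family (z : forall i, T i) j (t : T j) :
  exists F : forall i, T i, F j = t /\ forall i, i <> j -> F i = z i.
Proof.
exists (fun i => if @eqP _ j i is ReflectT e then icast e t else z i); split.
  by case: eqP => // e; rewrite (eq_irrelevance e erefl).
by move=> i ij; case: eqP => // e; case: ij.
Qed.

Lemma int_up (Inv : forall i, T i -> Prop) (Rel : forall i, T i -> T (i + 1) -> Prop)
    (z : forall i, T i) l (a : T l) :
  Inv l a ->
  (forall i t, Inv i t -> exists2 t', Inv (i + 1) t' & Rel i t t') ->
  exists F : forall i, T i, [/\ F l = a, forall i, i < l -> F i = z i &
    forall i, l <= i -> Rel i (F i) (F (i + 1))].
Proof.
move=> Ia step.
have next i (t : {t : T i | Inv i t}) : {t' : {t' : T (i + 1) | Inv (i + 1) t'} | Rel i (sval t) (sval t')}.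
  by apply: cid; have [t' It' Rt] := step i _ (svalP t); exists (exist _ t' It').
have eS n : l + n%:Z + 1 = l + n.+1%:Z by lia.
have cI i j (e : i = j) t : Inv i t -> Inv j (icast e t) by case: j / e.
pose G := fix G n : {t : T (l + n%:Z) | Inv _ t} := match n with
  | 0%N => exist _ (icast (esym (addr0 l)) a) (cI _ _ _ _ Ia)
  | n.+1 => let t := sval (next _ (G n)) in
            exist _ (icast (eS n) (sval t)) (cI _ _ _ _ (svalP t))
  end.
have eG j : ~~ (j < l) -> l + `|j - l|%N%:Z = j by lia.
pose F j : T j := if pselect (is_true (~~ (j < l))) is left jl then icast (eG j jl) (sval (G `|j - l|%N)) else z j.
have FE n j (e : l + n%:Z = j) : F j = icast e (sval (G n)).
  rewrite /F; case: pselect => [jl|nj]; last by exfalso; apply: nj; lia.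
  have kn : `|j - l|%N = n by lia.
  move: (eG j jl); rewrite kn => e'.
  by rewrite (eq_irrelevance e' e).
exists F; split=> [|i il|i il].
- by rewrite (FE 0%N l (addr0 l)) /= icastK.
- by rewrite /F; case: pselect => // jl; exfalso; rewrite il in jl.
- have [n e] : exists n : nat, l + n%:Z = i by exists `|i - l|%N; lia.
  case: i / e il => il; rewrite (FE n _ erefl) /=.
  have e1 : l + n.+1%:Z = l + n%:Z + 1 by lia.
  by rewrite (FE n.+1 _ e1) /= icastK; apply: (svalP (next _ (G n))).
Qed.

(** Downward recursion by dependent choice, keeping the given family [z] from N on; it serves
    complexes that vanish in high degrees. *)
Lemma int_down (Inv : forall i, T i -> Prop) (Rel : forall i, T (i + 1) -> T i -> Prop)
    (z : forall i, T i) (N : int) :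
  (forall i, N <= i -> Inv i (z i)) -> (forall i, N <= i -> Rel i (z (i + 1)) (z i)) ->
  (forall i t, Inv (i + 1) t -> exists2 t', Inv i t' & Rel i t t') ->
  exists F : forall i, T i, (forall i, N <= i -> F i = z i) /\
    forall i, Rel i (F (i + 1)) (F i).
Proof.
move=> Iz Rz step.
have next i (t : {t : T (i + 1) | Inv (i + 1) t}) : {t' : {t' : T i | Inv i t'} | Rel i (sval t) (sval t')}.
  by apply: cid; have [t' It' Rt] := step i _ (svalP t); exists (exist _ t' It').
have eS n : N - n%:Z = N - n.+1%:Z + 1 by lia.
have cI i j (e : i = j) t : Inv i t -> Inv j (icast e t) by case: j / e.
pose G := fix G n : {t : T (N - n%:Z) | Inv _ t} := match n with
  | 0%N => exist _ (icast (esym (subr0 N)) (z N)) (cI _ _ _ _ (Iz N (lexx N)))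
  | n.+1 => sval (next _ (exist _ (icast (eS n) (sval (G n))) (cI _ _ _ _ (svalP (G n)))))
  end.
have eG j : ~~ (N <= j) -> N - `|N - j|%N%:Z = j by lia.
pose F j : T j := if pselect (is_true (~~ (N <= j))) is left jl then icast (eG j jl) (sval (G `|N - j|%N)) else z j.
have FE n j (e : N - n%:Z = j) : F j = icast e (sval (G n)).
  rewrite /F; case: pselect => [jl|Nj]; last first.
    have n0 : n = 0%N by lia.
    move: e; rewrite n0 => e; have jN : N = j by lia.
    by case: j / jN e Nj => e _; rewrite /= icastK.
  have kn : `|N - j|%N = n by lia.
  by move: (eG j jl); rewrite kn => e'; rewrite (eq_irrelevance e' e).
have Fz i : N <= i -> F i = z i by rewrite /F; case: pselect => // jl Ni; exfalso; rewrite Ni in jl.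
exists F; split=> // i; have [Ni|iN] := lerP N i.
  by rewrite !Fz //; [apply: Rz | lia].
have [n e] : exists n : nat, N - n.+1%:Z = i by exists (`|N - i|.-1)%N; lia.
case: i / e iN => _; rewrite (FE n.+1 _ erefl) (FE n _ (eS n)) /=.
exact (svalP (next _ (exist (fun t => Inv _ t) (icast (eS n) (sval (G n)))
  (cI _ _ (eS n) _ (svalP (G n)))))).
Qed.

End IntFamilies.

Lemma int_all_succ (Q : int -> Prop) : (forall i, Q (i + 1)) -> forall j, Q j.
Proof. by move=> Q1 j; rewrite -[j](subrK 1); apply: Q1. Qed.

(** * Complexes, homotopies and lifting along quasi-isomorphisms *)

Section Complexes.
Variable A : pzRingType.

Record cplx := Cplx {
  cob :> int -> lmodType A;
  cd : forall i, {linear cob i -> cob (i + 1)};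
  cdK : forall i (x : cob i), cd (i + 1) (cd i x) = 0
}.

Definition cx_of (X : bcomplex A) : cplx := Cplx (@diffK A X).

Record chain (X Y : cplx) := Chain {
  cm :> forall i, {linear X i -> Y i};
  cmP : forall i (x : X i), cd Y i (cm i x) = cm (i + 1) (cd X i x)
}.

Implicit Types (X Y Z P C : cplx).

Definition chain_zero X Y : chain X Y.
Proof. by exists (fun i => \0) => i x; rewrite linear0. Defined.

Definition chain_idc X : chain X X.
Proof. by exists (fun i => idfun). Defined.

Definition chain_o X Y Z (g : chain Y Z) (f : chain X Y) : chain X Z.
Proof. by exists (fun i => (g i \o f i)%FUN) => i x /=; rewrite !cmP. Defined.

Definition chain_sub X Y (f g : chain X Y) : chain X Y.
Proof. by exists (fun i => f i \- g i) => i x /=; rewrite linearB !cmP. Defined.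

Definition chain_of (X Y : bcomplex A) (f : chain_map X Y) : chain (cx_of X) (cx_of Y) :=
  @Chain (cx_of X) (cx_of Y) f (cmapP f).

(** The condition is stated in degree i + 1, which covers all degrees and needs no transport for
    [h i]. *)
Definition homotopic X Y (f g : chain X Y) :=
  exists h : forall i, {linear X (i + 1) -> Y i}, forall i x,
    f (i + 1) x - g (i + 1) x = h (i + 1) (cd X (i + 1) x) + cd Y i (h i x).

Lemma homotopic_refl X Y (f : chain X Y) : homotopic f f.
Proof. by exists (fun i => \0) => i x; rewrite linear0 addr0 subrr. Qed.

Lemma homotopic_eq X Y (f g : chain X Y) : (forall i, f i =1 g i) -> homotopic f g.
Proof. by move=> fg; exists (fun i => \0) => i x; rewrite linear0 addr0 fg subrr. Qed.

Lemma homotopic_sym X Y (f g : chain X Y) : homotopic f g -> homotopic g f.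
Proof.
move=> [h hE]; exists (fun i => \- h i) => i x /=.
by rewrite linearN -opprD -hE opprB.
Qed.

Lemma homotopic_trans X Y (f g k : chain X Y) :
  homotopic f g -> homotopic g k -> homotopic f k.
Proof.
move=> [h hE] [l lE]; exists (fun i => h i \+ l i) => i x /=.
by rewrite linearD addrACA -hE -lE; abel.
Qed.

Lemma homotopic_sub X Y (f g : chain X Y) :
  homotopic f g <-> homotopic (chain_sub f g) (chain_zero X Y).
Proof. by split=> -[h hE]; exists h => i x; rewrite -hE /= subr0. Qed.

Lemma homotopic_post X Y Z (k : chain Y Z) (f g : chain X Y) :
  homotopic f g -> homotopic (chain_o k f) (chain_o k g).
Proof.
move=> [h hE]; exists (fun i => (k i \o h i)%FUN) => i x /=.
by rewrite -linearB hE linearD cmP.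
Qed.

Definition qis X Y (f : chain X Y) : Prop :=
  forall i : int,
    (forall x : X (i + 1), cd X (i + 1) x = 0 ->
       (exists y : Y i, cd Y i y = f (i + 1) x) ->
       exists z : X i, cd X i z = x) /\
    (forall y : Y (i + 1), cd Y (i + 1) y = 0 ->
       exists2 x : X (i + 1), cd X (i + 1) x = 0 &
         exists z : Y i, cd Y i z = y - f (i + 1) x).

Definition acyclic C := forall i (x : C (i + 1)), cd C (i + 1) x = 0 ->
  exists y, cd C i y = x.

Definition proj_cplx P := (forall i, dual_basis (P i)) /\
  exists N : int, forall i, N <= i -> forall x : P i, x = 0.

(** Downward induction from where [P] vanishes. By the invariant, f minus h d takes cocycles as
    values, hence boundaries, and projectivity lifts it through the differential. *)
Lemma acyclic_null P C (f : chain P C) : proj_cplx P -> acyclic C ->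
  homotopic f (chain_zero P C).
Proof.
move=> [P_proj [N PN]] C_acyclic.
have [||i h hI|h [_ hP]] := @int_down (fun i => {linear P (i + 1) -> C i})
  (fun i h => forall x : P i, cd C i (h (cd P i x)) = cd C i (f i x))
  (fun i h' h => forall x, f (i + 1) x = h' (cd P (i + 1) x) + cd C i (h x))
  (fun i => \0) N.
- by move=> i Ni x; rewrite (PN i Ni x) !linear0.
- move=> i Ni x; have Ni1 : N <= i + 1 by lia.
  by rewrite (PN _ Ni1 x) !linear0 addr0.
- have [|h' h'E] := @dual_basis_lift _ _ _ _ (cd C i) (f (i + 1) \- (h \o cd P (i + 1))%FUN)
    (P_proj (i + 1)).
    move=> x; have [|y yE] := C_acyclic i (f (i + 1) x - h (cd P (i + 1) x)); last by exists y.
    by rewrite linearB hI subrr.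
  exists h' => x; first by rewrite h'E /= cdK linear0 subr0 cmP.
  by rewrite h'E /=; abel.
- by exists h => i x; rewrite -hP /= subr0.
Qed.

Section Cone.
Variables (X Y : cplx) (s : chain X Y).

Fact ccone_linear i : linear (fun z : X (i + 1)%R * Y i =>
  (- cd X (i + 1) z.1, s (i + 1) z.1 + cd Y i z.2)).
Proof.
move=> a [x y] [x' y'] /=; rewrite !linearP /=; congr (_, _).
by rewrite /= scalerDr; abel.
Qed.

Definition ccone : cplx.
Proof.
exists (fun i => (X (i + 1)%R * Y i)%type : lmodType A) (fun i => Lin (@ccone_linear i)).
move=> i [x y] /=; rewrite linearN cdK oppr0 linearD cdK addr0 linearN cmP addNr.
by rewrite oppr0.
Defined.

Lemma ccone_acyclic : qis s -> acyclic ccone.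
Proof.
move=> qs i [x y] /= [/eqP].
rewrite oppr_eq0 => /eqP dx sxy.
have [x' dx'] : exists z : X (i + 1), cd X (i + 1) z = x.
  have [inj _] := qs (i + 1); apply: inj => //; exists (- y).
  by rewrite linearN; apply/eqP; rewrite eq_sym -addr_eq0 sxy.
have [_ surj] := qs i; have [|u du [v dv]] := surj (y + s (i + 1) x').
  by rewrite linearD cmP dx' -[RHS]sxy; abel.
exists (u - x', v); congr (_, _).
  by rewrite linearB du sub0r opprK dx'.
by rewrite linearB dv; abel.
Qed.

Variable P : cplx.
Hypothesis P_proj : proj_cplx P.
Hypothesis s_qis : qis s.

(** The map (0, a) into the acyclic cone of [s] is null-homotopic; the components of a null-homotopy
    are the lift [b] and a homotopy from s b to a. *)
Lemma qis_lift (a : chain P Y) : exists b : chain P X, homotopic (chain_o s b) a.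
Proof.
have lin i : linear (fun x => (0, a i x) : X (i + 1)%R * Y i).
  by move=> c x y; rewrite linearP; congr (_, _); rewrite /= scaler0 addr0.
have ch i (x : P i) : cd ccone i (Lin (lin i) x) = Lin (lin (i + 1)) (cd P i x).
  by rewrite /= !linear0 add0r cmP.
have [H HE] := acyclic_null (@Chain P ccone (fun i => Lin (lin i)) ch) P_proj
  (ccone_acyclic s_qis).
have HE1 i x : 0 = (H (i + 1) (cd P (i + 1) x)).1 - cd X (i + 1) (H i x).1.
  by have /(congr1 fst) := HE i x; rewrite /= subr0.
have HE2 i x : a (i + 1) x = (H (i + 1) (cd P (i + 1) x)).2 +
    (s (i + 1) (H i x).1 + cd Y i (H i x).2).
  by have /(congr1 snd) := HE i x; rewrite /= subr0.
have lin1 i : linear (fun x => (H i x).1) by move=> c x y; rewrite linearP.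
have lin2 i : linear (fun x => (H i x).2) by move=> c x y; rewrite linearP.
have [b bE] := @reindex_succ (fun i => {linear P i -> X i}) (fun i => Lin (lin1 i)).
have bP : forall i x, cd X i (b i x) = b (i + 1) (cd P i x).
  apply: int_all_succ => i x; rewrite !bE /=.
  by apply/esym/eqP; rewrite -subr_eq0 -HE1.
exists (Chain bP); apply: homotopic_sym; exists (fun i => Lin (lin2 i)) => i x /=.
by rewrite bE /= HE2; abel.
Qed.

(** [b] together with a null-homotopy of s b is a chain map from the shifted complex [P'] to the
    acyclic cone; contracting it contracts [b]. *)
Lemma qis_lift_null (b : chain P X) :
  homotopic (chain_o s b) (chain_zero P Y) -> homotopic b (chain_zero P X).
Proof.
move=> [h hE].
have P'K i (x : P (i + 1)) : (\- cd P (i + 1 + 1)) ((\- cd P (i + 1)) x) = 0.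
  by rewrite /= linearN cdK !oppr0.
pose P' := @Cplx (fun i => P (i + 1)) (fun i => \- cd P (i + 1)) P'K.
have P'_proj : proj_cplx P'.
  have [Pp [N PN]] := P_proj; split=> [i|]; first exact: Pp.
  by exists N => i Ni; apply: PN; lia.
have lin i : linear (fun x : P (i + 1) => (b (i + 1) x, - h i x) : X (i + 1)%R * Y i).
  by move=> c x y; rewrite !linearP; congr (_, _); rewrite /= scalerN.
have ch i (x : P' i) : cd ccone i (Lin (lin i) x) = Lin (lin (i + 1)) (cd P' i x).
  rewrite /= !linearN opprK cmP; congr (_, _).
  by have := hE i x; rewrite /= subr0 => ->; abel.
have [K KE] := acyclic_null (@Chain P' ccone (fun i => Lin (lin i)) ch) P'_proj
  (ccone_acyclic s_qis).
have KE1 i x : b (i + 1 + 1) x = - (K (i + 1) (cd P (i + 1 + 1) x)).1 - cd X (i + 1) (K i x).1.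
  by have /(congr1 fst) := KE i x; rewrite /= subr0 linearN.
have lin1 i : linear (fun x => - (K i x).1).
  by move=> c x y; rewrite linearP opprD -scalerN.
have [l lE] := @reindex_succ (fun i => {linear P (i + 1) -> X i}) (fun i => Lin (lin1 i)).
exists l; apply: int_all_succ => i x; rewrite !lE /= subr0 KE1.
by rewrite linearN.
Qed.

Lemma qis_cancel (b b' : chain P X) :
  homotopic (chain_o s b) (chain_o s b') -> homotopic b b'.
Proof.
move=> [h hE]; apply/homotopic_sub/qis_lift_null; exists h => i x.
by rewrite -hE /= subr0 linearB.
Qed.

End Cone.

End Complexes.

(** * Morphisms of the derived category as homotopy classes *)

Section HomotopyEqual.
Variable A : pzRingType.
Implicit Types X Y Z : bcomplex A.

Lemma dhom_eq_comp X Y Z (f f' : dhom X Y) (g g' : dhom Y Z) h h' :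
  dhom_eq f f' -> dhom_eq g g' -> dhom_eq h (DComp f g) -> dhom_eq h' (DComp f' g') ->
  dhom_eq h h'.
Proof.
move=> ff gg hE h'E; apply: DTrans hE _; apply: DTrans (DSym h'E).
exact: DCompEq.
Qed.

Lemma dhom_cancel X Y Z (s : chain_map X Y) (qs : quasi_iso s) (f g : dhom Z X) :
  dhom_eq (DComp f (DMap s)) (DComp g (DMap s)) -> dhom_eq f g.
Proof.
have E (k : dhom Z X) : dhom_eq k (DComp (DComp k (DMap s)) (DInv qs)).
  apply: DTrans (DSym (DCompId k)) _; apply: DTrans (DCompA _ _ _).
  exact: DCompEq (DRefl _) (DSym (DMapInv qs)).
by move=> fg; apply: dhom_eq_comp fg (DRefl (DInv qs)) (E f) (E g).
Qed.

Lemma dhom_cancel_l X Y Z (s : chain_map X Y) (qs : quasi_iso s) (f g : dhom Y Z) :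
  dhom_eq (DComp (DMap s) f) (DComp (DMap s) g) -> dhom_eq f g.
Proof.
have E (k : dhom Y Z) : dhom_eq k (DComp (DInv qs) (DComp (DMap s) k)).
  apply: DTrans (DSym (DIdComp k)) _; apply: DTrans (DSym (DCompA _ _ _)).
  exact: DCompEq (DSym (DInvMap qs)) (DRefl _).
by move=> fg; apply: dhom_eq_comp (DRefl (DInv qs)) fg (E f) (E g).
Qed.

Variable X : bcomplex A.

Definition dbl_diff_fun i (z : (X i * X i)%type) : (X (i + 1)%R * X (i + 1)%R)%type :=
  (diff X i z.1, diff X i z.2).
Fact dbl_diff_linear i : linear (@dbl_diff_fun i).
Proof. by move=> a [x y] [x' y']; rewrite /dbl_diff_fun /= !linearP. Qed.

Definition dbl : bcomplex A.
Proof.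
unshelve eapply (@BComplex A (fun i => (X i * X i)%type) (fun i => Lin (@dbl_diff_linear i))).
- by move=> i [x y] /=; rewrite /dbl_diff_fun /= !diffK.
- by move=> i; apply: fg_prod; apply: cx_fg.
- by have [n Xn] := cx_bounded X; exists n => i ni [x y]; rewrite (Xn i ni x) (Xn i ni y).
Defined.

Fact cyl_map_linear i : linear (fun x : X i => (x, - x) : X i * X i).
Proof. by move=> a x y; rewrite opprD -scalerN. Qed.

Definition cyl_map : chain_map X dbl.
Proof.
exists (fun i => Lin (@cyl_map_linear i)) => i x.
by rewrite /= /dbl_diff_fun /= linearN.
Defined.

(** The cylinder of [X]: a homotopy from [f] to [g] is a chain map out of it that restricts to [f]
    and [g] on the two ends. The ends agree in the derived category, being sections of one
    quasi-isomorphism ([cyl_in_eq]). *)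
Definition cyl := cone cyl_map.

Fact cyl_proj_linear i : linear (fun z : cyl i => z.2.1 + z.2.2).
Proof. by move=> a x y /=; rewrite scalerDr; abel. Qed.

Definition cyl_proj : chain_map cyl X.
Proof.
exists (fun i => Lin (@cyl_proj_linear i)) => i [x [y z]].
by rewrite /= linearD; abel.
Defined.

Lemma cyl_proj_qis : quasi_iso cyl_proj.
Proof.
move=> i; split=> [[x [y z]]|y dy] /=.
  move=> [_ _ dz] [w dw]; exists (- z, (w, 0)).
  rewrite /= /cone_diff_fun /= /dbl_diff_fun /= linearN !opprK linear0; congr (_, (_, _)).
  - by apply/eqP; rewrite -subr_eq0 -[X in _ == X]dz; apply/eqP; abel.
  - by rewrite dw /=; abel.
  - by rewrite /=; abel.
exists (0, (y, 0)); last by exists 0; rewrite linear0 addr0 subrr.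
by rewrite /= /cone_diff_fun /= /dbl_diff_fun /= !linear0 dy ?oppr0 !add0r.
Qed.

Fact cyl_in1_linear i : linear (fun y : X i => (0, (y, 0)) : cyl i).
Proof. by move=> a y z; congr (_, (_, _)); rewrite /= scaler0 addr0. Qed.
Fact cyl_in2_linear i : linear (fun y : X i => (0, (0, y)) : cyl i).
Proof. by move=> a y z; congr (_, (_, _)); rewrite /= scaler0 addr0. Qed.

Definition cyl_in1 : chain_map X cyl.
Proof.
exists (fun i => Lin (@cyl_in1_linear i)) => i x.
by rewrite /= /cone_diff_fun /= /dbl_diff_fun /= !linear0 ?oppr0 !add0r.
Defined.
Definition cyl_in2 : chain_map X cyl.
Proof.
exists (fun i => Lin (@cyl_in2_linear i)) => i x.
by rewrite /= /cone_diff_fun /= /dbl_diff_fun /= !linear0 ?oppr0 !add0r.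
Defined.

Lemma cyl_in_eq : dhom_eq (DMap cyl_in1) (DMap cyl_in2).
Proof.
apply: (dhom_cancel cyl_proj_qis); apply: DTrans (DSym (DMapComp _ _)) _.
apply: DTrans (DMapComp _ _); apply: DMapEq => i x /=.
by rewrite addr0 add0r.
Qed.

Lemma homotopic_dhom Y (f g : chain_map X Y) :
  homotopic (chain_of f) (chain_of g) -> dhom_eq (DMap f) (DMap g).
Proof.
move=> [h hE].
have lin i : linear (fun z : cyl i => h i z.1 + f i z.2.1 + g i z.2.2).
  by move=> a x y /=; rewrite !linearP !scalerDr; abel.
have ch i (z : cyl i) : diff Y i (Lin (lin i) z) = Lin (lin (i + 1)) (diff cyl i z).
  case: z => x [y z].
  have hx : diff Y i (h i x) = f (i + 1) x - g (i + 1) x - h (i + 1) (diff X (i + 1) x).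
    by rewrite [X in _ = X - _](hE i x) /=; abel.
  by rewrite /= !linearD !linearN !cmapP hx; abel.
pose H := ChainMap ch.
apply: DTrans (_ : dhom_eq _ (DComp (DMap cyl_in1) (DMap H))) _.
  apply: DTrans (DMapComp _ _); apply: DMapEq => i x /=.
  by rewrite !linear0 add0r addr0.
apply: DTrans (DCompEq cyl_in_eq (DRefl _)) _.
apply: DTrans (DSym (DMapComp _ _)) _; apply: DMapEq => i x /=.
by rewrite !linear0 !add0r.
Qed.

End HomotopyEqual.

Section Action.
Variables (A : pzRingType) (P : cplx A).
Implicit Types X Y Z : bcomplex A.
Hypothesis P_proj : proj_cplx P.

(* The action of a morphism of the derived category on homotopy classes of    *)
(* chain maps from a complex of projectives. *)
Fixpoint act X Y (f : dhom X Y) : chain P (cx_of X) -> chain P (cx_of Y) -> Prop :=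
  match f in dhom X Y return chain P (cx_of X) -> chain P (cx_of Y) -> Prop with
  | DMap _ _ f => fun a b => homotopic b (chain_o (chain_of f) a)
  | DInv _ _ s _ => fun a b => homotopic (chain_o (chain_of s) b) a
  | DComp _ _ _ f g => fun a c => exists2 b, act f a b & act g b c
  end.

Lemma act_total X Y (f : dhom X Y) a : exists b, act f a b.
Proof.
elim: f a => {X Y} [X Y f|X Y s qs|X Y Z f IHf g IHg] a /=.
- by exists (chain_o (chain_of f) a); apply: homotopic_refl.
- exact: (qis_lift P_proj (s := chain_of s)).
- by have [b fb] := IHf a; have [c gc] := IHg b; exists c, b.
Qed.

Lemma act_unique X Y (f : dhom X Y) a a' b b' :
  act f a b -> act f a' b' -> homotopic a a' -> homotopic b b'.
Proof.
elim: f a a' b b' => {X Y} [X Y f|X Y s qs|X Y Z f IHf g IHg] a a' b b' /=.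
- move=> fb fb' aa'; apply: homotopic_trans fb _; apply: homotopic_trans (homotopic_sym fb').
  exact: homotopic_post.
- move=> sb sb' aa'; apply: (qis_cancel P_proj (s := chain_of s)) => //.
  by apply: homotopic_trans sb _; apply: homotopic_trans aa' (homotopic_sym sb').
- by move=> [c fc gc] [c' fc' gc'] aa'; apply: IHg gc gc' _; apply: IHf fc fc' aa'.
Qed.

Lemma act_resp X Y (f : dhom X Y) a a' b b' :
  act f a b -> homotopic a a' -> homotopic b b' -> act f a' b'.
Proof.
elim: f a a' b b' => {X Y} [X Y f|X Y s qs|X Y Z f IHf g IHg] a a' b b' /=.
- move=> fb aa' bb'; apply: homotopic_trans (homotopic_sym bb') _.
  by apply: homotopic_trans fb _; apply: homotopic_post.
- move=> sb aa' bb'; apply: homotopic_trans aa'; apply: homotopic_trans sb.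
  by apply: homotopic_post; apply: homotopic_sym.
- move=> [c fc gc] aa' bb'; exists c; first exact: IHf fc aa' (homotopic_refl _).
  exact: IHg gc (homotopic_refl _) bb'.
Qed.

Lemma act_eq X Y (f g : dhom X Y) : dhom_eq f g -> forall a b, act f a b <-> act g a b.
Proof.
elim=> {X Y f g} [//|X Y f g _ IH a b|X Y f g h _ IH _ IH' a b||X Y f|X Y f|||X Y Z f g|X Y s qs|X Y s qs].
- by rewrite IH.
- by rewrite IH.
- move=> X Y Z f f' g g' _ IHf _ IHg a b /=.
  by split=> -[c fc gc]; exists c; [apply/IHf|apply/IHg|apply/IHf|apply/IHg].
- move=> a b /=; split=> [[c ca fc]|fa].
    apply: (act_resp fc) (homotopic_refl _); apply: homotopic_trans ca _.
    exact: homotopic_eq.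
  by exists a => //; apply: homotopic_eq.
- move=> a b /=; split=> [[c fc cb]|fa].
    apply: act_resp fc (homotopic_refl _) _; apply: homotopic_sym.
    by apply: homotopic_trans cb _; apply: homotopic_eq.
  by exists b => //; apply: homotopic_eq.
- move=> X Y Z W f g h a b /=; split=> [[c fc [e ge he]]|[c [e fe gc] hc]].
    by exists e => //; exists c.
  by exists e => //; exists c.
- move=> X Y f g fg a b /=.
  have E : homotopic (chain_o (chain_of f) a) (chain_o (chain_of g) a).
    by apply: homotopic_eq => i x /=; apply: fg.
  by split=> H; apply: homotopic_trans H _ => //; apply: homotopic_sym.
- move=> a b /=; split=> [H|[c fc gc]].
    by exists (chain_o (chain_of f) a); [apply: homotopic_refl|].
  by apply: homotopic_trans gc _; apply: homotopic_post fc.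
- move=> a b /=; split=> [[c ca bc]|ba].
    apply: homotopic_trans (_ : homotopic b a) (homotopic_eq _) => //.
    by apply: (qis_cancel P_proj (s := chain_of s)) => //; apply: homotopic_trans bc ca.
  exists (chain_o (chain_of s) b); last exact: homotopic_refl.
  by apply: homotopic_post; apply: homotopic_trans ba _; apply: homotopic_eq.
- move=> a b /=; split=> [[c ca bc]|ba].
    by apply: homotopic_trans bc _; apply: homotopic_trans ca _; apply: homotopic_eq.
  have [c cP] := act_total (DInv qs) a; exists c => //.
  apply: homotopic_trans ba _; apply: homotopic_trans (homotopic_sym cP).
  exact: homotopic_eq.
Qed.

End Action.

(** * Free resolutions and truncations *)

Section FreeComplexes.
Variable A : pzRingType.

Record fcx := Fcx {
  sz : int -> nat;
  mx : forall i, 'M[A]_(sz i, sz (i + 1));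
  mxK : forall i, mx i *m mx (i + 1) = 0;
  sz_top : exists N : int, forall i, N <= i -> sz i = 0%N
}.

Fact mulmxr_linear m n (M : 'M[A]_(m, n)) : linear (fun x : 'rV[A]_m => x *m M).
Proof. by move=> a x y; rewrite mulmxDl scalemxAl. Qed.

Definition mxlin m n (M : 'M[A]_(m, n)) : {linear 'rV[A]_m -> 'rV[A]_n} :=
  Lin (mulmxr_linear M).

Lemma mxlinP m n (f : {linear 'rV[A]_m -> 'rV[A]_n}) :
  exists M : 'M[A]_(m, n), forall x, f x = x *m M.
Proof. by exists (lin1_mx f) => x; rewrite mul_rV_lin1. Qed.

Definition fc (P : fcx) : cplx A.
Proof.
exists (fun i => 'rV[A]_(sz P i) : lmodType A) (fun i => mxlin (mx P i)).
by move=> i x; rewrite /= -mulmxA mxK mulmx0.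
Defined.

Lemma fc_proj P : proj_cplx (fc P).
Proof.
split=> [i|]; first exact: rv_dual_basis.
have [N PN] := sz_top P; exists N => i /PN /= PNi x.
by move: x; rewrite PNi => x; rewrite [x]thinmx0.
Qed.

Section Resolution.
Hypothesis A_noeth : left_noetherian A.
Variables (X : bcomplex A) (N : int).
Hypothesis X_top : forall i, N <= i -> forall x : X i, x = 0.

Record res_state i := ResState {
  rs_sz : nat;
  rs_map : {linear 'rV[A]_rs_sz -> X i};
  rs_cyc : submod 'rV[A]_rs_sz
}.

(** The new free module covers the fibre product of the cycles in degree i + 1 and [X i] over
    [X (i + 1)]. Both halves of being a quasi-isomorphism follow from this. *)
Definition res_rel i (t : res_state (i + 1)) (t' : res_state i) :=
  exists q : 'M[A]_(rs_sz t', rs_sz t),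
  [/\ forall v, rs_cyc t (v *m q) /\ diff X i (rs_map t' v) = rs_map t (v *m q),
      forall v, rs_cyc t' v <-> v *m q = 0 &
      forall y x, rs_cyc t y -> rs_map t y = diff X i x ->
        exists v, y = v *m q /\ x = rs_map t' v].

Lemma res_step i (t : res_state (i + 1)) : exists t', res_rel t t'.
Proof.
have lin : linear (fun z : 'rV[A]_(rs_sz t) * X i => rs_map t z.1 - diff X i z.2).
  by move=> a x y /=; rewrite !linearP scalerBr ?scalerN /=; abel.
pose D := sm_cap (sm_prod (rs_cyc t) (sm_top (X i))) (sm_ker (Lin lin)).
have [n [v [Dv vP]]] := fg_submod A_noeth D (fg_prod (fg_rv A _) (cx_fg X i)).
have lin1 : linear (fst \o rvlin v) by move=> a x y; rewrite /= -[X in fst X]/(rvlin v _) linearP.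
have lin2 : linear (snd \o rvlin v) by move=> a x y; rewrite /= -[X in snd X]/(rvlin v _) linearP.
have [q qE] := mxlinP (Lin lin1).
exists (@ResState i n (Lin lin2) (sm_ker (mxlin q))); exists q.
have DU u : D (rvlin v u) by apply: sm_sum => k; apply: smZ.
split=> [u|u //|y x ty txy].
  rewrite -qE; have [[cu _] /eqP] := DU u.
  by rewrite subr_eq0 => /eqP <-.
have [|c cE] := vP (y, x); first by split; [split | rewrite /= txy subrr].
exists (\row_k c k); rewrite -qE /=.
have -> : \sum_i0 (\row_k c k) 0 i0 *: v i0 = (y, x).
  by rewrite cE; apply: eq_bigr => k _; rewrite mxE.
by [].
Qed.

Lemma free_resolution : exists P : fcx, (forall i, N <= i -> sz P i = 0%N) /\
  exists f : chain (fc P) (cx_of X), qis f.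
Proof.
pose z i : res_state i := @ResState i 0 \0 (sm_top _).
have [|i Ni|i t _|F [Fz FR]] := @int_down res_state (fun _ _ => True) res_rel z N.
- by [].
- exists 0; split=> [v|v|y x _ _].
  + by rewrite /= linear0.
  + by rewrite mulmx0.
  + by exists 0; rewrite (X_top Ni x) [y]thinmx0 mulmx0.
- by have [t' tt'] := res_step t; exists t'.
pose q i := projT1 (cid (FR i)); have qP i := projT2 (cid (FR i)).
have qK i : q i *m q (i + 1) = 0.
  apply/row_matrixP => k; rewrite row_mul row0.
  have [_ cyc1 _] := qP (i + 1); have [cyc0 _ _] := qP i.
  by rewrite rowE; apply/cyc1; have [] := cyc0 (delta_mx 0 k).
have top : exists N : int, forall i, N <= i -> rs_sz (F i) = 0%N.
  by exists N => i /Fz ->.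
exists (Fcx qK top); split=> [i /Fz /= -> //|].
have ch i (x : 'rV_(rs_sz (F i))) : diff X i (rs_map (F i) x) = rs_map (F (i + 1)) (x *m q i).
  by have [/(_ x)[]] := qP i.
exists (@Chain _ (fc (Fcx qK top)) (cx_of X) (fun i => rs_map (F i)) ch) => i; split=> /=.
- move=> x xq [y dy]; have [_ cyc1 _] := qP (i + 1); have [_ _ surj] := qP i.
  by have [|//|v [-> _]] := surj x y; [apply/cyc1 | exists v].
- move=> y dy; have [_ _ surj] := qP (i + 1).
  have [||v [v0 ->]] := surj 0 y; [exact: sm0 | by rewrite linear0|].
  by exists v => //; exists 0; rewrite linear0 subrr.
Qed.

End Resolution.

(** * Truncations of free complexes *)

Section Truncation.
Variables (P : fcx) (c : int).

(** The quotient by these keeps the cohomology above degree c, kills it elsewhere, and has the image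
    of the differential in degree c. It is bounded, hence an object of D^b(mod A). *)
Definition tr_sub i : submod 'rV[A]_(sz P i) :=
  if i < c then sm_top _ else if i == c then sm_ker (mxlin (mx P i)) else sm_bot _.

Lemma tr_sub_diff i x : tr_sub i x -> tr_sub (i + 1) (x *m mx P i).
Proof.
rewrite /tr_sub; have [ic|ci|ic] := ltgtP i c; last first.
- by move=> /= ->; apply: sm0.
- by move=> /= ->; rewrite mul0mx; apply: sm0.
- move=> _; have [//|ic1|_] := ltgtP (i + 1) c; first by exfalso; lia.
  by rewrite /= -mulmxA mxK mulmx0.
Qed.

Definition tau i : {linear 'rV[A]_(sz P i) -> quot (tr_sub i)} := qproj _.

Fact tr_diff_key i : {d : {linear quot (tr_sub i) -> quot (tr_sub (i + 1))} |
  forall x, d (tau i x) = tau (i + 1) (x *m mx P i)}.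
Proof.
apply/cid/(@surj_factor _ _ _ _ (tau i) (tau (i + 1) \o mxlin (mx P i))).
  exact: qproj_surj.
by move=> x /qproj_eq0/tr_sub_diff Wx; apply/qproj_eq0.
Qed.

Definition tr_diff i := sval (tr_diff_key i).

Lemma tr_diffE i x : tr_diff i (tau i x) = tau (i + 1) (x *m mx P i).
Proof. exact: (svalP (tr_diff_key i)). Qed.

Lemma tau_surj i (u : quot (tr_sub i)) : exists x, tau i x = u.
Proof. exact: qproj_surj. Qed.

Lemma tau_eq0 i x : tau i x = 0 <-> tr_sub i x.
Proof. exact: qproj_eq0. Qed.

Lemma tr_zero_below i (u : quot (tr_sub i)) : i < c -> u = 0.
Proof. by move=> ic; have [x <-] := tau_surj u; apply/tau_eq0; rewrite /tr_sub ic. Qed.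

Lemma tr_diffK i u : tr_diff (i + 1) (tr_diff i u) = 0.
Proof.
have [x <-] := tau_surj u; rewrite !tr_diffE -mulmxA mxK mulmx0.
exact: linear0.
Qed.

Lemma tr_fg i : fg_module (quot (tr_sub i)).
Proof. exact: fg_surj (@tau_surj i) (fg_rv A _). Qed.

Lemma tr_bounded : exists n : nat, forall i : int, (n < `|i|)%N ->
  forall u : quot (tr_sub i), u = 0.
Proof.
have [N PN] := sz_top P; exists (maxn `|N| `|c|) => i; rewrite gtn_max => /andP[iN ic] u.
have [ltic|leci] := ltrP i c; first exact: tr_zero_below.
have Ni : N <= i by lia.
have [x <-] := tau_surj u; suff -> : x = 0 by exact: linear0.
by clear -x PN Ni; move: x; rewrite (PN i Ni) => x; rewrite [x]thinmx0.
Qed.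

Definition tr : bcomplex A :=
  @BComplex A (fun i => quot (tr_sub i)) tr_diff tr_diffK tr_fg tr_bounded.

Definition tauc : chain (fc P) (cx_of tr) := @Chain _ (fc P) (cx_of tr) tau tr_diffE.

Variable X : bcomplex A.
Hypothesis X_below : forall i, i <= c -> forall x : X i, x = 0.

Lemma tr_sub_below i (x : 'rV[A]_(sz P i)) : tr_sub i x -> i <= c \/ x = 0.
Proof.
rewrite /tr_sub; have [ic _|ci x0|ic _] := ltgtP i c.
- by left.
- by right.
- by left.
Qed.

Lemma tr_factor (a : chain (fc P) (cx_of X)) :
  exists a' : chain_map tr X, forall i x, a' i (tau i x) = a i x.
Proof.
have ex i : exists a' : {linear tr i -> X i}, forall x, a' (tau i x) = a i x.
  apply: surj_factor (@tau_surj i) _ => x /tau_eq0/tr_sub_below[ic|->].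
    exact: X_below.
  exact: linear0.
pose a' i := projT1 (cid (ex i)); have a'E i := projT2 (cid (ex i)).
have ch i u : diff X i (a' i u) = a' (i + 1) (tr_diff i u).
  by have [x <-] := tau_surj u; rewrite tr_diffE !a'E; apply: (cmP a).
by exists (@ChainMap _ tr X a' ch).
Qed.

Lemma tr_homotopic (a b : chain (fc P) (cx_of X)) (a' b' : chain_map tr X) :
  (forall i x, a' i (tau i x) = a i x) -> (forall i x, b' i (tau i x) = b i x) ->
  homotopic a b -> homotopic (chain_of a') (chain_of b').
Proof.
move=> a'E b'E [h hE].
have ex i : exists h' : {linear tr (i + 1) -> X i}, forall x, h' (tau (i + 1) x) = h i x.
  apply: surj_factor (@tau_surj (i + 1)) _ => x /tau_eq0/tr_sub_below[ic|->].
    by apply: X_below; lia.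
  exact: linear0.
pose h' i := projT1 (cid (ex i)); have h'E i := projT2 (cid (ex i)).
exists h' => i u; have [x <-] := tau_surj u.
by rewrite /= a'E b'E tr_diffE !h'E; apply: hE.
Qed.

Lemma tr_qis (a : chain (fc P) (cx_of X)) (a' : chain_map tr X) :
  (forall i x, a' i (tau i x) = a i x) -> qis a -> quasi_iso a'.
Proof.
move=> a'E qa i; have [inj surj] := qa i; split=> [u|y dy].
  have [x <-] := tau_surj u; rewrite [X in X = 0]tr_diffE a'E => /tau_eq0 Wx dy.
  have [ic|ci] := ltrP (i + 1) c.
    by exists 0; rewrite linear0; apply: esym; apply: (tr_zero_below (i := i + 1)).
  have x0 : x *m mx P (i + 1) = 0.
    by move: Wx; rewrite /tr_sub; have [||] := ltgtP (i + 1 + 1) c => // H _; exfalso; lia.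
  have [z <-] := inj x x0 dy; exists (tau i z); exact: tr_diffE.
have [x dx [z dz]] := surj y dy.
exists (tau (i + 1) x); first by rewrite [LHS]tr_diffE [X in tau _ X]dx linear0.
by exists z; rewrite a'E.
Qed.

End Truncation.

Lemma bcomplex_below (X : bcomplex A) : exists c0 : int, forall i, i <= c0 -> forall x : X i, x = 0.
Proof.
have [n Xn] := cx_bounded X; exists (- n.+1%:Z) => i ic x; apply: Xn; lia.
Qed.

(** A morphism is a composite through complexes with different lower bounds; [c] must be below all
    of them so that chain maps and homotopies factor through the truncation. *)
Lemma act_tr (P : fcx) X Y (f : dhom X Y) (a : chain (fc P) (cx_of X))
    (b : chain (fc P) (cx_of Y)) : act f a b ->
  exists c0 : int, forall c, c <= c0 -> forall (a' : chain_map (tr P c) X)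
    (b' : chain_map (tr P c) Y),
    (forall i x, a' i (tau P c i x) = a i x) ->
    (forall i x, b' i (tau P c i x) = b i x) -> dhom_eq (DComp (DMap a') f) (DMap b').
Proof.
elim: f a b => {X Y} [X Y f|X Y s qs|X Y Z f IHf g IHg] a b /=.
- move=> fab; have [c0 Y0] := bcomplex_below Y; exists c0 => c cc0 a' b' a'E b'E.
  apply: DTrans (DSym (DMapComp _ _)) _; apply: homotopic_dhom.
  apply: tr_homotopic (homotopic_sym fab) => [i ic||//]; first by apply: Y0; lia.
  by move=> i x /=; rewrite a'E.
- move=> sb; have [c0 Y0] := bcomplex_below Y; exists c0 => c cc0 a' b' a'E b'E.
  have E : dhom_eq (DMap a') (DComp (DMap b') (DMap s)).
    apply: DTrans (DMapComp _ _); apply: homotopic_dhom; apply: homotopic_sym.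
    apply: tr_homotopic sb => [i ic||//]; first by apply: Y0; lia.
    by move=> i x /=; rewrite b'E.
  apply: DTrans (DCompEq E (DRefl _)) _; apply: DTrans (DSym (DCompA _ _ _)) _.
  by apply: DTrans (DCompEq (DRefl _) (DMapInv qs)) _; apply: DCompId.
- move=> [e fe ge]; have [c1 c1P] := IHf _ _ fe; have [c2 c2P] := IHg _ _ ge.
  have [c3 Y0] := bcomplex_below Y; exists (Num.min c1 (Num.min c2 c3)) => c cc a' b' a'E b'E.
  have [|e' e'E] := @tr_factor P c Y _ e; first by move=> i ic; apply: Y0; lia.
  apply: DTrans (DCompA _ _ _) _.
  have cc1 : c <= c1 by lia.
  have cc2 : c <= c2 by lia.
  exact: DTrans (DCompEq (c1P c cc1 a' e' a'E e'E) (DRefl _)) (c2P c cc2 e' b' e'E b'E).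
Qed.

(** * Hom in the derived category from a free resolution *)

Section Morphisms.
Variables (P : fcx) (X Y : bcomplex A) (p : chain (fc P) (cx_of X)).
Hypothesis p_qis : qis p.

Lemma act_inj (f g : dhom X Y) a b : act f p a -> act g p b -> homotopic a b -> dhom_eq f g.
Proof.
move=> fa gb ab; have [c1 c1P] := act_tr fa; have [c2 c2P] := act_tr gb.
have [c3 X0] := bcomplex_below X; have [c4 Y0] := bcomplex_below Y.
pose c := Num.min (Num.min c1 c2) (Num.min c3 c4).
have X0c i : i <= c -> forall x : X i, x = 0 by move=> ic; apply: X0; lia.
have Y0c i : i <= c -> forall x : Y i, x = 0 by move=> ic; apply: Y0; lia.
have [p' p'E] := tr_factor X0c p.
have [a' a'E] := tr_factor Y0c a; have [b' b'E] := tr_factor Y0c b.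
apply: (dhom_cancel_l (tr_qis p'E p_qis)).
have cc1 : c <= c1 by lia.
have cc2 : c <= c2 by lia.
apply: DTrans (c1P c cc1 _ _ p'E a'E) _; apply: DTrans _ (DSym (c2P c cc2 _ _ p'E b'E)).
exact/homotopic_dhom/(tr_homotopic Y0c a'E b'E).
Qed.

Lemma act_surj (a : chain (fc P) (cx_of Y)) : exists f : dhom X Y, act f p a.
Proof.
have [c3 X0] := bcomplex_below X; have [c4 Y0] := bcomplex_below Y.
pose c := Num.min c3 c4.
have X0c i : i <= c -> forall x : X i, x = 0 by move=> ic; apply: X0; lia.
have Y0c i : i <= c -> forall x : Y i, x = 0 by move=> ic; apply: Y0; lia.
have [p' p'E] := tr_factor X0c p; have [a' a'E] := tr_factor Y0c a.
exists (DComp (DInv (tr_qis p'E p_qis)) (DMap a')); exists (tauc P c).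
  by apply: homotopic_eq => i x /=; rewrite p'E.
by apply: homotopic_eq => i x /=; rewrite a'E.
Qed.

(** By [act_inj] and [act_surj], Hom(X, Y) is the set of homotopy classes of chain maps from [P] to
    [Y]. *)
Lemma dhom_trivialP : (forall f g : dhom X Y, dhom_eq f g) <->
  (forall a : chain (fc P) (cx_of Y), homotopic a (chain_zero _ _)).
Proof.
split=> [triv a|triv f g].
  have [f fa] := act_surj a; have [g g0] := act_surj (chain_zero (fc P) (cx_of Y)).
  apply: (act_unique (fc_proj P)) fa _ (homotopic_refl p).
  exact/(act_eq (fc_proj P) (triv f g)).
have [a fa] := act_total (fc_proj P) f p; have [b gb] := act_total (fc_proj P) g p.
apply: act_inj fa gb _; apply: homotopic_trans (triv a) _.
exact/homotopic_sym/triv.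
Qed.

End Morphisms.

End FreeComplexes.

(** * A property of triangulated categories invariant under equivalence *)

Local Open Scope derived_scope.

#[local] Instance hom_eq_equivalence (C : category) (X Y : C) :
  RelationClasses.Equivalence (@hom_eq C X Y).
Proof.
by split; [exact: hom_eq_refl | exact: hom_eq_sym | exact: hom_eq_trans].
Qed.

#[local] Instance comp_hom_proper (C : category) (X Y Z : C) :
  Morphisms.Proper (Morphisms.respectful (@hom_eq C X Y)
    (Morphisms.respectful (@hom_eq C Y Z) (@hom_eq C X Z))) (@comp_hom C X Y Z).
Proof. by move=> f f' ff g g' gg; apply: comp_hom_eq. Qed.

#[local] Instance fmap_proper (C D : category) (F : functor C D) (X Y : C) :
  Morphisms.Proper (Morphisms.respectful (@hom_eq C X Y) (@hom_eq D (F X) (F Y)))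
    (@fmap C D F X Y).
Proof. by move=> f g fg; apply: fmap_eq. Qed.

#[local] Hint Resolve hom_eq_refl : core.

Section Category.
Variable C : category.
Implicit Types X Y Z : C.

Definition hom_trivial X Y := forall f g : hom X Y, f === g.

(* The zero maps, described without reference to the additive structure.      *)
Definition zero_map X Y (f : hom X Y) :=
  exists Z (a : hom X Z) (b : hom Z Y), hom_trivial Z Z /\ f === a ;; b.

Definition brick X := forall f : hom X X, zero_map f \/ is_iso f.

Definition isomorphic X Y := exists f : hom X Y, is_iso f.

Lemma isomorphic_sym X Y : isomorphic X Y -> isomorphic Y X.
Proof. by move=> [f [g [fg gf]]]; exists g, f. Qed.

Lemma is_iso_comp X Y Z (f : hom X Y) (g : hom Y Z) :
  is_iso f -> is_iso g -> is_iso (f ;; g).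
Proof.
move=> [f' [ff' f'f]] [g' [gg' g'g]]; exists (g' ;; f'); split.
  by rewrite comp_homA -(comp_homA f) gg' comp_hom_id.
by rewrite comp_homA -(comp_homA g') f'f comp_hom_id.
Qed.

Lemma isomorphic_trans X Y Z : isomorphic X Y -> isomorphic Y Z -> isomorphic X Z.
Proof. by move=> [f fi] [g gi]; exists (f ;; g); apply: is_iso_comp. Qed.

Lemma isomorphic_refl X : isomorphic X X.
Proof. by exists (id_hom X), (id_hom X); split; apply: comp_id_hom. Qed.

Lemma is_iso_eq X Y (f g : hom X Y) : f === g -> is_iso f -> is_iso g.
Proof. by move=> fg [h [fh hf]]; exists h; rewrite -fg. Qed.

Lemma hom_trivial_iso X X' Y Y' : isomorphic X X' -> isomorphic Y Y' ->
  hom_trivial X Y -> hom_trivial X' Y'.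
Proof.
move=> [a [a' [aa' a'a]]] [b [b' [bb' b'b]]] triv f g.
have E (k : hom X' Y') : k === a' ;; (a ;; k ;; b') ;; b.
  rewrite !comp_homA a'a comp_id_hom -comp_homA b'b comp_hom_id.
  exact: hom_eq_refl.
by rewrite (E f) (E g) (triv (a ;; f ;; b') (a ;; g ;; b')).
Qed.

Lemma brick_iso X X' : isomorphic X X' -> brick X -> brick X'.
Proof.
move=> [a [a' [aa' a'a]]] X_brick f.
have fE : f === a' ;; (a ;; f ;; a') ;; a.
  by rewrite !comp_homA a'a comp_id_hom -comp_homA a'a comp_hom_id.
have [[Z [u [v [Z0 uv]]]]|afa] := X_brick (a ;; f ;; a').
  left; exists Z, (a' ;; u), (v ;; a); split=> //.
  by rewrite fE uv !comp_homA.
right; apply: is_iso_eq (hom_eq_sym fE) _; apply: is_iso_comp; first apply: is_iso_comp => //.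
  by exists a.
by exists a'.
Qed.

End Category.

Section Triangulated.
Variable C : triangulated.
Implicit Types X Y : C.

Definition shiftn n X : C := iter n (shift C) X.

Definition left_bounded Y := forall X, brick X ->
  exists n0 : nat, forall n, (n0 <= n)%N -> hom_trivial Y (shiftn n X).

Definition right_bounded Y := forall X, brick X ->
  exists n0 : nat, forall n, (n0 <= n)%N -> hom_trivial X (shiftn n Y).

Definition balanced := forall Y, left_bounded Y <-> right_bounded Y.

Lemma functor_iso (D E : category) (F : functor D E) (X Y : D) (f : hom X Y) :
  is_iso f -> is_iso (fmap F f).
Proof.
move=> [g [fg gf]]; exists (fmap F g); rewrite -!fmap_comp fg gf !fmap_id.
by split; apply: hom_eq_refl.
Qed.

Lemma shiftn_iso n X Y : isomorphic X Y -> isomorphic (shiftn n X) (shiftn n Y).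
Proof.
move=> XY; elim: n => [//|n [f fi]].
by exists (fmap (shift C) f); apply: functor_iso.
Qed.

Lemma left_bounded_iso Y Y' : isomorphic Y Y' -> left_bounded Y -> left_bounded Y'.
Proof.
move=> YY' bY X X_brick; have [n0 n0P] := bY X X_brick; exists n0 => n nn0.
by apply: hom_trivial_iso YY' (isomorphic_refl _) (n0P n nn0).
Qed.

Lemma right_bounded_iso Y Y' : isomorphic Y Y' -> right_bounded Y -> right_bounded Y'.
Proof.
move=> YY' bY X X_brick; have [n0 n0P] := bY X X_brick; exists n0 => n nn0.
by apply: hom_trivial_iso (isomorphic_refl _) _ (n0P n nn0); apply: shiftn_iso.
Qed.

End Triangulated.

(** * Transport of boundedness along an equivalence *)

Section Equivalence.
Variables (C D : triangulated) (F : functor C D) (G : functor D C).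
Variables (theta : forall X : C, hom (F (shift C X)) (shift D (F X))).
Variables (eta : forall X : C, hom X (G (F X))) (eps : forall Y : D, hom (F (G Y)) Y).
Hypothesis eta_iso : forall X, is_iso (eta X).
Hypothesis eps_iso : forall Y, is_iso (eps Y).
Hypothesis eta_nat : forall (X X' : C) (f : hom X X'),
  eta X ;; fmap G (fmap F f) === f ;; eta X'.
Hypothesis eps_nat : forall (Y Y' : D) (g : hom Y Y'),
  eps Y ;; g === fmap F (fmap G g) ;; eps Y'.
Hypothesis theta_iso : forall X, is_iso (theta X).

Lemma equiv_faithful (X Y : C) (f g : hom X Y) : fmap F f === fmap F g -> f === g.
Proof.
move=> fg; have [e [ee _]] := eta_iso Y.
have E (k : hom X Y) : k === eta X ;; fmap G (fmap F k) ;; e.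
  by rewrite eta_nat -comp_homA ee comp_hom_id.
by rewrite (E f) (E g) fg.
Qed.

Lemma equiv_faithful_inv (X Y : D) (f g : hom X Y) : fmap G f === fmap G g -> f === g.
Proof.
move=> fg; have [e [_ ee]] := eps_iso X.
have E (k : hom X Y) : k === e ;; (fmap F (fmap G k) ;; eps Y).
  by rewrite -eps_nat comp_homA ee comp_id_hom.
by rewrite (E f) (E g) fg.
Qed.

(** By naturality of [eta], the morphism [f] built from G k satisfies G (F f) = G k, and [G] is
    faithful as well. *)
Lemma equiv_full (X Y : C) (k : hom (F X) (F Y)) : exists f : hom X Y, fmap F f === k.
Proof.
have [e [ee e'e]] := eta_iso Y; have [d [dd d'd]] := eta_iso X.
exists (eta X ;; fmap G k ;; e); apply: equiv_faithful_inv.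
set f := _ ;; e.
have E : eta X ;; fmap G (fmap F f) === eta X ;; fmap G k.
  by rewrite eta_nat /f -comp_homA e'e comp_hom_id.
have := comp_hom_eq (hom_eq_refl d) E.
by rewrite !comp_homA d'd !comp_id_hom.
Qed.

Lemma equiv_trivial (X Y : C) : hom_trivial X Y <-> hom_trivial (F X) (F Y).
Proof.
split=> triv f g; last by apply: equiv_faithful; apply: triv.
have [f' <-] := equiv_full f; have [g' <-] := equiv_full g.
by rewrite (triv f' g').
Qed.

Lemma equiv_brick (X : C) : brick X <-> brick (F X).
Proof.
split=> X_brick f.
  have [f' fE] := equiv_full f.
  have [[Z [a [b [Z0 ab]]]]|f'_iso] := X_brick f'; last first.
    by right; apply: is_iso_eq fE (functor_iso _ f'_iso).
  left; exists (F Z), (fmap F a), (fmap F b); split; first exact/equiv_trivial.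
  by rewrite -fE ab fmap_comp.
have [[Z [a [b [Z0 ab]]]]|[g [fg gf]]] := X_brick (fmap F f).
  have [e [ee e'e]] := eps_iso Z.
  have [a' a'E] := equiv_full (a ;; e); have [b' b'E] := equiv_full (eps Z ;; b).
  left; exists (G Z), a', b'; split.
    by apply/equiv_trivial; apply: hom_trivial_iso Z0; exists e, (eps Z).
  apply: equiv_faithful; rewrite ab fmap_comp a'E b'E.
  by rewrite comp_homA -(comp_homA a) e'e comp_hom_id.
have [g' g'E] := equiv_full g; right; exists g'; split; apply: equiv_faithful.
  by rewrite fmap_comp g'E fg fmap_id.
by rewrite fmap_comp g'E gf fmap_id.
Qed.

Lemma equiv_shiftn n (X : C) : isomorphic (F (shiftn n X)) (shiftn n (F X)).
Proof.
elim: n => [|n [f fi]]; first exact: isomorphic_refl.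
exists (theta _ ;; fmap (shift D) f); apply: is_iso_comp; first exact: theta_iso.
exact: functor_iso.
Qed.

Lemma equiv_surj (Y : D) : isomorphic (F (G Y)) Y.
Proof. by exists (eps Y). Qed.

Lemma equiv_brick_inv (Y : D) : brick Y -> brick (G Y).
Proof. by move=> Yb; apply/equiv_brick; apply: brick_iso Yb; apply/isomorphic_sym/equiv_surj. Qed.

Lemma equiv_left_bounded (Y : C) : left_bounded Y <-> left_bounded (F Y).
Proof.
split=> bY X X_brick.
  have [n0 n0P] := bY _ (equiv_brick_inv X_brick); exists n0 => n /n0P/equiv_trivial.
  apply: hom_trivial_iso (isomorphic_refl _) _.
  apply: isomorphic_trans (equiv_shiftn n _) _; exact/shiftn_iso/equiv_surj.
have [n0 n0P] := bY _ ((equiv_brick X).1 X_brick); exists n0 => n /n0P triv.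
apply/equiv_trivial; apply: hom_trivial_iso (isomorphic_refl _) _ triv.
exact/isomorphic_sym/equiv_shiftn.
Qed.

Lemma equiv_right_bounded (Y : C) : right_bounded Y <-> right_bounded (F Y).
Proof.
split=> bY X X_brick.
  have [n0 n0P] := bY _ (equiv_brick_inv X_brick); exists n0 => n /n0P/equiv_trivial.
  by apply: hom_trivial_iso; [apply: equiv_surj | apply: equiv_shiftn].
have [n0 n0P] := bY _ ((equiv_brick X).1 X_brick); exists n0 => n /n0P triv.
apply/equiv_trivial; apply: hom_trivial_iso (isomorphic_refl _) _ triv.
exact/isomorphic_sym/equiv_shiftn.
Qed.

Lemma equiv_balanced : balanced C <-> balanced D.
Proof.
split=> bal Y; last by rewrite equiv_left_bounded equiv_right_bounded.
have YE := equiv_surj Y; have YE' := isomorphic_sym YE.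
split=> bY.
  apply: right_bounded_iso YE _; apply/equiv_right_bounded/bal/equiv_left_bounded.
  exact: left_bounded_iso YE' bY.
apply: left_bounded_iso YE _; apply/equiv_left_bounded/bal/equiv_right_bounded.
exact: right_bounded_iso YE' bY.
Qed.

End Equivalence.

Lemma triangle_equivalent_balanced (C D : triangulated) :
  triangle_equivalent C D -> (balanced C <-> balanced D).
Proof.
move=> [F [theta [[G [eta [eps [eta_iso eps_iso eta_nat eps_nat]]]] theta_iso _ _]]].
exact (equiv_balanced eta_iso eps_iso eta_nat eps_nat theta_iso).
Qed.

(** * Bricks in the derived category of a finite algebra *)

Section ChainConstructions.
Variable A : pzRingType.
Implicit Types (Q : cplx A) (Y : bcomplex A).

(** Subtracting such a map changes a chain map inside its homotopy class in chosen degrees; see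
    [local_null]. *)
Lemma null_chain (Q Y : cplx A) (h : forall i, {linear Q (i + 1) -> Y i}) :
  exists2 e : chain Q Y, homotopic e (chain_zero Q Y) &
    forall i x, e (i + 1) x = h (i + 1) (cd Q (i + 1) x) + cd Y i (h i x).
Proof.
have lin i : linear (fun x => h (i + 1) (cd Q (i + 1) x) + cd Y i (h i x)).
  by move=> a x y; rewrite !linearP /= scalerDr; abel.
have [F FE] := @reindex_succ (fun i => {linear Q i -> Y i}) (fun i => Lin (lin i)).
have ch : forall i x, cd Y i (F i x) = F (i + 1) (cd Q i x).
  apply: int_all_succ => i x; rewrite !FE /= linearD !cdK addr0 linear0.
  by rewrite add0r.
by exists (Chain ch) => [|i x]; [exists h => i x; rewrite subr0|]; rewrite /= FE.
Qed.

Lemma homotopic_sub_null (Q Y : cplx A) (a e : chain Q Y) :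
  homotopic e (chain_zero Q Y) -> homotopic a (chain_sub a e).
Proof.
move=> [h hE]; exists h => i x; rewrite -hE /= subr0.
by abel.
Qed.

(* If all chain maps from Q to Y are null-homotopic and Y starts in degree    *)
(* k + 1, a cocycle with values in Y (k + 1) extends to a chain map, so it is *)
(* a coboundary.                                                              *)
Lemma hom_exact_of_null Q Y k : (forall i, i <= k -> forall y : Y i, y = 0) ->
  (forall i, k <= i -> hom_exact (central_unit A) (cd Q i) (cd Q (i + 1)) (Y (i + 1 + 1))) ->
  (forall a : chain Q (cx_of Y), homotopic a (chain_zero _ _)) ->
  hom_exact (central_unit A) (cd Q k) (cd Q (k + 1)) (Y (k + 1)).
Proof.
move=> Y0 QY null a ad.
have [||F [Fk Fz FR]] := @int_up (fun i => {linear Q (i + 1) -> Y (i + 1)})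
  (fun i f => k <= i /\ forall x, diff Y (i + 1) (f (cd Q i x)) = 0)
  (fun i f f' => forall x, f' (cd Q (i + 1) x) = diff Y (i + 1) (f x))
  (fun i => \0) k a.
- by split=> // x; rewrite ad linear0.
- move=> i f [ki fI]; have [|_ -> [f' f'E]] := QY i ki (diff Y (i + 1) \o f)%FUN.
    by move=> x; apply: fI.
  have f'R x : f' (cd Q (i + 1) x) = diff Y (i + 1) (f x) by rewrite -f'E scale1r.
  exists f' => //; split; first by lia.
  by move=> x; rewrite f'R diffK.
have [f fE] := @reindex_succ (fun i => {linear Q i -> Y i}) F.
have ch : forall i x, diff Y i (f i x) = f (i + 1) (cd Q i x).
  apply: int_all_succ => i x; rewrite !fE; have [ki|ik] := lerP k i; first by rewrite FR.
  rewrite (Fz i ik) linear0; have [ik1|ki1] := ltrP (i + 1) k; first by rewrite Fz.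
  have ki : k = i + 1 by lia.
  by move: a ad Fk {QY Y0 Fz FR ik ki1}; rewrite ki => a ad ->; rewrite ad.
have [h hE] := null (@Chain _ Q (cx_of Y) f ch).
exists 1 => //; exists (h (k + 1)) => x; rewrite scale1r.
by have := hE k x; rewrite /= fE Fk subr0 (Y0 k (lexx k) (h k x)) linear0 addr0.
Qed.

End ChainConstructions.

Lemma shiftn_obj (A : pzRingType) n (X : bcomplex A) (i : int) :
  (shiftn (C := Db_mod A) n X : bcomplex A) i = X (i + n%:Z) :> lmodType A.
Proof.
elim: n i => [|n IHn] i; first by rewrite addr0.
rewrite -[LHS]/((shiftn (C := Db_mod A) n X : bcomplex A) (i + 1)) IHn.
by congr (X _); lia.
Qed.

Section Algebra.
Variables (R : comPzRingType) (A : assoc_algebra R).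
Hypothesis R_noeth : left_noetherian R.
Hypothesis A_fg : fg_module (alg_module A).
Let A_noeth : left_noetherian A := algebra_noetherian A_fg R_noeth.

Definition rchain (r : R) (P Y : cplx A) (a : chain P Y) : chain P Y.
Proof. by exists (fun i => (rmul r (Y i) \o a i)%FUN) => i x /=; rewrite linZ cmP. Defined.

Definition rmap (r : R) (X : bcomplex A) : chain_map X X.
Proof. by exists (fun i => rmul r (X i)) => i x /=; rewrite linZ. Defined.

Definition zmap (X Y : bcomplex A) : chain_map X Y.
Proof. by exists (fun i => \0) => i x; rewrite /= linear0. Defined.

Lemma rchain_homotopic r (P Y : cplx A) (a b : chain P Y) :
  homotopic a b -> homotopic (rchain r a) (rchain r b).
Proof.
move=> [h hE]; exists (fun i => (rmul r (Y i) \o h i)%FUN) => i x /=.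
by rewrite -scalerBr hE scalerDr linZ.
Qed.

Lemma rchain_comp r t (P Y : cplx A) (a : chain P Y) :
  homotopic (rchain r (rchain t a)) (rchain (r * t) a).
Proof. by apply: homotopic_eq => i x /=; rewrite scalerA rmorphM. Qed.

Lemma act_rchain r P (X Y : bcomplex A) (f : dhom X Y) (a : chain P (cx_of X))
    (b : chain P (cx_of Y)) : act f a b -> act f (rchain r a) (rchain r b).
Proof.
elim: f a b => {X Y} [X Y f|X Y s qs|X Y Z f IHf g IHg] a b /=.
- move=> fab; apply: homotopic_trans (rchain_homotopic r fab) _.
  by apply: homotopic_eq => i x /=; rewrite linZ.
- move=> sb; apply: homotopic_trans _ (rchain_homotopic r sb).
  by apply: homotopic_eq => i x /=; rewrite linZ.
- by move=> [e fe ge]; exists (rchain r e); [apply: IHf | apply: IHg].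
Qed.

Lemma act_zero P (X Y : bcomplex A) (f : dhom X Y) :
  act f (chain_zero P (cx_of X)) (chain_zero P (cx_of Y)).
Proof.
elim: f => {X Y} [X Y f|X Y s qs|X Y Z f IHf g IHg] /=; last by exists (chain_zero _ _).
- by apply: homotopic_eq => i x /=; rewrite linear0.
- by apply: homotopic_eq => i x /=; rewrite linear0.
Qed.

Lemma act_zero_map P (X Y : bcomplex A) (f : dhom X Y) a b : proj_cplx P ->
  @zero_map (derived_cat A) X Y f -> @act _ P _ _ f a b -> homotopic b (chain_zero _ _).
Proof.
move=> P_proj [Z [u [v [Z0 fuv]]]] fab.
have [e ue ve] : act (DComp u v : dhom X Y) a b by apply/(act_eq P_proj fuv).
have e0 : homotopic e (chain_zero P (cx_of Z)).
  have /(act_eq P_proj) E := Z0 (DMap (chain_id Z)) (DMap (zmap Z Z)).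
  have /E : act (DMap (chain_id Z)) e e by apply: homotopic_eq.
  by move=> H; apply: homotopic_trans H _; apply: homotopic_eq.
exact (act_unique P_proj ve (@act_zero P Z Y v) e0).
Qed.

Lemma fcx_cover (X : bcomplex A) : exists (P : fcx A) (p : chain (fc P) (cx_of X)), qis p.
Proof.
have [n Xn] := cx_bounded X.
have [|P [_ [p pq]]] := @free_resolution A A_noeth X n.+1%:Z; last by exists P, p.
by move=> i ni; apply: Xn; lia.
Qed.

Definition zero_bcx : bcomplex A.
Proof.
unshelve eapply (@BComplex A (fun i => 'rV[A]_0 : lmodType A) (fun i => \0)).
- by [].
- by move=> i; apply: fg_rv.
- by exists 0%N => i _ x; rewrite [x]thinmx0.
Defined.

Lemma zero_bcx_trivial : @hom_trivial (derived_cat A) zero_bcx zero_bcx.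
Proof.
have [P [p pq]] := fcx_cover zero_bcx.
have [_ triv] := @dhom_trivialP A P zero_bcx zero_bcx p pq; apply: triv => a.
by apply: homotopic_eq => i x; rewrite [RHS]thinmx0 [LHS]thinmx0.
Qed.

Lemma zmap_zero (X Y : bcomplex A) (f : chain_map X Y) : (forall i x, f i x = 0) ->
  @zero_map (derived_cat A) X Y (DMap f).
Proof.
move=> f0; exists zero_bcx, (DMap (zmap X zero_bcx)), (DMap (zmap zero_bcx Y)).
split; first exact: zero_bcx_trivial.
by apply: DTrans (DMapComp _ _); apply: DMapEq => i x; rewrite f0.
Qed.

(** Take a nonzero cohomology module of [X] and its annihilator [D] in R. An r outside [D] is not a
    zero map, hence is invertible on the brick [X], hence is onto on the cohomology; Nakayama's
    lemma then puts some 1 - r y in [D], which is therefore maximal. *)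
Lemma loc_dichotomy (X : bcomplex A) : @brick (derived_cat A) X ->
  acyclic (cx_of X) \/ exists2 m : prime_ideal R, maximal_ideal m &
    forall s, ~~ prime_mem m s -> @is_iso (derived_cat A) X X (DMap (rmap s X)).
Proof.
move=> X_brick; have [P [p pq]] := fcx_cover X.
have [[i [z0 [dz0 nz0]]]|noH] := pselect (exists i (z : X (i + 1)),
    diff X (i + 1) z = 0 /\ ~ exists y, diff X i y = z); last first.
  left=> i x dx; apply: contrapT => nx; apply: noH.
  by exists i, x.
right; have cyc z : diff X (i + 1) z = 0 ->
    exists2 x : fc P (i + 1), cd (fc P) (i + 1) x = 0 & exists w, diff X i w = z - p (i + 1) x.
  by have [_ surj] := pq i; apply: surj.
have k1 r : @zero_map (derived_cat A) X X (DMap (rmap r X)) ->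
    forall z, diff X (i + 1) z = 0 -> exists y, diff X i y = rmul r (X (i + 1)) z.
  move=> r0 z /cyc[x dx [w dw]].
  have [|h hE] := act_zero_map (a := p) (b := rchain r p) (fc_proj P) r0.
    by apply: homotopic_eq.
  exists (h i x + rmul r (X i) w); have := hE i x.
  rewrite dx (linear0 (h (i + 1))) add0r /= subr0 => hx.
  by rewrite linearD linZ dw -hx scalerBr; abel.
have k2 r : @is_iso (derived_cat A) X X (DMap (rmap r X)) ->
    forall z, diff X (i + 1) z = 0 -> exists z', diff X (i + 1) z' = 0 /\
      exists y, diff X i y = z - rmul r (X (i + 1)) z'.
  move=> [g [_ gr]] z /cyc[x dx [w dw]].
  have [b gb] := act_total (fc_proj P) g p.
  have : act (DComp g (DMap (rmap r X)) : dhom X X) p (rchain r b).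
    by exists b => //; apply: homotopic_eq.
  move=> /(act_eq (fc_proj P) gr)[h hE].
  exists (b (i + 1) x); split; first by rewrite [LHS](cmP b) dx linear0.
  exists (w - h i x); have := hE i x.
  rewrite dx (linear0 (h (i + 1))) add0r /= => hx.
  by rewrite linearB dw -hx; abel.
have not_both r : (forall z, diff X (i + 1) z = 0 -> exists y, diff X i y = rmul r _ z) ->
    ~ @is_iso (derived_cat A) X X (DMap (rmap r X)).
  move=> rB /k2 - /(_ z0 dz0)[z' [dz' [y dy]]]; apply: nz0.
  have [y' dy'] := rB z' dz'; exists (y + y').
  by rewrite linearD dy dy' subrK.
pose H : lmodType R := restr (X (i + 1)).
pose B : submod H := restr_sub (sm_range (diff X i)).
pose Z : submod H := restr_sub (sm_ker (diff X (i + 1))).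
have [D DE] : exists D : submod R^o, forall r, D r <-> forall z, Z z -> B ((r : R) *: z).
  unshelve eexists (@Submod R R^o (fun r => forall z, Z z -> B ((r : R) *: z)) _ _ _) => //.
  - by move=> z _; rewrite scale0r; apply: sm0.
  - by move=> r t Dr Dt z Zz; rewrite scalerDl; apply: (smD (Dr z Zz) (Dt z Zz)).
  - by move=> a r Dr z Zz; rewrite -scalerA; apply: (smZ a (Dr z Zz)).
have D1 : ~ D 1 by move=> /DE/(_ z0 dz0); rewrite scale1r.
have [n [v [Zv vP]]] := fg_submod R_noeth Z (fg_restr A_fg (cx_fg X (i + 1))).
have iso_of r : ~ D r -> @is_iso (derived_cat A) X X (DMap (rmap r X)).
  move=> nDr; have [/k1 r0|//] := X_brick (DMap (rmap r X)).
  by case: nDr; apply/DE => z Zz; apply: r0.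
have [r /iso_of/k2 rP|m m_max mE] := maximal_prime D1.
  have I_ideal : left_ideal (fun x : R => exists t, x = r * t).
    split; first by exists 0; rewrite mulr0.
      by move=> x y [t ->] [u ->]; exists (t + u); rewrite mulrDr.
    by move=> a x [t ->]; exists (a * t); rewrite mulrCA.
  (* For the ideal rR and s = 1, the resulting [u] kills the cohomology and is congruent to 1 modulo
     r. *)
  have [|u [j [t ut]] uB] := nakayama (V := H) (B := B) I_ideal (e := v) (s := 1).
    move=> k; have [z' [Zz' [y dy]]] := rP _ (Zv k); have [c cE] := vP z' Zz'.
    exists (fun l => r * c l) => [l|]; first by exists (c l).
    exists y; rewrite dy scale1r; congr (_ - _).
    rewrite -[LHS]/((r : R) *: (z' : H)) cE scaler_sumr.
    by apply: eq_bigr => l _; rewrite scalerA.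
  exists (- t); have -> : 1 - r * - t = u.
    by move: ut; rewrite expr1n mulrN opprK => <-; rewrite addrC subrK.
  apply/DE => z /vP[c ->]; rewrite scaler_sumr; apply: sm_sum => l.
  by rewrite scalerA mulrC -scalerA; apply: smZ; apply: uB.
exists m => // s ms; apply: iso_of => Ds; move/negP: ms; apply.
exact/mE.
Qed.

End Algebra.

(** * Modules as complexes concentrated in degree 0 *)

Section Stalks.
Variable A : pzRingType.

(** Defined by matching, so that the term in degree 0 is [N] by conversion. *)
Definition stalk_obj (N : lmodType A) (i : int) : lmodType A :=
  if i is Posz 0 then N else 'rV[A]_0.

Definition stalk (N : lmodType A) (N_fg : fg_module N) : bcomplex A.
Proof.
unshelve eapply (@BComplex A (stalk_obj N) (fun i => \0)).
- by [].
- by case=> [[|n]|n]; [exact: N_fg | exact: fg_rv | exact: fg_rv].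
- by exists 0%N; case=> [[|n]|n] //= _ x; rewrite [x]thinmx0.
Defined.

Lemma stalk_zero N (N_fg : fg_module N) i : i <> 0 -> forall x : stalk N_fg i, x = 0.
Proof. by case: i => [[|n]|n] //= _ x; rewrite [x]thinmx0. Qed.

Definition stalk_map N N' (N_fg : fg_module N) (N'_fg : fg_module N') (f : {linear N -> N'}) :
  chain_map (stalk N_fg) (stalk N'_fg).
Proof.
exists (fun i => match i return {linear stalk N_fg i -> stalk N'_fg i} with
  Posz 0 => f | _ => \0 end).
by move=> i x; rewrite [diff (stalk N_fg) i x]/= linear0.
Defined.

Lemma stalk_cover (A_noeth : left_noetherian A) N (N_fg : fg_module N) :
  exists (P : fcx A) (e : {linear 'rV[A]_(sz P 0) -> N}), [/\ forall i, 0 < i -> sz P i = 0%N,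
    forall y, exists x, e x = y, forall x, e x = 0 <-> exists y, x = y *m mx P (-1),
    forall i, i + 1 < 0 -> forall x : 'rV[A]_(sz P (i + 1)), x *m mx P (i + 1) = 0 ->
      exists y, x = y *m mx P i &
    exists2 p : chain (fc P) (cx_of (stalk N_fg)), qis p & p 0 = e].
Proof.
have [|P [P0 [p pq]]] := @free_resolution A A_noeth (stalk N_fg) 1.
  by move=> i i1; apply: stalk_zero; lia.
have P1 (x : 'rV[A]_(sz P (0 + 1))) : x = 0.
  by apply/rowP => -[k kl]; exfalso; move: kl; rewrite P0.
have [inj surj] := pq (-1).
exists P, (p 0); split=> [i i0|y|x|i i0 x x0|].
- by apply: P0; lia.
- have [//|x _ [z zE]] := surj y.
  by exists x; apply/eqP; rewrite eq_sym -subr_eq0 -[_ - _]zE.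
- split=> [px|[y ->]].
    have [||y <-] := inj x; [exact: P1 | by exists 0; rewrite linear0 |].
    by exists y.
  exact (esym (cmP p (y : fc P (-1)))).
- have [inj' _] := pq i; have [//||y <-] := inj' x; last by exists y.
  by exists 0; rewrite linear0; apply: esym; apply: stalk_zero; lia.
- by exists p.
Qed.

End Stalks.

Section LocalActions.
Variables (R : comPzRingType) (A : assoc_algebra R).
Hypothesis R_noeth : left_noetherian R.
Hypothesis A_fg : fg_module (alg_module A).
Let A_noeth : left_noetherian A := algebra_noetherian A_fg R_noeth.

(** Multiplying a map into [X] by [s] is composing it with an automorphism of [X], which can be
    cancelled; [iso_source] cancels an automorphism of the source. *)
Lemma iso_target (X : bcomplex A) (s : R) P (a : chain P (cx_of X)) : proj_cplx P ->
  @is_iso (derived_cat A) X X (DMap (rmap s X)) ->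
  homotopic (rchain s a) (chain_zero _ _) -> homotopic a (chain_zero _ _).
Proof.
move=> P_proj [g [sg _]] sa0.
have [b gb] := act_total P_proj (g : dhom X X) (rchain s a).
have b0 := act_unique P_proj gb (act_zero P (g : dhom X X)) sa0.
have : act (DComp (DMap (rmap s X)) g : dhom X X) a b.
  by exists (rchain s a) => //; apply: homotopic_eq.
move=> /(act_eq P_proj sg) H; apply: homotopic_trans b0; apply: homotopic_sym.
by apply: homotopic_trans H _; apply: homotopic_eq.
Qed.

Lemma iso_source (X Y : bcomplex A) (s : R) (P : fcx A) (p : chain (fc P) (cx_of X))
    (a : chain (fc P) (cx_of Y)) : qis p ->
  @is_iso (derived_cat A) X X (DMap (rmap s X)) ->
  homotopic (rchain s a) (chain_zero _ _) -> homotopic a (chain_zero _ _).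
Proof.
move=> pq [g [_ gs]] sa0; have [f fa] := act_surj pq a.
have E : dhom_eq (DComp (DMap (rmap s X)) f) (DMap (zmap X Y)).
  apply: (act_inj pq (a := rchain s a) (b := chain_zero _ _)) => //.
    by exists (rchain s p); [apply: homotopic_eq | apply: act_rchain].
  by apply: homotopic_eq.
have E' : dhom_eq f (DComp g (DMap (zmap X Y))).
  apply: DTrans (DSym (DIdComp f)) _.
  apply: DTrans (DCompEq (DSym gs) (DRefl f)) _.
  by apply: DTrans (DSym (DCompA _ _ _)) _; apply: DCompEq (DRefl g) E.
have [b gb] := act_total (fc_proj P) (g : dhom X X) p.
have : act (DComp g (DMap (zmap X Y)) : dhom X Y) p (chain_zero _ _).
  by exists b => //; apply: homotopic_eq.
move=> /(act_eq (fc_proj P) (DSym E')) f0.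
exact (act_unique (fc_proj P) fa f0 (homotopic_refl p)).
Qed.

(* The homotopy is built one degree at a time, multiplying by an element of   *)
(* the complement of m at each step.                                          *)
Lemma local_null (m : prime_ideal R) (Q : cplx A) (Y : bcomplex A) (c : int)
    (a : chain Q (cx_of Y)) :
  (forall i, c <= i -> forall y : Y i, y = 0) ->
  (forall k, k + 1 < c -> hom_exact (loc_set A m) (cd Q k) (cd Q (k + 1)) (Y (k + 1))) ->
  exists2 s, ~~ prime_mem m s & homotopic (rchain s a) (chain_zero _ _).
Proof.
move=> Yc QY; have [l Yl] := bcomplex_below Y.
have step (n : nat) : exists2 s, ~~ prime_mem m s & exists2 b : chain Q (cx_of Y),
    homotopic (rchain s a) b & forall i, i <= l + n%:Z -> forall x, b i x = 0.
  elim: n => [|n [s ms [b ab b0]]].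
    exists 1; first exact: prime_proper.
    exists a; first by apply: homotopic_eq => i x /=; rewrite rmorph1 scale1r.
    by move=> i il x; apply: Yl; lia.
  pose k := l + n%:Z.
  have [kc|ck] := ltrP (k + 1) c; last first.
    exists s => //; exists b => // i il x; have [ik|ki] := lerP i k; first exact: b0.
    by apply: Yc; lia.
  have [|_ [t mt ->] [h hE]] := QY k kc (b (k + 1)).
    by move=> x; rewrite -[LHS](cmP b) b0 ?linear0.
  have [H [Hk H0]] := @single_family (fun i => {linear Q (i + 1) -> Y i}) (fun i => \0) (k + 1) h.
  have [e e0 eE] := @null_chain _ Q (cx_of Y) H.
  exists (t * s); first exact: (valP (denomM (Sub t mt : denom m) (Sub s ms))).
  exists (chain_sub (rchain t b) e).
    apply: homotopic_trans (homotopic_sym (rchain_comp _ _ _)) _.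
    apply: homotopic_trans (rchain_homotopic t ab) _.
    exact: homotopic_sub_null.
  apply: int_all_succ => i il x; rewrite [LHS]/= eE.
  have [ik|ki] := ltrP i k.
    rewrite !H0 /=; [|lia|lia]; rewrite linear0 !addr0 subr0.
    by rewrite b0 ?scaler0 //; lia.
  have {il ki}ik : i = k by lia.
  by subst i; rewrite Hk H0; [rewrite linear0 addr0 -hE subrr | lia].
have [s ms [b ab b0]] := step `|c - l|%N; exists s => //.
apply: homotopic_trans ab _; apply: homotopic_eq => i x /=.
have [ic|ci] := ltrP i c; last exact: Yc.
by apply: b0; lia.
Qed.

(** Schur's lemma, once an endomorphism in the derived category is identified with the linear map
    [phi] that it induces on [N]. *)
Lemma simple_brick (N : lmodType A) (N_fg : fg_module N) : simple_module N ->
  @brick (derived_cat A) (stalk N_fg).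
Proof.
move=> [_ N_simple] f; have [P [e [P0 e_surj e_ker _ [p pq pe]]]] := stalk_cover A_noeth N_fg.
have [b fb] := act_total (fc_proj P) (f : dhom _ _) p.
have [|phi phiE] := @surj_factor _ _ _ _ e (b 0) e_surj.
  by move=> x /e_ker[y ->]; apply: etrans (esym (cmP b (y : fc P (-1)))) _.
have fE : dhom_eq f (DMap (stalk_map N_fg N_fg phi)).
  pose b' := chain_o (chain_of (stalk_map N_fg N_fg phi)) p.
  apply: (act_inj pq fb (b := b')); first exact: homotopic_refl.
  apply: homotopic_eq.
  case=> [[|n]|n] x /=; [by rewrite pe phiE | |]; by rewrite [LHS]thinmx0.
have [ker0|kerT] := N_simple (sm_ker phi); last first.
  left; have f0 : forall i x, stalk_map N_fg N_fg phi i x = 0.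
    by case=> [[|n]|n] x //=; apply: kerT.
  have [Z [u [v [Z0 uv]]]] := zmap_zero R_noeth A_fg f0.
  by exists Z, u, v; split=> //; apply: DTrans fE uv.
have phi_inj : injective phi.
  by move=> x y xy; apply/eqP; rewrite -subr_eq0; apply/eqP/ker0; rewrite /= linearB xy subrr.
have [im0|imT] := N_simple (sm_range phi).
  left; have f0 : forall i x, stalk_map N_fg N_fg phi i x = 0.
    by case=> [[|n]|n] x //=; apply: im0; exists x.
  have [Z [u [v [Z0 uv]]]] := zmap_zero R_noeth A_fg f0.
  by exists Z, u, v; split=> //; apply: DTrans fE uv.
right; have [h hE] := choice imT.
have h_lin : linear h by move=> a x y; apply: phi_inj; rewrite linearP !hE.
apply (is_iso_eq (C := derived_cat A) (DSym fE)); exists (DMap (stalk_map N_fg N_fg (Lin h_lin))).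
split; (apply: DTrans (DSym (DMapComp _ _)) _; apply: DMapEq).
  by case=> [[|n]|n] x /=; [apply: phi_inj; rewrite hE | rewrite thinmx0 [RHS]thinmx0 | rewrite thinmx0 [RHS]thinmx0].
by case=> [[|n]|n] x /=; [rewrite hE | rewrite thinmx0 [RHS]thinmx0 | rewrite thinmx0 [RHS]thinmx0].
Qed.

End LocalActions.

(** * Complexes of matrices *)

Section MatrixComplexes.
Variables (A : pzRingType) (S : central_set A).
Implicit Types (N U V W : lmodType A).

Lemma mulmxZr s a b c (M : 'M[A]_(a, b)) (N : 'M_(b, c)) : S s ->
  M *m (s *: N) = s *: (M *m N).
Proof.
move=> Ss; apply/matrixP => i j; rewrite !mxE mulr_sumr; apply: eq_bigr => k _.
by rewrite mxE mulrA -(csC Ss) mulrA.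
Qed.

(** Rows form left modules, on which matrices act from the right; columns form right modules, on
    which they act from the left. So [col_exact] below is exactness of right modules. *)
Definition row_exact a b c (q : 'M[A]_(a, b)) (q' : 'M_(b, c)) :=
  forall x : 'rV_b, x *m q' = 0 -> exists y, x = y *m q.

Definition col_exact a b c (t : 'M[A]_(a, b)) (t' : 'M_(b, c)) :=
  forall n (x : 'M_(b, n)), t *m x = 0 -> exists y, x = t' *m y.

Lemma row_exact_mx a b c (q : 'M[A]_(a, b)) (q' : 'M_(b, c)) : row_exact q q' ->
  forall n (X : 'M_(n, b)), X *m q' = 0 -> exists Y, X = Y *m q.
Proof.
move=> qq' n X X0; have [|y yE] := @choice _ _ (fun i y => row i X = y *m q).
  by move=> i; apply: qq'; rewrite -row_mul X0 row0.
exists (\matrix_i y i); apply/row_matrixP => i.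
by rewrite row_mul rowK yE.
Qed.

(* Tor between the modules resolved by t and by q vanishes up to S. *)
Definition tor_zero a b c d e (t : 'M[A]_(a, b)) (t' : 'M_(b, c)) (q : 'M_(d, e)) :=
  forall B : 'M_(b, d), t *m B *m q = 0 ->
  exists2 s, S s & exists C, s *: (B *m q) = t' *m C *m q.

Section DimensionShift.
Variables (a b c d e f g : nat).
Variables (t : 'M[A]_(a, b)) (t' : 'M[A]_(b, c)) (t'' : 'M[A]_(c, d)).
Variables (q : 'M[A]_(e, f)) (q' : 'M[A]_(f, g)).
Hypotheses (qK : q *m q' = 0) (qE : row_exact q q').

(** Dimension shift: the image of [q'] is a free module modulo the image of [q], so Tor against the
    former is Tor against the latter one degree lower. [tor_zero_up] goes the other way. *)
Lemma tor_zero_down : t' *m t'' = 0 -> col_exact t t' ->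
  tor_zero t' t'' q' -> tor_zero t t' q.
Proof.
move=> tK tE H D; rewrite -mulmxA => /tE[B DB].
have [|s Ss [C BC]] := H B; first by rewrite -DB -mulmxA qK mulmx0.
have [|E EE] := row_exact_mx qE (X := s *: B - t'' *m C).
  by rewrite mulmxBl -scalemxAl BC subrr.
exists s => //; exists E; rewrite DB -mulmxZr // -[t' *m E *m q]mulmxA -EE mulmxBr.
by rewrite mulmxA tK mul0mx subr0.
Qed.

Lemma tor_zero_up : t *m t' = 0 -> col_exact t' t'' ->
  tor_zero t t' q -> tor_zero t' t'' q'.
Proof.
move=> tK tE H B /(row_exact_mx qE)[D BD].
have [|s Ss [E EE]] := H D; first by rewrite -mulmxA -BD mulmxA tK mul0mx.
have [|F FE] := tE _ (s *: B - E *m q).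
  by rewrite mulmxBr mulmxZr // BD EE mulmxA subrr.
exists s => //; exists F.
by rewrite -FE mulmxBl -scalemxAl -[E *m q *m q']mulmxA qK mulmx0 subr0.
Qed.

End DimensionShift.

Definition loc_split a b c (q : 'M[A]_(a, b)) (q' : 'M_(b, c)) :=
  exists2 s, S s & exists u w, s%:M = q' *m u + w *m q.

(** The product of [u] and [q] acts as [s] on the image of [q], so this image is a direct summand of
    a free module up to [S]. *)
Definition loc_perfect a b (q : 'M[A]_(a, b)) :=
  exists2 s, S s & exists u, s *: q = q *m u *m q.

Lemma split_perfect_l a b c (q : 'M[A]_(a, b)) (q' : 'M_(b, c)) :
  q *m q' = 0 -> loc_split q q' -> loc_perfect q.
Proof.
move=> qK [s Ss [u [w E]]]; exists s => //; exists w.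
have -> : s *: q = q *m (s *: 1%:M) by rewrite mulmxZr // mulmx1.
by rewrite scalemx1 E mulmxDr mulmxA qK mul0mx add0r mulmxA.
Qed.

Lemma perfect_split a b c (q : 'M[A]_(a, b)) (q' : 'M_(b, c)) :
  row_exact q q' -> loc_perfect q' -> loc_split q q'.
Proof.
move=> qE [s Ss [u E]]; exists s => //.
have [|w wE] := row_exact_mx qE (X := s%:M - q' *m u).
  by rewrite mulmxBl mul_scalar_mx E subrr.
by exists u, w; rewrite -wE addrC subrK.
Qed.

Lemma perfect_tor_zero a b c d e (t : 'M[A]_(a, b)) (t' : 'M_(b, c)) (q : 'M_(d, e)) :
  col_exact t t' -> loc_perfect q -> tor_zero t t' q.
Proof.
move=> tE [s Ss [u E]] B tB.
have [|C BC] := tE _ (B *m q *m u); first by rewrite !mulmxA tB mul0mx.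
by exists s => //; exists C; rewrite -mulmxZr // E -BC !mulmxA.
Qed.

(* Taking B = 1 turns the vanishing of Tor into a splitting. *)
Lemma tor_zero_perfect a b c d (q : 'M[A]_(a, b)) (q' : 'M_(b, c)) (t : 'M_(b, d)) :
  q *m q' = 0 -> row_exact q q' -> q *m t = 0 -> tor_zero q t q' -> loc_perfect q.
Proof.
move=> qK qE qt H; have [|s Ss [C E]] := H 1%:M; first by rewrite mulmx1.
have [|w wE] := row_exact_mx qE (X := s%:M - t *m C).
  by rewrite mulmxBl mul_scalar_mx -E mul1mx subrr.
exists s => //; exists w; rewrite -mulmxA -wE mulmxBr mulmxA qt mul0mx subr0.
by rewrite -scalemx1 mulmxZr // mulmx1.
Qed.

Lemma split_hom_exact a b c (q : 'M[A]_(a, b)) (q' : 'M_(b, c)) (C : lmodType A) :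
  loc_split q q' -> hom_exact S (mxlin q) (mxlin q') C.
Proof.
move=> [s Ss [u [w E]]] f fq; exists s => //; exists (f \o mxlin u)%FUN => x /=.
rewrite -linZ -mul_scalar_mx.
have -> : s%:M *m x = x *m s%:M by rewrite mul_scalar_mx -scalemx1 mulmxZr // mulmx1.
by rewrite E mulmxDr linearD mulmxA [X in _ + f X]mulmxA [X in _ + X]fq addr0.
Qed.

(** The module to test is the cokernel of [q], with the projection onto it as cocycle. *)
Lemma hom_exact_split a b c (q : 'M[A]_(a, b)) (q' : 'M_(b, c)) :
  (forall N, fg_module N -> hom_exact S (mxlin q) (mxlin q') N) -> loc_split q q'.
Proof.
move=> H; pose D := sm_range (mxlin q).
have [|x|s Ss [g gE]] := H (quot D) _ (qproj D).
- exact: fg_surj (@qproj_surj _ _ D) (fg_rv A b).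
- by apply/qproj_eq0; exists x.
have [h hE] := dual_basis_lift (rv_dual_basis A c) (fun x => @qproj_surj _ _ D (g x)).
pose k : {linear 'rV[A]_b -> 'rV[A]_b} := scale_fun (idfun : {linear _ -> _}) (csC Ss) \- (h \o mxlin q')%FUN.
have [|l lE] := @dual_basis_lift _ _ _ _ (mxlin q) k (rv_dual_basis A b).
  move=> x; apply/(qproj_eq0 D).
  by rewrite [k x]/(s *: x - h (x *m q')) linearB linZ hE gE subrr.
have [u uE] := mxlinP h; have [w wE] := mxlinP l.
exists s => //; exists u, w; apply/row_matrixP => i; rewrite !rowE.
set x := delta_mx 0 i.
have e : l x *m q = s *: x - h (x *m q') by exact: lE.
by rewrite mulmxDr !mulmxA -wE -uE e addrC subrK -scalemx1 mulmxZr // mulmx1.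
Qed.

Section Targets.
Variables (U V W : lmodType A) (d : {linear U -> V}) (d' : {linear V -> W}).

Lemma hom_exact_zero (C : lmodType A) : (forall x : C, x = 0) -> hom_exact S d d' C.
Proof.
by move=> C0 b _; exists 1; [apply: cs1 | exists \0 => x; apply: etrans (C0 _) (esym (C0 _))].
Qed.

Lemma hom_exact_iso (C C' : lmodType A) (f : {linear C -> C'}) : injective f -> (forall y, exists x, f x = y) ->
  hom_exact S d d' C -> hom_exact S d d' C'.
Proof.
move=> f_inj f_surj H b bd.
have [g gE] := inj_corestrict f_inj (fun x => f_surj (b x)).
have [|s Ss [c cE]] := H g; first by move=> x; apply: f_inj; rewrite gE bd linear0.
by exists s => //; exists (f \o c)%FUN => x; rewrite /= -cE linZ gE.
Qed.

Lemma hom_exact_rv n : hom_exact S d d' A^o -> hom_exact S d d' 'rV[A]_n.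
Proof.
move=> H b bd; have lin j : linear (fun x => b x 0 j : A^o).
  by move=> a x y; rewrite linearP !mxE.
have bj j : exists s, S s /\ exists c : {linear W -> A^o}, forall x, s *: (b x 0 j : A^o) = c (d' x).
  have [|s Ss [c cE]] := H (Lin (lin j)); first by move=> x /=; rewrite bd mxE.
  by exists s; split=> //; exists c.
have [s sP] := choice bj; have [c cE] := choice (fun j => (sP j).2).
have [t St tP] := cs_prod (fun j => (sP j).1).
have [u Su uE] : exists2 u, forall j, S (u j) & forall j, t = u j * s j.
  have [u uP] : exists u, forall j, S (u j) /\ t = u j * s j.
    have uP j : exists u, S u /\ t = u * s j by have [u] := tP j; exists u.
    by have [u ?] := choice uP; exists u.
  by exists u => j; have [] := uP j.
have linc : linear (fun y => \row_j (u j * (c j y : A))).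
  move=> a x y; apply/rowP => j; rewrite !mxE.
  have -> : c j (a *: x + y) = a * (c j x : A) + c j y by exact: linearP.
  by rewrite mulrDr mulrA (csC (Su j)) -mulrA.
exists t => //; exists (Lin linc) => x; apply/rowP => j.
by rewrite !mxE -cE (uE j) mulrA.
Qed.

End Targets.
End MatrixComplexes.

(** * Ext into the ring and into the terms of a resolution *)

Section Resolutions.
Variables (A : pzRingType) (S : central_set A).
Implicit Types (N U V W : lmodType A).

Fact colform_linear n (v : 'cV[A]_n) : linear (fun x : 'rV[A]_n => (x *m v) 0 0 : A^o).
Proof. by move=> a x y; rewrite mulmxDl -scalemxAl !mxE. Qed.

Definition colform n (v : 'cV[A]_n) : {linear 'rV[A]_n -> A^o} := Lin (colform_linear v).

Lemma colformP n (f : {linear 'rV[A]_n -> A^o}) : exists v, forall x, f x = colform v x.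
Proof.
exists (\col_j f (delta_mx 0 j)) => x; rewrite [x in LHS]rv_basis linear_sum /= mxE.
by apply: eq_bigr => j _; rewrite linZ mxE.
Qed.

Lemma colform_inj n (v w : 'cV[A]_n) : (forall x, colform v x = colform w x) -> v = w.
Proof.
move=> vw; apply/colP => j; have := vw (delta_mx 0 j).
by rewrite /= -!rowE !mxE.
Qed.

Lemma hom_exact_col a b c (q : 'M[A]_(a, b)) (q' : 'M_(b, c)) :
  hom_exact S (mxlin q) (mxlin q') A^o <->
  forall x : 'cV_b, q *m x = 0 -> exists2 s, S s & exists y, s *: x = q' *m y.
Proof.
split=> [H x qx|H f fq].
  have [z|s Ss [f fE]] := H (colform x); first by rewrite /= -mulmxA qx mulmx0 mxE.
  have [y yE] := colformP f; exists s => //; exists y; apply: colform_inj => z.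
  have := fE z; rewrite yE /= -!mulmxA => <-.
  by rewrite (mulmxZr _ _ Ss) mxE.
have [v vE] := colformP f.
have [|s Ss [y vy]] := H v.
  apply: colform_inj => z; rewrite /= mulmxA -[LHS]/(colform v (mxlin q z)) -vE.
  by rewrite [LHS]fq mulmx0 mxE.
by exists s => //; exists (colform y) => x; rewrite /= -mulmxA -vy (mulmxZr _ _ Ss) mxE vE.
Qed.

(** The quotient by the kernel of [q] is the image of [q], which up to [S] is a direct summand of a
    free module. *)
Lemma hom_exact_coker a b (q : 'M[A]_(a, b)) U V W (d : {linear U -> V}) (d' : {linear V -> W}) :
  loc_perfect S q -> hom_exact S d d' A^o -> hom_exact S d d' (quot (sm_ker (mxlin q))).
Proof.
move=> [s Ss [u uE]] H f fd; pose p := qproj (sm_ker (mxlin q)).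
have [|i iE] := @surj_factor _ _ _ _ p (mxlin q) (@qproj_surj _ _ _).
  by move=> x /qproj_eq0.
have i_inj x : i x = 0 -> x = 0.
  by have [y <-] := qproj_surj x; rewrite iE => y0; apply/qproj_eq0.
have [|t St [c cE]] := @hom_exact_rv _ _ _ _ _ _ _ b H (i \o f)%FUN.
  by move=> x /=; rewrite fd linear0.
exists (s * t); first exact: csM.
exists (p \o (mxlin u \o c))%FUN => x.
apply/eqP; rewrite -subr_eq0; apply/eqP/i_inj; rewrite linearB linZ /= iE -cE /= -scalemxAl.
have [y yE] := qproj_surj (f x); rewrite -yE iE /= -!scalemxAl.
have -> : y *m q *m u *m q = s *: (y *m q).
  by rewrite -(mulmxZr _ _ Ss) uE !mulmxA.
by rewrite scalerA (csC Ss) subrr.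
Qed.

Lemma row_loc_exact a b c (q : 'M[A]_(a, b)) (q' : 'M_(b, c)) :
  row_exact q q' -> loc_exact S (mxlin q) (mxlin q').
Proof. by move=> qq'; apply: exact_loc_exact => x /qq'. Qed.

(* The localization of A at S has finite injective dimension on the left. *)
Definition inj_bound := exists d : nat, forall (P : fcx A) (c : int),
  (forall k, k <= c -> row_exact (mx P k) (mx P (k + 1))) ->
  forall k, k + d%:Z <= c -> hom_exact S (mxlin (mx P k)) (mxlin (mx P (k + 1))) A^o.

Lemma hom_exact_of_ext1 (Q : cplx A) n C (c : int) : (forall i, dual_basis (Q i)) ->
  (forall k, k <= c -> loc_exact S (cd Q k) (cd Q (k + 1))) ->
  (forall N, fg_module N -> ext1_zero S N (iter n (@cosyz A) C)) ->
  forall k, k + n%:Z <= c -> hom_exact S (cd Q k) (cd Q (k + 1)) C.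
Proof.
move=> Q_proj Q_ex; elim: n C => [|n IHn] C E k kc.
  apply: hom_exact_base E; first by apply: Q_ex; lia.
  exact: fg_dual_basis.
apply: (@hom_exact_step _ _ _ _ _ _ (cd Q k) (cd Q (k + 1)) (cd Q (k + 1 + 1))).
- by apply: Q_ex; lia.
- exact: cdK.
- exact: Q_proj.
- by apply: IHn; [move=> N N_fg; rewrite -iterSr; apply: E | lia].
Qed.

Lemma hom_exact_iter (Q : cplx A) n C (c k : int) : (forall i, dual_basis (Q i)) ->
  (forall k, k <= c -> loc_exact S (cd Q k) (cd Q (k + 1))) -> k + n%:Z <= c ->
  hom_exact S (cd Q k) (cd Q (k + 1)) C ->
  hom_exact S (cd Q (k + n%:Z)) (cd Q (k + n%:Z + 1)) (iter n (@cosyz A) C).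
Proof.
move=> Q_proj Q_ex; elim: n => [|n IHn] kc H; first by rewrite addr0.
have -> : k + n.+1%:Z = k + n%:Z + 1 by lia.
rewrite iterS; apply: hom_exact_cosyz (Q_ex _ _); [|exact: Q_proj|exact: cdK|lia].
by apply: IHn => //; lia.
Qed.

End Resolutions.

Lemma hom_exact_unit (A : pzRingType) (S : central_set A) (U V W : lmodType A)
    (d : {linear U -> V}) (d' : {linear V -> W}) C :
  hom_exact (central_unit A) d d' C -> hom_exact S d d' C.
Proof. by apply: hom_exact_mono => s ->; apply: cs1. Qed.

(** * What boundedness says about resolutions at m *)

Section Bounded.
Variables (R : comPzRingType) (A : assoc_algebra R).
Hypothesis R_noeth : left_noetherian R.
Hypothesis A_fg : fg_module (alg_module A).
Let A_noeth : left_noetherian A := algebra_noetherian A_fg R_noeth.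

Lemma hom_exact_shiftn (P : fcx A) (X Y : bcomplex A) (p : chain (fc P) (cx_of X)) n k :
  qis p -> @hom_trivial (derived_cat A) X (shiftn (C := Db_mod A) n Y) ->
  (forall i, i <= k + n%:Z -> forall y : Y i, y = 0) ->
  (forall i, k <= i -> hom_exact (central_unit A) (cd (fc P) i) (cd (fc P) (i + 1))
     (Y (i + 1 + 1 + n%:Z))) ->
  hom_exact (central_unit A) (cd (fc P) k) (cd (fc P) (k + 1)) (Y (k + 1 + n%:Z)).
Proof.
move=> pq triv Y0 H; rewrite -shiftn_obj.
apply: (@hom_exact_of_null A (fc P) (shiftn (C := Db_mod A) n Y)) => [i ik|i ki|].
- by rewrite shiftn_obj; apply: Y0; lia.
- by rewrite shiftn_obj; apply: H.
- exact ((@dhom_trivialP A P X (shiftn (C := Db_mod A) n Y) p pq).1 triv).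
Qed.

Lemma acyclic_trivial (X Y : bcomplex A) : acyclic (cx_of X) ->
  @hom_trivial (derived_cat A) X Y.
Proof.
move=> X0; have [P [p pq]] := fcx_cover R_noeth A_fg X.
have XX := (@dhom_trivialP A P X X p pq).2 (fun a => acyclic_null a (fc_proj P) X0).
apply: (proj2 (@dhom_trivialP A P X Y p pq)) => a; have [f fa] := act_surj pq a.
have E : dhom_eq f (DComp (DMap (zmap X X)) f).
  by apply: DTrans (DSym (DIdComp f)) _; apply: DCompEq (XX _ _) (DRefl f).
move: fa => /(act_eq (fc_proj P) E)[b b0 fb].
apply: (act_unique (fc_proj P) fb (act_zero _ f)); apply: homotopic_trans b0 _.
exact: homotopic_eq.
Qed.

Variable m : prime_ideal R.
Hypothesis m_max : maximal_ideal m.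
Local Notation S := (loc_set A m).

(** Shifts of simple stalks are bricks, and Hom from [Y] into them is the cohomology of Hom(P, N);
    [hom_exact_local] passes from simple [N] to all finitely generated ones. *)
Lemma left_bounded_split (P : fcx A) (Y : bcomplex A) (p : chain (fc P) (cx_of Y)) :
  qis p -> @left_bounded (Db_mod A) Y ->
  exists n : nat, forall k, k <= - n%:Z -> loc_split S (mx P k) (mx P (k + 1)).
Proof.
move=> pq Yb.
have [||n H] := @hom_exact_local R A m R_noeth A_fg m_max (fc P) (cd (fc P)) (@cdK _ (fc P)).
- by move=> i; apply: rv_dual_basis.
- move=> N N_fg N_simple mN.
  have [n0 n0P] := Yb (stalk N_fg) (@simple_brick R A R_noeth A_fg N N_fg N_simple).
  exists n0.+1 => k kn; apply: hom_exact_unit.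
  have [n e] : exists n : nat, k + 1 + n%:Z = 0 by exists (absz (k + 1)%R); lia.
  have := @hom_exact_shiftn P Y (stalk N_fg) p n k pq; rewrite e; apply.
  + by apply: n0P; lia.
  + by move=> i ik; apply: stalk_zero; lia.
  + by move=> i ik; apply: hom_exact_zero; apply: stalk_zero; lia.
- by exists n => k kn; apply: hom_exact_split => N N_fg; apply: H.
Qed.

(** [Y] starts in degree c. The last hypothesis lets a cocycle with values in [Y c] extend to a
    chain map into a shift of [Y]; right boundedness makes that map null-homotopic and the cocycle a
    coboundary. *)
Lemma right_bounded_ext1 (Y : bcomplex A) (c : int) : @right_bounded (Db_mod A) Y ->
  (forall i, i < c -> forall y : Y i, y = 0) ->
  (forall N (N_fg : fg_module N), simple_module N -> killed m N ->
     forall (Q : fcx A) (p : chain (fc Q) (cx_of (stalk N_fg))), qis p ->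
     exists n : nat, forall k, k <= - n%:Z -> forall j, c < j ->
       hom_exact (central_unit A) (cd (fc Q) k) (cd (fc Q) (k + 1)) (Y j)) ->
  exists n, forall N, fg_module N ->
    forall i, (n <= i)%N -> ext1_zero S N (iter i (@cosyz A) (Y c)).
Proof.
move=> Yb Yc H; apply: (ext1_zero_local R_noeth A_fg m_max (cx_fg Y c)).
move=> N N_fg N_simple mN.
have [Q [e [_ e_surj e_ker Q_ex [p pq _]]]] := stalk_cover A_noeth N_fg.
have [n0 n0P] := Yb (stalk N_fg) (@simple_brick R A R_noeth A_fg N N_fg N_simple).
have [n1 n1P] := H N N_fg N_simple mN Q p pq.
have [l Yl] := cx_bounded Y.
exists (n0 + n1 + l + `|c|)%N => i ni.
(* From here i dimension shifts lead to degree -2, where the augmentation of the resolution turns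
   the vanishing into one of Ext^1. *)
pose k : int := - 2 - i%:Z.
have [n nE] : exists n : nat, k + 1 + n%:Z = c by exists (absz (c - k - 1)%R); lia.
have Hk : hom_exact S (cd (fc Q) k) (cd (fc Q) (k + 1)) (Y c).
  apply: hom_exact_unit; have := @hom_exact_shiftn Q _ Y p n k pq; rewrite nE; apply.
  - by apply: n0P; lia.
  - by move=> i' ik; apply: Yc; lia.
  - move=> i' ki; have [jl|lj] := lerP (i' + 1 + 1 + n%:Z) l%:Z.
      by apply: n1P; lia.
    by apply: hom_exact_zero; apply: Yl; lia.
have := @hom_exact_iter _ S (fc Q) i (Y c) (-2) k (proj1 (fc_proj Q)).
have -> : k + i%:Z = -2 by lia.
move=> /(_ _ _ Hk) H2; apply: (hom_exact_ext1 (H2 _ _) (rv_dual_basis A (sz Q 0)) (@cdK _ (fc Q) (-2)) _ _ e_surj).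
- by move=> k' k'2; apply: row_loc_exact => x; apply: Q_ex; lia.
- by [].
- by apply: exact_loc_exact => x /e_ker[y ->]; exists y.
- by move=> y; apply/e_ker; exists y.
Qed.

End Bounded.

(** * Right modules through the opposite ring *)

Section Opposite.
Variable A : pzRingType.

(** The transpose turns complexes of rows over the opposite ring into complexes of columns over
    [A]. *)
Definition op a b (M : 'M[A^c]_(a, b)) : 'M[A]_(b, a) := M^T.

Lemma opM a b c (M : 'M[A^c]_(a, b)) (N : 'M[A^c]_(b, c)) : op (M *m N) = op N *m op M.
Proof. by apply/matrixP => i j; rewrite !mxE; apply: eq_bigr => k _; rewrite !mxE. Qed.

Lemma op_inj a b : injective (@op a b).
Proof. exact: trmx_inj. Qed.

Lemma op0 a b : op (0 : 'M[A^c]_(a, b)) = 0.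
Proof. exact: trmx0. Qed.

Lemma op_surj a b (M : 'M[A]_(b, a)) : exists N, op N = M.
Proof. by exists (M^T : 'M[A^c]_(a, b)); apply: trmxK. Qed.

Lemma opZ (S : central_set A) s a b (M : 'M[A^c]_(a, b)) : S s -> op ((s : A^c) *: M) = s *: op M.
Proof. by move=> Ss; apply/matrixP => i j; rewrite !mxE; exact (esym (csC Ss (M j i : A))). Qed.

Lemma row_exact_op a b c (q : 'M[A^c]_(a, b)) (q' : 'M_(b, c)) :
  row_exact q q' -> col_exact (op q') (op q).
Proof.
move=> /row_exact_mx qq' n x; have [y <-] := op_surj x; rewrite -opM -(op0 n c) => /op_inj/qq'[z ->].
by exists (op z); rewrite opM.
Qed.

End Opposite.

Section OppositeAlgebra.
Variables (R : comPzRingType) (A : assoc_algebra R).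

Definition opp_map (r : R) : A^c := alg_map A r.

Fact opp_map_zmod_morphism : zmod_morphism opp_map.
Proof. exact (rmorphB (alg_map A)). Qed.

Fact opp_map_monoid_morphism : monoid_morphism opp_map.
Proof.
split=> [|x y]; first exact (rmorph1 (alg_map A)).
by rewrite mulrC; exact (rmorphM (alg_map A) y x).
Qed.

HB.instance Definition _ := GRing.isZmodMorphism.Build R A^c opp_map opp_map_zmod_morphism.
HB.instance Definition _ := GRing.isMonoidMorphism.Build R A^c opp_map opp_map_monoid_morphism.

Fact opp_map_central r (a : A^c) : opp_map r * a = a * opp_map r.
Proof. exact (esym (alg_map_central r (a : A))). Qed.

Definition opp_alg : assoc_algebra R := AssocAlgebra opp_map_central.

End OppositeAlgebra.

(** * From local splitting to boundedness *)

Section Truncations.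
Variables (R : comPzRingType) (A : assoc_algebra R).

Lemma tr_iso (P : fcx A) (Y : bcomplex A) (p : chain (fc P) (cx_of Y)) c : qis p ->
  (forall i, i <= c -> forall y : Y i, y = 0) -> @isomorphic (derived_cat A) (tr P c) Y.
Proof.
move=> pq Yc; have [p' p'E] := tr_factor Yc p.
exists (DMap p'), (DInv (tr_qis p'E pq)); split; first exact: DMapInv.
exact: DInvMap.
Qed.

Lemma resolution_exact (P : fcx A) (Y : bcomplex A) (p : chain (fc P) (cx_of Y)) c : qis p ->
  (forall i, i <= c -> forall y : Y i, y = 0) ->
  forall k, k + 1 <= c -> row_exact (mx P k) (mx P (k + 1)).
Proof.
move=> pq Yc k kc x x0; have [inj _] := pq k.
have [//||y <-] := inj x; last by exists y.
by exists 0; rewrite linear0; apply: esym; apply: Yc.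
Qed.

Lemma tr_hom_exact (S : central_set A) (P : fcx A) c (U V W : lmodType A)
    (d : {linear U -> V}) (d' : {linear V -> W}) j :
  hom_exact S d d' A^o -> (j = c -> loc_perfect S (mx P c)) -> hom_exact S d d' (tr P c j).
Proof.
move=> H Pc; have [jc|cj|jc] := ltgtP j c.
- by apply: hom_exact_zero => x; apply: (tr_zero_below (i := j)).
- apply: (hom_exact_iso (f := tau P c j)) (hom_exact_rv H); last exact: tau_surj.
  move=> x y /eqP; rewrite -subr_eq0 -linearB => /eqP/tau_eq0.
  by rewrite /tr_sub ltNge (ltW cj) /= gt_eqF // => /eqP; rewrite subr_eq0 => /eqP.
- subst j; rewrite /= /tr_sub ltxx eqxx; apply: hom_exact_coker H.
  exact: Pc.
Qed.

Hypothesis R_noeth : left_noetherian R.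
Hypothesis A_fg : fg_module (alg_module A).
Let A_noeth : left_noetherian A := algebra_noetherian A_fg R_noeth.
Variable m : prime_ideal R.
Hypothesis m_max : maximal_ideal m.
Local Notation S := (loc_set A m).

Lemma rmap_shiftn s (X : bcomplex A) n : @is_iso (derived_cat A) X X (DMap (rmap s X)) ->
  let Z : bcomplex A := shiftn (C := Db_mod A) n X in
  @is_iso (derived_cat A) Z Z (DMap (rmap s Z)).
Proof.
move=> X_iso; elim: n => [//|n IHn] /=.
apply: (is_iso_eq (C := derived_cat A) _ (functor_iso (derived_shift A) IHn)).
by apply: DMapEq.
Qed.

(** Where the shifted [X] lives, the resolution of [Y] splits up to [S]. So a chain map becomes
    null-homotopic after multiplication by some s outside m, which is invertible on [X]. *)
Lemma split_left_bounded (P : fcx A) (X Y : bcomplex A) (p : chain (fc P) (cx_of Y)) n :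
  qis p -> (forall k, k <= - n%:Z -> loc_split S (mx P k) (mx P (k + 1))) ->
  (forall s, ~~ prime_mem m s -> @is_iso (derived_cat A) X X (DMap (rmap s X))) ->
  exists n0 : nat, forall n, (n0 <= n)%N ->
    @hom_trivial (derived_cat A) Y (shiftn (C := Db_mod A) n X).
Proof.
move=> pq Ps X_iso; have [l Xl] := cx_bounded X; exists (l + n)%N => i il.
apply/(proj2 (@dhom_trivialP A P Y _ p pq)) => a.
have [||s ms sa] := @local_null R A m (fc P) (shiftn (C := Db_mod A) i X) (l.+1%:Z - i%:Z) a.
- by move=> j jl; rewrite shiftn_obj; apply: Xl; lia.
- by move=> k kl; apply: split_hom_exact; apply: Ps; lia.
- by apply: iso_target (fc_proj P) _ sa; apply: rmap_shiftn; apply: X_iso.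
Qed.

(** The truncated resolution of [Y] has free terms and, at the bottom, one that is projective up to
    [S]; by [inj_bound], Ext from [X] into all of them vanishes far out. *)
Lemma split_right_bounded (P : fcx A) (X Y : bcomplex A) (p : chain (fc P) (cx_of Y)) n :
  inj_bound S -> qis p ->
  (forall k, k <= - n%:Z -> loc_split S (mx P k) (mx P (k + 1))) ->
  (forall s, ~~ prime_mem m s -> @is_iso (derived_cat A) X X (DMap (rmap s X))) ->
  exists n0 : nat, forall n, (n0 <= n)%N ->
    @hom_trivial (derived_cat A) X (shiftn (C := Db_mod A) n Y).
Proof.
move=> [d dP] pq Ps X_iso; have [c0 Yc0] := bcomplex_below Y.
pose c := Num.min c0 (- n%:Z).
have YT : @isomorphic (derived_cat A) (tr P c) Y.
  by apply: tr_iso pq _ => i ic; apply: Yc0; lia.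
have [Q [q qq]] := fcx_cover R_noeth A_fg X; have [c1 Xc1] := bcomplex_below X.
have [l Tl] := cx_bounded (tr P c).
exists (l + d + `|c1| + 3)%N => i il.
apply: hom_trivial_iso (isomorphic_refl _) (shiftn_iso (C := Db_mod A) i YT) _.
apply/(proj2 (@dhom_trivialP A Q X _ q qq)) => a.
have [||s ms sa] := @local_null R A m (fc Q) (shiftn (C := Db_mod A) i (tr P c)) (l.+1%:Z - i%:Z) a.
- by move=> j jl; rewrite shiftn_obj; apply: Tl; lia.
- move=> k kl; rewrite shiftn_obj; apply: tr_hom_exact => [|_].
    apply: (dP Q (c1 - 1)) => [k' kc|]; last by lia.
    by apply: (resolution_exact qq Xc1); lia.
  by apply: split_perfect_l (mxK P c) (Ps c _); lia.
- by apply: iso_source qq _ sa; apply: X_iso.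
Qed.

(* On a resolution of a module killed by m the elements of m are              *)
(* null-homotopic, so vanishing up to S is vanishing.                         *)
Lemma hom_exact_killed N (N_fg : fg_module N) (Q : fcx A)
    (p : chain (fc Q) (cx_of (stalk N_fg))) k C : qis p -> killed m N ->
  hom_exact S (cd (fc Q) k) (cd (fc Q) (k + 1)) C ->
  hom_exact (central_unit A) (cd (fc Q) k) (cd (fc Q) (k + 1)) C.
Proof.
move=> pq mN H b bd; have [_ [s ms ->] [c cE]] := H b bd.
have [y m1] := m_max ms; set r := 1 - s * y in m1.
have [h hE] : homotopic (rchain r (chain_idc (fc Q))) (chain_zero _ _).
  apply: (qis_cancel (s := p)) => //; first exact: fc_proj.
  apply: homotopic_eq => i x /=; rewrite linear0 linZ.
  move: (p i x); case: i {x} => [[|i]|i] /= x; [exact: mN m1 x | |]; by rewrite [LHS]thinmx0.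
exists 1 => //; exists ((rmul y C \o c) \+ (b \o h (k + 1)%R))%FUN => x; rewrite scale1r /= -cE.
have /(congr1 b) := hE k x; rewrite [chain_zero _ _ _ _]/= subr0 linearD bd addr0 => <-.
have ys : y * s + r = 1 by rewrite /r [s * y]mulrC addrC subrK.
rewrite /= linZ scalerA -rmorphM -scalerDl -rmorphD ys.
by rewrite rmorph1 scale1r.
Qed.

End Truncations.

(** * Tor against right resolutions *)

Section RightResolutions.
Variables (R : comPzRingType) (A : assoc_algebra R).
Hypothesis R_noeth : left_noetherian R.
Hypothesis A_fg : fg_module (alg_module A).
Let A_noeth : left_noetherian A := algebra_noetherian A_fg R_noeth.
Variable m : prime_ideal R.
Hypothesis m_max : maximal_ideal m.
Local Notation S := (loc_set A m).
Local Notation S' := (loc_set (opp_alg A) m).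

Lemma opp_fg : fg_module (alg_module (opp_alg A)).
Proof.
have [n [e eP]] := A_fg; exists n, e => x; have [c cE] := eP x; exists c.
rewrite [LHS]cE; apply: eq_bigr => i _.
exact (alg_map_central (c i) (e i : A)).
Qed.

Lemma col_loc_exact (Q : fcx A^c) (i : int) :
  hom_exact S' (mxlin (mx Q i)) (mxlin (mx Q (i + 1))) A^c^o ->
  loc_exact S (mxlin (op (mx Q (i + 1)))) (mxlin (op (mx Q i))).
Proof.
move=> /hom_exact_col H; apply: loc_exact_fg A_noeth (fg_rv A _) _ => x.
have [y <-] := op_surj x; rewrite /= -opM -[0](op0 _ _) => /op_inj/H[s Ss [z zE]].
exists s; first exact: Ss.
by exists (op z); rewrite /= -opM -zE; exact (esym (@opZ A S s _ _ y Ss)).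
Qed.

Lemma right_hom_exact (Q : fcx A^c) (e : int) n C :
  (forall i, i <= e -> loc_exact S (mxlin (op (mx Q (i + 1)))) (mxlin (op (mx Q i)))) ->
  (forall N, fg_module N -> ext1_zero S N (iter n (@cosyz A) C)) ->
  forall i, i <= e -> hom_exact S (mxlin (op (mx Q (i + 1)))) (mxlin (op (mx Q i))) C.
Proof.
move=> Q_ex; elim: n C => [|n IHn] C E i ie.
  exact: hom_exact_base (Q_ex i ie) (fg_rv A _) E.
move: ie; rewrite -[i](subrK 1); move: (i - 1) => {}i ie.
apply: (@hom_exact_step _ _ _ _ _ _ (mxlin (op (mx Q (i + 1 + 1)))) (mxlin (op (mx Q (i + 1)))) (mxlin (op (mx Q i)))).
- exact: Q_ex.
- by move=> x; rewrite /= -mulmxA -opM mxK op0 mulmx0.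
- exact: rv_dual_basis.
- by apply: IHn; [move=> N N_fg; rewrite -iterSr; apply: E | lia].
Qed.

(** For a free right module F of finite rank and N the image of [q], Hom(D, N) is the tensor product
    of F and N, where D is the dual of F. *)
Lemma hom_exact_tor_zero a b c d e (t : 'M[A]_(a, b)) (t' : 'M_(b, c)) (q : 'M_(d, e)) :
  hom_exact S (mxlin t) (mxlin t') (quot (sm_ker (mxlin q))) -> tor_zero S t t' q.
Proof.
move=> H B tBq; pose p := qproj (sm_ker (mxlin q)).
have [x|s Ss [f fE]] := H (p \o mxlin B)%FUN.
  by apply/qproj_eq0; rewrite /= -!mulmxA [t *m _]mulmxA tBq mulmx0.
have [h hE] := dual_basis_lift (rv_dual_basis A c) (fun x => qproj_surj (f x)).
have [C CE] := mxlinP h; exists s => //; exists C; apply/row_matrixP => i; rewrite !rowE.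
have /qproj_eq0 : p (s *: (delta_mx 0 i *m B) - h (delta_mx 0 i *m t')) = 0.
  by rewrite linearB linZ hE -fE subrr.
rewrite /= mulmxBl CE => /eqP; rewrite subr_eq0 => /eqP.
by rewrite -scalemxAl (mulmxZr _ _ Ss) !mulmxA.
Qed.

Lemma right_tor_zero : inj_bound S' -> forall a b (q : 'M[A]_(a, b)) n,
  (forall N, fg_module N -> ext1_zero S N (iter n (@cosyz A) (quot (sm_ker (mxlin q))))) ->
  exists d : nat, forall (Q : fcx A^c) e,
    (forall i, i <= e -> row_exact (mx Q i) (mx Q (i + 1))) ->
    forall i, i + d%:Z <= e -> tor_zero S (op (mx Q (i + 1))) (op (mx Q i)) q.
Proof.
move=> [d dP] a b q n E; exists d => Q e Q_ex i ie.
apply/hom_exact_tor_zero/(@right_hom_exact Q (e - d%:Z) n) => //; last by lia.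
by move=> j je; apply/col_loc_exact/(dP Q e Q_ex); lia.
Qed.

(** The image N of [mx P c] is a syzygy of [Y] into which high Ext vanishes up to [S], so by
    [right_tor_zero] Tor against N vanishes far out. For small k, an exact complex of right modules
    is built on the columns of [mx P k], and the vanishing is shifted down from [mx P c] to
    [mx P (k + 1)], where [tor_zero_perfect] applies. *)
Lemma right_bounded_split (P : fcx A) (Y : bcomplex A) (p : chain (fc P) (cx_of Y)) :
  inj_bound S -> inj_bound S' -> qis p -> @right_bounded (Db_mod A) Y ->
  exists n : nat, forall k, k <= - n%:Z -> loc_split S (mx P k) (mx P (k + 1)).
Proof.
move=> [d dP] S'_bound pq Yb; have [c Yc] := bcomplex_below Y.
have Tb : @right_bounded (Db_mod A) (tr P c).
  exact (right_bounded_iso (C := Db_mod A) (isomorphic_sym (tr_iso pq Yc)) Yb).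
have [||n nP] := @right_bounded_ext1 R A R_noeth A_fg m m_max (tr P c) c Tb.
- by move=> i ic y; apply: (@tr_zero_below A P c i y).
- move=> N N_fg N_simple mN Q q qq; exists d.+2 => k kd j cj.
  apply: (hom_exact_killed m_max qq mN); apply: tr_hom_exact => [|jc]; last by move: cj; rewrite jc ltxx.
  apply: (dP Q (-2)) => [k' k'2|]; last by lia.
  by apply: (resolution_exact (c := -1) qq) => [i i1|]; [apply: stalk_zero; lia | lia].
have [e eP] : exists e : nat, forall (Q : fcx A^c) l,
    (forall i, i <= l -> row_exact (mx Q i) (mx Q (i + 1))) ->
    forall i, i + e%:Z <= l -> tor_zero S (op (mx Q (i + 1))) (op (mx Q i)) (mx P c).
  apply: (right_tor_zero S'_bound) => N N_fg.
  by have := nP N N_fg n (leqnn n); rewrite /= /tr_sub ltxx eqxx; apply.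
have P_ex k : k + 1 <= c -> row_exact (mx P k) (mx P (k + 1)).
  exact: (resolution_exact pq Yc).
exists (`|c| + e + 6)%N => k kn.
suff : loc_perfect S (mx P (k + 1)) by apply: perfect_split; apply: P_ex; lia.
have {kn} : k + 1 <= 1 - (`|c| + e + 6)%N%:Z by lia.
move: (k + 1) => {}k kn.
(* The transposed differential [q'] is continued to an exact complex of right modules: [Q] resolves
   its kernel [D], and [E] covers that kernel inside the free module. *)
have [q' q'E] := op_surj (mx P k); pose D := sm_ker (mxlin q').
have A'_noeth : left_noetherian A^c := algebra_noetherian opp_fg R_noeth.
have D_fg : fg_module (subm D) := fg_subm A'_noeth D (fg_rv _ _).
have [Q [f [_ f_surj f_ker Q_ex _]]] := stalk_cover A'_noeth D_fg.
have [E EE] := mxlinP (subm_val D \o f)%FUN.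
have Eq' : E *m q' = 0.
  apply/row_matrixP => i; rewrite row_mul row0 rowE -EE.
  by apply: (proj2 (subm_valP D _)); exists (f (delta_mx 0 i)).
have Eq'_ex : row_exact E q'.
  move=> x /(subm_valP D)[y <-]; have [z <-] := f_surj y.
  by exists z; rewrite -EE.
have QE : mx Q (-1) *m E = 0.
  apply/row_matrixP => i; rewrite row_mul row0 -EE /=.
  have -> : f (row i (mx Q (-1))) = 0 by apply/f_ker; exists (delta_mx 0 i); rewrite rowE.
  by rewrite linear0.
have QE_ex : row_exact (mx Q (-1)) E.
  move=> x xE; apply/f_ker; apply: (@subm_val_inj _ _ D); rewrite linear0.
  by rewrite -[LHS]/((subm_val D \o f)%FUN x) EE.
(* Each step goes one degree down in [P] and one up in [Q]. At the end [P] is in degree k + 3 and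
   [Q] at its differentials -2 and -1; the remaining two shifts pass through [E]. *)
have HV (n' : nat) : (n' <= absz (c - k - 3)%R)%N ->
    tor_zero S (op (mx Q (-2 - (absz (c - k - 3)%R)%:Z + n'%:Z + 1)))
      (op (mx Q (-2 - (absz (c - k - 3)%R)%:Z + n'%:Z))) (mx P (c - n'%:Z)).
  elim: n' => [|n' IHn'] ln'.
    rewrite addr0 subr0; apply: (eP Q (-2)); last by lia.
    by move=> i i2 x; apply: Q_ex; lia.
  have := IHn' (ltnW ln').
  have -> : c - n'%:Z = c - n'.+1%:Z + 1 by lia.
  have -> : (-2 - (absz (c - k - 3)%R)%:Z + n'.+1%:Z = -2 - (absz (c - k - 3)%R)%:Z + n'%:Z + 1) by lia.
  apply: tor_zero_down (mxK P _) _ _ _; first by apply: P_ex; lia.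
    by rewrite -opM mxK op0.
  by apply: row_exact_op; move=> x; apply: Q_ex; lia.
have := HV _ (leqnn _).
have -> : c - (absz (c - k - 3)%R)%:Z = k + 1 + 1 + 1 by lia.
rewrite subrK => H.
have {}H : tor_zero S (op E) (op (mx Q (-1))) (mx P (k + 1 + 1)).
  apply: tor_zero_down (mxK P _) _ _ _ H; first by apply: P_ex; lia.
    by rewrite -opM (mxK Q (-2)) op0.
  exact: row_exact_op.
have {}H : tor_zero S (mx P k) (op E) (mx P (k + 1)).
  apply: tor_zero_down (mxK P _) _ _ _ H; first by apply: P_ex; lia.
    by rewrite -opM QE op0.
  by rewrite -q'E; apply: row_exact_op.
apply: tor_zero_perfect (mxK P k) _ _ H; first by apply: P_ex; lia.
by rewrite -q'E -opM Eq' op0.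
Qed.

End RightResolutions.

(** * Finite injective dimension on both sides gives balance *)

Section Balanced.
Variables (R : comPzRingType) (A : assoc_algebra R).
Hypothesis R_noeth : left_noetherian R.
Hypothesis A_fg : fg_module (alg_module A).

Lemma shiftn_acyclic (X : bcomplex A) n : acyclic (cx_of X) ->
  acyclic (cx_of (shiftn (C := Db_mod A) n X)).
Proof.
move=> X0; elim: n => [//|n IHn] i x /= /eqP; rewrite oppr_eq0 => /eqP dx.
by have [y <-] := IHn (i + 1) x dx; exists (- y); rewrite /= linearN opprK.
Qed.

(** Left and right boundedness each amount to the local splitting of a free resolution in low
    degrees, at every maximal ideal. *)
Lemma inj_bound_balanced :
  (forall m : prime_ideal R, maximal_ideal m ->
     inj_bound (loc_set A m) /\ inj_bound (loc_set (opp_alg A) m)) ->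
  @balanced (Db_mod A).
Proof.
move=> bounds Y; have [P [p pq]] := fcx_cover R_noeth A_fg Y.
split=> Yb X X_brick; have [X0|[m m_max X_iso]] := loc_dichotomy R_noeth A_fg X_brick.
- by exists 0%N => n _; apply: (acyclic_trivial R_noeth A_fg).
- have [Sb _] := bounds m m_max.
  have [n Pn] := left_bounded_split R_noeth A_fg m_max pq Yb.
  exact (split_right_bounded R_noeth A_fg Sb pq Pn X_iso).
- exists 0%N => n _; apply/(proj2 (@dhom_trivialP A P Y _ p pq)) => a.
  by apply: acyclic_null; [apply: fc_proj | apply: shiftn_acyclic].
- have [Sb S'b] := bounds m m_max.
  have [n Pn] := right_bounded_split R_noeth A_fg m_max Sb S'b pq Yb.
  exact (split_left_bounded pq Pn X_iso).
Qed.

End Balanced.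

(** * Injective dimension and localization *)

Section InjectiveDimension.
Variable A : pzRingType.
Implicit Types M N : lmodType A.

(** A cocycle with values in the term [I i] and killed by [d i] is a coboundary of the same kind, by
    induction on the number of terms left in the injective resolution; a cocycle with values in [M]
    is the case i = 0. *)
Lemma injdim_hom_exact M : finite_injdim M -> exists n : nat, forall (Q : cplx A) c,
  (forall i, dual_basis (Q i)) ->
  (forall k, k <= c -> forall x, cd Q (k + 1) x = 0 -> exists y, x = cd Q k y) ->
  forall k, k + n%:Z <= c -> hom_exact (central_unit A) (cd Q k) (cd Q (k + 1)) M.
Proof.
move=> [I [d [e [N [I_inj e_inj e_ker d_ker I0]]]]]; exists N.+1 => Q c Q_proj Q_ex.
have E n i k : (N < i + n)%N -> k + n%:Z <= c -> forall b : {linear Q (k + 1) -> I i},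
    (forall x, b (cd Q k x) = 0) -> (forall x, d i (b x) = 0) ->
    exists2 g : {linear Q (k + 1 + 1) -> I i}, forall x, b x = g (cd Q (k + 1) x) &
      forall x, d i (g x) = 0.
  elim: n i k => [|n IHn] i k Nin kn b bd db.
    by exists \0 => x; [apply: I0; lia | rewrite linear0].
  have [|g gE] := inj_factor (I_inj i) (d := cd Q (k + 1)) (a := b).
    by move=> x /Q_ex[|y ->] //; lia.
  have [||||h hE dh] := IHn i.+1 (k + 1) _ _ (d i \o g)%FUN.
  - by lia.
  - by lia.
  - by move=> x; rewrite /= gE db.
  - by move=> x; apply/d_ker; exists (g x).
  have [h' h'E] := dual_basis_lift (Q_proj (k + 1 + 1 + 1)) (fun x => (d_ker _ _).1 (dh x)).
  exists (g \- (h' \o cd Q (k + 1 + 1)))%FUN => x /=; first by rewrite cdK linear0 subr0 gE.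
  by rewrite linearB h'E -hE subrr.
move=> k kN b bd; have [|||g gE dg] := E N.+1 0%N k _ kN (e \o b)%FUN.
- by lia.
- by move=> x /=; rewrite bd linear0.
- by move=> x; apply/e_ker; exists (b x).
have [f fE] := inj_corestrict e_inj (fun x => (e_ker _).1 (dg x)).
exists 1 => //; exists f => x; apply: e_inj.
by rewrite scale1r fE -gE.
Qed.

Lemma finite_injdim_injective M : injective_module M -> finite_injdim M.
Proof.
move=> M_inj; pose I n : lmodType A := if n is 0%N then M else 'rV[A]_0.
exists I, (fun n => \0), idfun, 0%N; split=> [[|n]|x y|x|n x|[|n] //= _ x] //.
- by move=> U V f g f_inj; exists \0 => x; rewrite [RHS]thinmx0.
- by split=> // _; exists x.
- by split=> // _; exists 0; rewrite linear0 [x]thinmx0.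
- by rewrite [x]thinmx0.
Qed.

Lemma finite_injdim_cosyz M : finite_injdim (cosyz M) -> finite_injdim M.
Proof.
move=> [I [d [e [N [I_inj e_inj e_ker d_ker I0]]]]].
pose J n : lmodType A := if n is n'.+1 then I n' else hull M.
pose dJ n : {linear J n -> J n.+1} :=
  if n is n'.+1 return {linear J n -> J n.+1} then d n' else (e \o cosyz_proj M)%FUN.
exists J, dJ, (hull_emb M), N.+1; split=> [[|n]|x y|x|[|n] x|[|n] //=].
- exact: hull_injective.
- exact: I_inj.
- exact: hull_emb_inj.
- rewrite -cosyz_ker /=; split=> [|->]; last exact: linear0.
  by rewrite -[X in _ = X](linear0 e) => /e_inj.
- rewrite e_ker; split=> [[y <-]|[y <-]]; last by exists (cosyz_proj M y).
  by have [z <-] := cosyz_surj y; exists z.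
- exact: d_ker.
- by move=> nN; apply: I0.
Qed.

Lemma finite_injdim_iter n M : injective_module (iter n (@cosyz A) M) -> finite_injdim M.
Proof.
elim: n M => [|n IHn] M; first exact: finite_injdim_injective.
by rewrite iterSr => /IHn/finite_injdim_cosyz.
Qed.

End InjectiveDimension.

(** * Transfer of injective dimension to a localization *)

Record is_localization (A L : pzRingType) (S : central_set A) (f : {rmorphism A -> L}) : Prop :=
  IsLocalization {
    loc_frac : forall x : L, exists2 s, S s & exists a, f s * x = f a;
    loc_ker : forall a, f a = 0 -> exists2 s, S s & s * a = 0;
    loc_inv : forall s, S s -> exists t, t * f s = 1;
    loc_central : forall s, S s -> forall x, f s * x = x * f s
  }.

Section Localize.
Variables (A L : pzRingType) (S : central_set A) (f : {rmorphism A -> L}).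
Hypothesis locf : is_localization S f.
Local Notation mapf := (map_mx f).

Lemma loc_noetherian : left_noetherian A -> left_noetherian L.
Proof.
move=> A_noeth J [J0 JD JM]; have [|n [e [Je eP]]] := A_noeth (fun a => J (f a)).
  split; first by rewrite rmorph0.
    by move=> x y; rewrite rmorphD; apply: JD.
  by move=> a x; rewrite rmorphM; apply: JM.
exists n, (fun i => f (e i)); split=> // x Jx.
have [s Ss [a sx]] := loc_frac locf x; have [t ts] := loc_inv locf Ss.
have [|c cE] := eP a; first by rewrite -sx; apply: JM.
exists (fun i => t * f (c i)); rewrite -[x]mul1r -ts -mulrA sx cE rmorph_sum mulr_sumr.
by apply: eq_bigr => i _; rewrite rmorphM mulrA.
Qed.

Lemma loc_mx_frac a b (M : 'M[L]_(a, b)) : exists2 s, S s & exists N, f s *: M = mapf N.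
Proof.
have [s sP] : exists s : 'I_a * 'I_b -> A, forall k, S (s k) /\ exists x, f (s k) * M k.1 k.2 = f x.
  have sP k : exists s, S s /\ exists x, f s * M k.1 k.2 = f x.
    by have [s Ss [x sx]] := loc_frac locf (M k.1 k.2); exists s; split=> //; exists x.
  by have [s ?] := choice sP; exists s.
have [t St tP] := cs_prod (fun k => (sP k).1); exists t => //.
have tM k : exists x, f t * M k.1 k.2 = f x.
  have [u _ ->] := tP k; have [_ [x sx]] := sP k.
  by exists (u * x); rewrite !rmorphM -mulrA sx.
have [x xE] := choice tM; exists (\matrix_(i, j) x (i, j)).
by apply/matrixP => i j; rewrite !mxE -xE.
Qed.

Lemma loc_mx_ker a b (M : 'M[A]_(a, b)) : mapf M = 0 -> exists2 s, S s & s *: M = 0.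
Proof.
move=> /matrixP M0.
have [s sP] : exists s : 'I_a * 'I_b -> A, forall k, S (s k) /\ s k * M k.1 k.2 = 0.
  have sP k : exists s, S s /\ s * M k.1 k.2 = 0.
    have [|s Ss sM] := loc_ker locf (a := M k.1 k.2); last by exists s.
    by have := M0 k.1 k.2; rewrite !mxE.
  by have [s ?] := choice sP; exists s.
have [t St tP] := cs_prod (fun k => (sP k).1); exists t => //.
apply/matrixP => i j; rewrite !mxE; have [u _ ->] := tP (i, j).
by rewrite -mulrA (proj2 (sP (i, j))) mulr0.
Qed.

Lemma loc_mulmxZr s a b c (M : 'M[L]_(a, b)) (N : 'M_(b, c)) : is_central s ->
  M *m (s *: N) = s *: (M *m N).
Proof.
move=> sC; apply/matrixP => i j; rewrite !mxE mulr_sumr; apply: eq_bigr => k _.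
by rewrite mxE mulrA -sC mulrA.
Qed.

Lemma loc_inv_central s : S s -> exists2 t, is_central t & t * f s = 1.
Proof.
move=> Ss; have [t ts] := loc_inv locf Ss; exists t => // x.
have st : f s * t = 1 by rewrite (loc_central locf Ss).
by rewrite -[t * x]mulr1 -st mulrA -[_ * x * _]mulrA -(loc_central locf Ss) mulrA ts mul1r.
Qed.

Lemma loc_row_exact a b c (q : 'M[A]_(a, b)) (q' : 'M_(b, c)) :
  row_exact q q' -> row_exact (mapf q) (mapf q').
Proof.
move=> qE x xq; have [s Ss [y sy]] := loc_mx_frac x; have [t ts] := loc_inv locf Ss.
have [|u Su uy] := loc_mx_ker (M := y *m q').
  by rewrite map_mxM -sy -scalemxAl xq scaler0.
have [|z zE] := qE (u *: y); first by rewrite -scalemxAl.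
have [v vu] := loc_inv locf Su; exists (t *: (v *: mapf z)).
rewrite -!scalemxAl -map_mxM -zE map_mxZ -sy.
by rewrite !scalerA -[t * v * f u]mulrA vu mulr1 ts scale1r.
Qed.

Definition map_fcx (P : fcx A) : fcx L.
Proof.
exists (sz P) (fun i => mapf (mx P i)); last exact: sz_top.
by move=> i; rewrite -map_mxM mxK map_mx0.
Defined.

Lemma injdim_inj_bound : @finite_injdim L L^o -> inj_bound S.
Proof.
move=> /injdim_hom_exact[n nP]; exists n => P c P_ex k kc.
apply/hom_exact_col => x qx.
have [k'|k' k'c||_ -> [y yE]] := (hom_exact_col _ _ _).1 (nP (fc (map_fcx P)) c _ _ k kc) (mapf x).
- exact: rv_dual_basis.
- by move=> x' /(loc_row_exact (P_ex k' k'c))[y ->]; exists y.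
- by rewrite /= -map_mxM qx map_mx0.
move: yE; rewrite scale1r /= => yE; have [s Ss [z sz]] := loc_mx_frac y.
have [|t St tE] := loc_mx_ker (M := s *: x - mx P (k + 1) *m z).
  by rewrite map_mxB map_mxZ map_mxM -sz (loc_mulmxZr _ _ (loc_central locf Ss)) yE subrr.
exists (t * s); first exact: csM.
exists (t *: z); apply/eqP; rewrite -subr_eq0 -scalerA (mulmxZr _ _ St).
by rewrite -scalerBr tE.
Qed.

Lemma loc_hom_exact a b c (q : 'M[A]_(a, b)) (q' : 'M_(b, c)) :
  hom_exact S (mxlin q) (mxlin q') A^o ->
  hom_exact (central_unit L) (mxlin (mapf q)) (mxlin (mapf q')) L^o.
Proof.
move=> /hom_exact_col H; apply/hom_exact_col => x qx; exists 1 => //; rewrite scale1r.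
have [s Ss [y sy]] := loc_mx_frac x; have [t ts] := loc_inv locf Ss.
have [|u Su uy] := loc_mx_ker (M := q *m y).
  by rewrite map_mxM -sy (loc_mulmxZr _ _ (loc_central locf Ss)) qx scaler0.
have [|v Sv [z zE]] := H (u *: y); first by rewrite (mulmxZr _ _ Su).
have [w wC ww] := loc_inv_central (csM Sv (csM Su Ss)).
exists (w *: mapf z); rewrite (loc_mulmxZr _ _ wC) -map_mxM -zE !map_mxZ -sy !scalerA.
by rewrite -!mulrA -!rmorphM ww scale1r.
Qed.

Section Converse.
Hypothesis A_noeth : left_noetherian A.

(** Baer's criterion for the cosyzygy [C] of order d + 1. An ideal of [L] comes from its contraction
    [JA] to [A]. A free resolution of [JA], continued by [E] into the ring and localized, is exact,
    and the vanishing of Ext into [L] extends [phi] from the ideal to [L]. *)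
Lemma inj_bound_injdim : inj_bound S -> @finite_injdim L L^o.
Proof.
move=> [d dP]; apply: (@finite_injdim_iter _ d.+1); set C := iter d.+1 _ _.
apply: baer => J phi [J0 JD JM] phiD phiM.
have [JA JAE] : exists D : submod A^o, forall a, D a <-> J (f a).
  unshelve eexists (@Submod A A^o (fun a => J (f a)) _ _ _) => //.
  - by have := J0; rewrite -(rmorph0 f).
  - by move=> x y Jx Jy; have := JD _ _ Jx Jy; rewrite -rmorphD.
  - by move=> a x Jx; have := JM (f a) _ Jx; rewrite -rmorphM.
have [P [e [_ e_surj e_ker P_ex _]]] := stalk_cover A_noeth (fg_subm A_noeth JA (fg_regular A)).
have [E EE] := colformP (subm_val JA \o e)%FUN.
have PE : row_exact (mx P (-1)) E.
  move=> x xE; apply/e_ker; apply: (@subm_val_inj _ _ JA); rewrite linear0.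
  by rewrite -[LHS]/((subm_val JA \o e)%FUN x) EE /= xE mxE.
have PE0 : mx P (-1) *m E = 0.
  apply: colform_inj => x; rewrite /= mulmxA -[LHS]/(colform E (x *m mx P (-1))) -EE /=.
  have -> : e (x *m mx P (-1)) = 0 by apply/e_ker; exists x.
  by rewrite linear0 mulmx0 mxE.
(* d shifts lead from k to degree -2, and one more to the differential followed by [E]. *)
pose k : int := - 2 - d%:Z.
have /hom_exact_iter : hom_exact (central_unit L) (cd (fc (map_fcx P)) k)
    (cd (fc (map_fcx P)) (k + 1)) L^o.
  apply/loc_hom_exact/(dP P (-2)) => [k' k'2 x|]; last by rewrite subrK.
  by apply: P_ex; lia.
move=> /(_ d (-2) (proj1 (fc_proj (map_fcx P)))); rewrite subrK => /(_ _ (lexx _)) H.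
have {}H : hom_exact (central_unit L) (mxlin (mapf (mx P (-1)))) (mxlin (mapf E)) C.
  apply: hom_exact_cosyz (H _) (rv_dual_basis L _) _ _.
  - by move=> k' k'2; apply: row_loc_exact; apply: loc_row_exact => x; apply: P_ex; lia.
  - exact: (@cdK _ (fc (map_fcx P)) (-2)).
  - by apply: row_loc_exact; apply: loc_row_exact.
have JE x : J ((x *m mapf E) 0 0).
  rewrite mxE; elim/big_ind: _ => // i _; apply: JM; rewrite mxE; apply/JAE.
  apply/subm_valP; exists (e (delta_mx 0 i)).
  by rewrite -[LHS]/((subm_val JA \o e)%FUN _) EE /= -rowE mxE.
have phi0 : phi 0 = 0 by rewrite -[0 in LHS](mul0r 0) phiM // scale0r.
have lin : linear (fun x : 'rV[L]_(sz P 0) => phi ((x *m mapf E) 0 0)).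
  move=> a x y; rewrite mulmxDl -scalemxAl; set u := x *m _; set v := y *m _.
  have -> : (a *: u + v) 0 0 = a * u 0 0 + v 0 0 by rewrite !mxE.
  rewrite phiD ?phiM //; [exact: JE | apply: JM; exact: JE | exact: JE].
have [|_ -> [c cE]] := H (Lin lin).
  by move=> x; rewrite /= -mulmxA -map_mxM PE0 map_mx0 mulmx0 mxE.
exists (c 1%:M) => x Jx.
have [s Ss [a sx]] := loc_frac locf x; have [t ts] := loc_inv locf Ss.
have /subm_valP[y ya] : JA a by apply/JAE; rewrite -sx; apply: JM.
have [z zy] := e_surj y.
have xE : x%:M = t *: mapf z *m mapf E :> 'M_1.
  rewrite -scalemxAl -map_mxM [z *m E]mx11_scalar -[_ 0 0]/(colform E z) -EE /= zy ya.
  by rewrite map_scalar_mx /= -sx scale_scalar_mx mulrA ts mul1r.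
have := cE (t *: mapf z); rewrite scale1r /= -xE mxE eqxx mulr1n => ->.
by rewrite -[x%:M]scalemx1 linZ.
Qed.

End Converse.
End Localize.

Section LocalizationMap.
Variables (R : comPzRingType) (A : assoc_algebra R) (p : prime_ideal R).
Local Notation L := (localization A p).

Definition loc_map (a : A) : L := \pi_(L)%qT (a, denom1 p).

Lemma loc_map_eq (a b : A) s t : (exists2 u, ~~ prime_mem p u &
    alg_map A u * (alg_map A (val t) * a) = alg_map A u * (alg_map A (val s) * b)) ->
  \pi_(L)%qT (a, s) = \pi_(L)%qT (b, t).
Proof. by move=> [u pu E]; apply: eq_localization; apply/asboolP; exists (Sub u pu). Qed.

Fact loc_map_zmod_morphism : zmod_morphism loc_map.
Proof.
move=> a b; rewrite /loc_map !piE; apply: loc_map_eq; exists 1; first exact: prime_proper.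
by rewrite /= /alg_scale !(rmorph1, rmorphM, mul1r).
Qed.

Fact loc_map_monoid_morphism : monoid_morphism loc_map.
Proof.
split=> [|a b]; first by rewrite /loc_map !piE.
rewrite /loc_map !piE; apply: loc_map_eq; exists 1; first exact: prime_proper.
by rewrite /= !(rmorph1, rmorphM, mul1r).
Qed.

HB.instance Definition _ := GRing.isZmodMorphism.Build A L loc_map loc_map_zmod_morphism.
HB.instance Definition _ := GRing.isMonoidMorphism.Build A L loc_map loc_map_monoid_morphism.

Lemma loc_map_is_localization : is_localization (loc_set A p) loc_map.
Proof.
split=> [x|a|_ [s ps ->]|_ [s ps ->] x].
- rewrite -[x]reprK; move: (repr x) => [b t]; exists (alg_map A (val t)).
    by exists (val t); [exact: (valP t)|].
  exists b; rewrite /loc_map !piE; apply: loc_map_eq; exists 1; first exact: prime_proper.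
  by rewrite /= !(rmorph1, rmorphM, mul1r).
- move=> a0; have /eqP : loc_map a = loc_map 0 by rewrite a0 rmorph0.
  rewrite /loc_map piE => /asboolP[u /=]; rewrite /alg_scale !(rmorph1, mul1r, mulr0) => ua.
  by exists (alg_map A (val u)) => //; exists (val u); [exact: (valP u)|].
- exists (\pi_(L)%qT (1, Sub s ps)); rewrite /loc_map !piE; apply: loc_map_eq.
  exists 1; first exact: prime_proper.
  by rewrite /= !(rmorph1, rmorphM, mul1r, mulr1).
- rewrite -[x]reprK; move: (repr x) => [b t]; rewrite /loc_map !piE; apply: loc_map_eq.
  exists 1; first exact: prime_proper.
  by rewrite /= !(rmorph1, rmorphM, mul1r, mulr1) -(alg_map_central s).
Qed.

End LocalizationMap.

Section OppositeMorphism.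
Variables (A L : pzRingType) (f : {rmorphism A -> L}).

Definition opp_morph (a : A^c) : L^c := f a.

Fact opp_morph_zmod_morphism : zmod_morphism opp_morph.
Proof. exact (rmorphB f). Qed.

Fact opp_morph_monoid_morphism : monoid_morphism opp_morph.
Proof.
split=> [|x y]; first exact (rmorph1 f).
exact (rmorphM f y x).
Qed.

HB.instance Definition _ := GRing.isZmodMorphism.Build A^c L^c opp_morph opp_morph_zmod_morphism.
HB.instance Definition _ := GRing.isMonoidMorphism.Build A^c L^c opp_morph opp_morph_monoid_morphism.

Lemma opp_is_localization (S : central_set A) (S' : central_set A^c) :
  (forall s, S s <-> S' s) -> is_localization S f -> is_localization S' opp_morph.
Proof.
move=> SS' locf; split=> [x|a a0|s|s] /=.
- have [s Ss [a sx]] := loc_frac locf x; exists s; first exact/SS'.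
  by exists a; apply: etrans (esym (loc_central locf Ss x)) sx.
- have [s Ss sa] := loc_ker locf a0; exists s; first exact/SS'.
  by apply: etrans (esym (csC Ss a)) sa.
- move=> /SS' Ss; have [t ts] := loc_inv locf Ss; exists t.
  by apply: etrans (loc_central locf Ss t) ts.
- move=> /SS' Ss x; exact (esym (loc_central locf Ss x)).
Qed.

End OppositeMorphism.

Lemma inj_bound_trivial (A : pzRingType) (S : central_set A) : S 0 -> inj_bound S.
Proof.
by move=> S0; exists 0%N => P c _ k _ b _; exists 0 => //; exists \0 => x; rewrite scale0r.
Qed.

Section Gorenstein.
Variables (R : comPzRingType) (A : assoc_algebra R) (p : prime_ideal R).
Hypothesis R_noeth : left_noetherian R.
Hypothesis A_fg : fg_module (alg_module A).
Local Notation L := (localization A p).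
Let A_noeth : left_noetherian A := algebra_noetherian A_fg R_noeth.
Let A'_noeth : left_noetherian A^c := algebra_noetherian (opp_fg A_fg) R_noeth.
Let locL := loc_map_is_localization A p.
Let locL' : @is_localization A^c L^c (loc_set (opp_alg A) p) (opp_morph (loc_map p)) :=
  @opp_is_localization A L _ (loc_set A p) (loc_set (opp_alg A) p) (fun s => conj id id) locL.

Lemma gorenstein_inj_bound : ((1 : L) <> 0 -> iwanaga_gorenstein L) ->
  inj_bound (loc_set A p) /\ inj_bound (loc_set (opp_alg A) p).
Proof.
move=> G; have [L0|L1] := pselect ((1 : L) = 0); last first.
  have [_ _ I I'] := G L1; split; first exact: injdim_inj_bound locL I.
  exact: injdim_inj_bound locL' I'.
have [|s Ss] := loc_ker locL (a := 1); first by rewrite rmorph1.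
rewrite mulr1 => s0; rewrite s0 in Ss.
by split; apply: inj_bound_trivial.
Qed.

Lemma inj_bound_gorenstein :
  inj_bound (loc_set A p) -> inj_bound (loc_set (opp_alg A) p) -> iwanaga_gorenstein L.
Proof.
move=> Sb S'b; split.
- exact: loc_noetherian locL A_noeth.
- exact: loc_noetherian locL' A'_noeth.
- exact: inj_bound_injdim locL A_noeth Sb.
- exact: inj_bound_injdim locL' A'_noeth S'b.
Qed.

End Gorenstein.

(** * Balanced derived categories *)

Section DualBases.
Variable A : pzRingType.
Implicit Types M P : lmodType A.

Lemma dual_basis_fin P (I : finType) (e : I -> P) (l : I -> {linear P -> A^o}) :
  (forall x, x = \sum_k (l k x : A) *: e k) -> dual_basis P.
Proof.
move=> lP; exists #|I|, (fun i => e (enum_val i)), (fun i => l (enum_val i)) => x.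
rewrite [LHS]lP (reindex_onto enum_val enum_rank) => [|i _]; last by rewrite enum_rankK.
by apply: eq_bigl => i; rewrite enum_valK eqxx.
Qed.

Lemma projective_dual_basis P : fg_module P -> projective_module P -> dual_basis P.
Proof.
move=> /fgP[n [f f_surj]] P_proj; have [h hE] := P_proj _ _ f idfun f_surj.
have [k [e [l lP]]] := rv_dual_basis A n.
exists k, (fun i => f (e i)), (fun i => l i \o h)%FUN => x.
have {1}<- : f (h x) = x := hE x.
rewrite {1}[h x]lP linear_sum.
by apply: eq_bigr => i _; rewrite linZ.
Qed.

Lemma ffun_dual_basis (I : finType) P : dual_basis P -> dual_basis {ffun I -> P}.
Proof.
move=> [n [e [l lP]]].
have lin k : linear (fun w : {ffun I -> P} => l k.2 (w k.1)).
  by move=> a x y; rewrite !ffunE linearP.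
apply: (@dual_basis_fin _ (I * 'I_n)%type
  (fun k => [ffun i => if i == k.1 then e k.2 else 0]) (fun k => Lin (lin k))) => w.
apply/ffunP => i; rewrite sum_ffunE [LHS]lP.
rewrite -(pair_bigA _ (fun k j => ((l j (w k) : A) *: [ffun i => if i == k then e j else 0] : {ffun I -> P}) i)) /=.
rewrite [RHS](bigD1 i) //= [X in _ = _ + X]big1 ?addr0 => [|k /negbTE ki].
  by apply: eq_bigr => j _; rewrite !ffunE eqxx.
by rewrite big1 // => j _; rewrite !ffunE eq_sym ki scaler0.
Qed.

(** The degree -2 - n leaves room for n shifts up to the augmentation of a resolution of [N]. *)
Lemma inj_bound_ext1 (S : central_set A) : left_noetherian A -> inj_bound S ->
  exists n, forall N, fg_module N -> ext1_zero S N (iter n (@cosyz A) A^o).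
Proof.
move=> A_noeth [n nP]; exists n => N N_fg.
have [Q [e [_ e_surj e_ker Q_ex _]]] := stalk_cover A_noeth N_fg.
have Q_ex' k : k <= -2 -> row_exact (mx Q k) (mx Q (k + 1)).
  by move=> k2 x; apply: Q_ex; lia.
have H : hom_exact S (cd (fc Q) (-2 - n%:Z)) (cd (fc Q) (-2 - n%:Z + 1)) A^o.
  by apply: (nP Q (-2) Q_ex'); rewrite subrK.
have := @hom_exact_iter _ S (fc Q) n A^o (-2) (-2 - n%:Z) (proj1 (fc_proj Q)).
rewrite subrK => /(_ _ _ H) H2.
apply: (hom_exact_ext1 (H2 _ _) (rv_dual_basis A (sz Q 0)) (@cdK _ (fc Q) (-2)) _ _ e_surj) => //.
- by move=> k' k'2; apply/row_loc_exact/Q_ex'.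
- by apply: exact_loc_exact => x /e_ker[y ->]; exists y.
- by move=> y; apply/e_ker; exists y.
Qed.

Lemma inj_bound_mono (S T : central_set A) : (forall s, S s -> T s) -> inj_bound S -> inj_bound T.
Proof.
move=> ST [d dP]; exists d => P c P_ex k kc.
exact: hom_exact_mono ST (dP P c P_ex k kc).
Qed.

End DualBases.

(** * Balance bounds the left injective dimension *)

Section LeftBound.
Variables (R : comPzRingType) (A : assoc_algebra R).
Hypothesis R_noeth : left_noetherian R.
Hypothesis A_fg : fg_module (alg_module A).
Let A_noeth : left_noetherian A := algebra_noetherian A_fg R_noeth.

Definition unit_fcx : fcx A.
Proof.
exists (fun i => if i is Posz 0 then 1%N else 0%N) (fun i => 0) => [i|]; first exact: mulmx0.
by exists 1; case=> [[|n]|n].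
Defined.

(** Hom(A, X[n]) is the n-th cohomology of [X], which is bounded. *)
Lemma left_bounded_unit : @left_bounded (Db_mod A) (stalk (fg_regular A)).
Proof.
pose F i : {linear fc unit_fcx i -> stalk (fg_regular A) i} :=
  match i return {linear fc unit_fcx i -> stalk (fg_regular A) i} with
  | Posz 0 => colform (1%:M : 'M[A]_1) | _ => \0 end.
have ch : forall i x, diff (stalk (fg_regular A)) i (F i x) = F (i + 1) (cd (fc unit_fcx) i x).
  by move=> i x; rewrite [cd _ _ _]mulmx0 linear0.
pose p := @Chain _ (fc unit_fcx) (cx_of (stalk (fg_regular A))) F ch.
have pq : qis p.
  have Z0 (i : int) : i <> 0 -> forall x : fc unit_fcx i, x = 0.
    by case: i => [[|n]|n] //= _ x; rewrite [x]thinmx0.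
  move=> i; have [i0|/eqP ni] := eqVneq (i + 1) 0; last first.
    split=> [x _ _|y _]; first by exists 0; rewrite linear0 (Z0 _ ni x).
    exists 0; first exact: linear0.
    by exists 0; rewrite (stalk_zero ni y) [p _ _]linear0 subr0; exact: linear0.
  have -> : i = -1 by lia.
  split=> /= [x _ [y yE]|y _]; last first.
    exists (y : A)%:M; first by rewrite mulmx0.
    by exists 0; rewrite mulmx1 mxE eqxx mulr1n subrr.
  exists 0; rewrite mulmx0; apply/rowP => j; rewrite ord1 mxE yE.
  by rewrite mulmx1.
move=> X X_brick; have [l Xl] := cx_bounded X; exists l.+1 => n ln.
apply/(proj2 (@dhom_trivialP A _ _ _ p pq)) => a; apply: homotopic_eq => -[[|i]|i] x.
- have Z : forall y : (shiftn (C := Db_mod A) n X : bcomplex A) 0, y = 0.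
    by rewrite shiftn_obj; apply: Xl; lia.
  exact: Z.
- by rewrite [x]thinmx0 !linear0.
- by rewrite [x]thinmx0 !linear0.
Qed.

Lemma balanced_inj_bound (m : prime_ideal R) : maximal_ideal m -> @balanced (Db_mod A) ->
  inj_bound (loc_set A m).
Proof.
move=> m_max bal; have Yb := (bal _).1 left_bounded_unit.
have [||n nP] := @right_bounded_ext1 R A R_noeth A_fg m m_max _ 0 Yb.
- by move=> i i0; apply: stalk_zero; lia.
- move=> N N_fg N_simple mN Q p pq; exists 0%N => k _ j j0.
  by apply: hom_exact_zero; apply: stalk_zero; lia.
exists n => P c P_ex k kc.
apply: (@hom_exact_of_ext1 _ _ (fc P) n _ c) => //.
- by move=> i; apply: rv_dual_basis.
- by move=> k' k'c; apply/row_loc_exact/P_ex.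
- by move=> N N_fg; apply: (nP N N_fg n (leqnn n)).
Qed.

End LeftBound.

Definition prime_compl (R : comPzRingType) (m : prime_ideal R) : central_set R.
Proof.
exists (fun s => ~~ prime_mem m s); first exact: prime_proper.
- by move=> s t ms mt; apply: (valP (denomM (Sub s ms : denom m) (Sub t mt))).
- by move=> s _ a; apply: mulrC.
Defined.

(** * Descent of the bound to the base ring *)

Section BaseRing.
Variables (R : comPzRingType) (A : assoc_algebra R).
Hypothesis A_proj : dual_basis (alg_module A).
Variable m : prime_ideal R.
Local Notation S := (loc_set A m).

(** Otherwise all coefficients of a dual basis lie in m, and Nakayama's lemma gives u outside m that
    kills [A], so that 0 lies in [S]. *)
Lemma algebra_trace : ~ S 0 -> exists (b : A) (l : {linear alg_module A -> R^o}),
  ~~ prime_mem m (l b).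
Proof.
move=> S0; apply: contrapT => nl; have [n [e [l lP]]] := A_proj.
have lm k x : prime_mem m (l k x).
  by apply: contrapT => /negP mlx; apply: nl; exists x, (l k).
have [|k|u mu ue] := @prime_nakayama R m (alg_module A) (sm_bot _) n e 1.
- exact: prime_proper.
- exists (fun j => l j (e k)) => [j|]; first exact: lm.
  by rewrite /= scale1r -lP subrr.
apply: S0; exists u => //; have u1 : u *: (1 : alg_module A) = 0.
  rewrite [1 in LHS]lP scaler_sumr big1 // => k _.
  by rewrite scalerA mulrC -scalerA ue scaler0.
by rewrite -[alg_map A u]mulr1; exact (esym u1).
Qed.

(** Flatness of [A]: the forms of a dual basis split a row over [A] into rows over R. *)
Lemma row_exact_alg a b c (q : 'M[R]_(a, b)) (q' : 'M_(b, c)) : row_exact q q' ->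
  row_exact (map_mx (alg_map A) q) (map_mx (alg_map A) q').
Proof.
move=> qE x xq; have [n [e [l lP]]] := A_proj.
have lq k d (M : 'M[R]_(b, d)) : (\row_j (l k (x 0 j) : R)) *m M =
    \row_j (l k ((x *m map_mx (alg_map A) M) 0 j) : R).
  apply/rowP => j; rewrite !mxE linear_sum; apply: eq_bigr => i _.
  rewrite !mxE mulrC -[M i j * _]/(M i j *: (l k (x 0 i) : R^o)) -linZ.
  congr (l k _); exact (alg_map_central (M i j) (x 0 i)).
have ly k : exists y, \row_j (l k (x 0 j) : R) = y *m q.
  by apply: qE; rewrite lq xq; apply/rowP => j; rewrite !mxE linear0.
have [y yE] := choice ly.
exists (\sum_k (e k : A)%:M *m map_mx (alg_map A) (y k)).
rewrite mulmx_suml; apply/rowP => j; rewrite summxE [LHS](lP (x 0 j)); apply: eq_bigr => k _.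
rewrite -mulmxA -map_mxM -yE mul_scalar_mx !mxE.
exact (@alg_map_central R A (l k (x 0 j)) (e k)).
Qed.

(** Extend scalars to [A], multiply the cocycle by [b], use the bound over [A], and come back
    through [l]; this multiplies the cocycle by l(b), which lies outside m. *)
Lemma inj_bound_base : ~ S 0 -> inj_bound S -> inj_bound (prime_compl m).
Proof.
move=> /algebra_trace[b [l mlb]] [d dP]; exists d => Q c Q_ex k kc.
unshelve epose (P := @Fcx A (sz Q) (fun i => map_mx (alg_map A) (mx Q i)) _ (sz_top Q)).
  by move=> i; rewrite -map_mxM mxK map_mx0.
have /hom_exact_col H := dP P c (fun k kc => row_exact_alg (Q_ex k kc)) k kc.
apply/hom_exact_col => x qx.
have [|_ [s ms ->] [y yE]] := H (map_mx (alg_map A) x *m b%:M).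
  by rewrite /= mulmxA -map_mxM qx map_mx0 mul0mx.
exists (s * (l b : R)); first exact: (@csM _ (prime_compl m) _ _ ms mlb).
exists (map_mx (l : A -> R) y).
have lin r (z : A) : l (alg_map A r * z : A) = r * (l z : R) by exact: (linZ l r z).
apply/colP => i; have /colP/(_ i)/(congr1 (l : A -> R)) := yE.
rewrite !mxE big_ord1 !mxE eqxx mulr1n linear_sum !lin => E.
rewrite -mulrA [_ * x i 0]mulrC E; apply: eq_bigr => j _.
by rewrite !mxE lin.
Qed.

End BaseRing.

(** * The dual Hom_R(A, R) *)

Section DualModule.
Variables (R : comPzRingType) (A : assoc_algebra R).

Definition dual := {f : alg_module A -> R^o | linear f}.
HB.instance Definition _ := gen_eqMixin dual.
HB.instance Definition _ := gen_choiceMixin dual.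

Implicit Types (f g : dual) (x y a b : A).

Definition dual_lin f : {linear alg_module A -> R^o} := Lin (svalP f).
Definition dual_of (u : {linear alg_module A -> R^o}) : dual :=
  exist (fun v => linear v) u (linearP u).

Lemma dual_eq f g : (forall x, dual_lin f x = dual_lin g x) -> f = g.
Proof.
case: f g => f fP [g gP] /= fg; have eq_fg : f = g by apply/funext.
by move: gP; rewrite -eq_fg => gP; congr exist; apply: Prop_irrelevance.
Qed.

Fact dual_scale_linear a f : linear (fun x : alg_module A => dual_lin f ((x : A) * a)).
Proof.
move=> r x y; rewrite -[RHS](linearP (dual_lin f)); congr (dual_lin f _).
by rewrite [LHS]mulrDl; congr (_ + _); apply: esym (mulrA _ _ _).
Qed.

Definition dual_zero := dual_of \0.
Definition dual_add f g := dual_of (dual_lin f \+ dual_lin g).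
Definition dual_opp f := dual_of (\- dual_lin f).
Definition dual_scale a f := dual_of (Lin (dual_scale_linear a f)).

Fact dual_addA : associative dual_add.
Proof. by move=> f g h; apply: dual_eq => x; apply: addrA. Qed.
Fact dual_addC : commutative dual_add.
Proof. by move=> f g; apply: dual_eq => x; apply: addrC. Qed.
Fact dual_add0 : left_id dual_zero dual_add.
Proof. by move=> f; apply: dual_eq => x; apply: add0r. Qed.
Fact dual_addN : left_inverse dual_zero dual_opp dual_add.
Proof. by move=> f; apply: dual_eq => x; apply: addNr. Qed.
HB.instance Definition _ := GRing.isZmodule.Build dual
  dual_addA dual_addC dual_add0 dual_addN.

Fact dual_scaleA a b f : dual_scale a (dual_scale b f) = dual_scale (a * b) f.
Proof. by apply: dual_eq => x /=; rewrite mulrA. Qed.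
Fact dual_scale1 : left_id 1 dual_scale.
Proof. by move=> f; apply: dual_eq => x /=; rewrite mulr1. Qed.
Fact dual_scaleDr : right_distributive dual_scale +%R.
Proof. by move=> a f g; apply: dual_eq => x. Qed.
Fact dual_scaleDl f : {morph dual_scale^~ f : a b / a + b}.
Proof.
move=> a b; apply: dual_eq => x; rewrite -[RHS](linearD (dual_lin f)).
by rewrite -[LHS]/(dual_lin f (x * (a + b) : A)) mulrDr.
Qed.
HB.instance Definition _ := GRing.Zmodule_isLmodule.Build A dual
  dual_scaleA dual_scale1 dual_scaleDr dual_scaleDl.

Lemma dual_addE f g x : dual_lin (f + g) x = dual_lin f x + dual_lin g x.
Proof. by []. Qed.

Lemma dual_sumE (I : finType) (F : I -> dual) x : dual_lin (\sum_i F i) x = \sum_i dual_lin (F i) x.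
Proof. by elim/big_ind2: _ => // f a g b <- <-. Qed.

Lemma dual_scaleE a f x : dual_lin (a *: f) x = dual_lin f ((x : A) * a).
Proof. by []. Qed.

Lemma dual_restrZ r f x : dual_lin (alg_map A r *: f) x = r * (dual_lin f x : R).
Proof.
rewrite dual_scaleE -alg_map_central.
exact (linZ (dual_lin f) r (x : alg_module A)).
Qed.

Variables (n : nat) (e : 'I_n -> alg_module A) (l : 'I_n -> {linear alg_module A -> R^o}).
Hypothesis lP : forall x, x = \sum_k (l k x : R) *: e k.

Lemma dual_basisE f : f = \sum_k alg_map A (dual_lin f (e k)) *: dual_of (l k).
Proof.
apply: dual_eq => x; rewrite dual_sumE [x in LHS]lP linear_sum; apply: eq_bigr => k _.
by rewrite dual_restrZ linZ; apply: mulrC.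
Qed.

Lemma dual_fg : fg_module (dual : lmodType A).
Proof.
by exists n, (fun k => dual_of (l k)) => f; eexists; apply: dual_basisE.
Qed.

Lemma dual_dual_basis : dual_basis (restr dual).
Proof.
have lin k : linear (fun f : restr dual => dual_lin f (e k) : R^o).
  move=> r f g; apply: etrans (dual_addE _ _ _) _.
  by congr (_ + _); exact: dual_restrZ.
by exists n, (fun k => dual_of (l k)), (fun k => Lin (lin k)) => f; apply: dual_basisE.
Qed.

Lemma dual_reflexive (c : {linear restr dual -> R^o}) : exists y : A, forall f, c f = dual_lin f y.
Proof.
exists (\sum_k alg_map A (c (dual_of (l k))) * (e k : A)) => f.
rewrite [f in LHS]dual_basisE !linear_sum; apply: eq_bigr => k _.
apply: etrans (linZ c (dual_lin f (e k) : R) (dual_of (l k))) _.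
apply: etrans (mulrC _ _) _.
exact (esym (linZ (dual_lin f) (c (dual_of (l k)) : R) (e k))).
Qed.

Lemma dual_separates x y : (forall f, dual_lin f x = dual_lin f y) -> x = y.
Proof.
move=> xy; rewrite [x]lP [y]lP; apply: eq_bigr => k _.
exact (congr1 (fun r : R => r *: e k) (xy (dual_of (l k)))).
Qed.

End DualModule.

Lemma restr_dual_basis (R : comPzRingType) (A : assoc_algebra R) (V : lmodType A) :
  dual_basis (alg_module A) -> dual_basis V -> dual_basis (restr V).
Proof.
move=> [n [e [l lP]]] [k [v [h hP]]].
have lin j : linear (fun x : restr V => l j.2 (h j.1 x)).
  by move=> r x y; rewrite -(linearP (l j.2)); congr (l _ _); rewrite [LHS]linearP.
apply: (@dual_basis_fin R (restr V) ('I_k * 'I_n)%type (fun j => (e j.2 : A) *: v j.1)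
  (fun j => Lin (lin j))) => x.
rewrite -(pair_bigA _ (fun i j => (l j (h i x) : R) *: ((e j : A) *: v i : restr V))) /=.
rewrite [LHS]hP; apply: eq_bigr => i _; rewrite [h i x in LHS](lP (h i x)) scaler_suml.
by apply: eq_bigr => j _; rewrite [RHS]restrZ scalerA.
Qed.

(** * Balance bounds the right injective dimension *)

Section DualBounded.
Variables (R : comPzRingType) (A : assoc_algebra R).
Hypothesis R_noeth : left_noetherian R.
Hypothesis A_fg : fg_module (alg_module A).
Hypothesis A_proj : dual_basis (alg_module A).
Local Notation omega := (dual A : lmodType A).

Lemma base_hom_exact (m : prime_ideal R) : inj_bound (prime_compl m) ->
  exists n : nat, forall (Q : cplx R) (c : int), (forall i, dual_basis (Q i)) ->
    (forall k, k <= c -> loc_exact (prime_compl m) (cd Q k) (cd Q (k + 1))) ->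
    forall k, k + n%:Z <= c -> hom_exact (prime_compl m) (cd Q k) (cd Q (k + 1)) R^o.
Proof.
move=> /(inj_bound_ext1 R_noeth)[n nP]; exists n => Q c Q_proj Q_ex.
exact: hom_exact_of_ext1.
Qed.

(* Hom_A(V, Hom_R(A, R)) = Hom_R(V, R). *)
Lemma hom_exact_dual (m : prime_ideal R) (U V W : lmodType A) (d : {linear U -> V})
    (d' : {linear V -> W}) :
  hom_exact (prime_compl m) (restr_fun d) (restr_fun d') R^o ->
  hom_exact (loc_set A m) d d' omega.
Proof.
move=> H b bd; have lin : linear (fun x : restr V => dual_lin (b x) 1).
  move=> r x y; have -> : b (r *: x + y : restr V) = alg_map A r *: b x + b y by exact: linearP.
  by rewrite dual_addE dual_restrZ.
have [|r mr [c cE]] := H (Lin lin); first by move=> x /=; rewrite bd.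
have linW w : linear (fun a : alg_module A => c ((a : A) *: (w : W) : restr W)).
  move=> t x y; rewrite -(linearP c); congr (c _).
  by rewrite [LHS]scalerDl -[X in X + _]scalerA.
have linc : linear (fun w => dual_of (Lin (linW w)) : omega).
  move=> a x y; apply: dual_eq => z; rewrite dual_addE dual_scaleE -[LHS]/(c ((z : A) *: (a *: x + y) : restr W)).
  rewrite scalerDr scalerA; exact: (linearD c).
exists (alg_map A r); first by exists r.
exists (Lin linc) => x; apply: dual_eq => a; rewrite dual_restrZ.
have -> : dual_lin (Lin linc (d' x)) a = c (restr_fun d' ((a : A) *: x : V)).
  by rewrite /= linZ.
apply: etrans _ (cE _); have bx : b ((a : A) *: x) = (a : A) *: b x by exact: linZ.
rewrite -[RHS]/(r * (dual_lin (b ((a : A) *: x)) 1 : R)) bx.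
by rewrite [dual_lin (_ *: _) _]dual_scaleE mul1r.
Qed.

(** Hom_A(Q, Hom_R(A, R)) is Hom_R(Q, R), whose high cohomology vanishes at m because R inherits the
    bound of [A] there. *)
Lemma dual_right_bounded (omega_fg : fg_module omega) :
  (forall m : prime_ideal R, maximal_ideal m -> inj_bound (loc_set A m)) ->
  @right_bounded (Db_mod A) (stalk omega_fg).
Proof.
move=> bounds X X_brick; have [X0|[m m_max X_iso]] := loc_dichotomy R_noeth A_fg X_brick.
  by exists 0%N => n _; apply: (acyclic_trivial R_noeth A_fg).
have [Q [q qq]] := fcx_cover R_noeth A_fg X; have [c1 Xc1] := bcomplex_below X.
have [n nP] : exists n : nat, forall k, k <= - n%:Z ->
    hom_exact (loc_set A m) (cd (fc Q) k) (cd (fc Q) (k + 1)) omega.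
  have [S0|/(inj_bound_base A_proj) /(_ (bounds m m_max))] := pselect (loc_set A m 0).
    by exists 0%N => k _ b _; exists 0 => //; exists \0 => x; rewrite scale0r.
  move=> /base_hom_exact[n nP]; exists (n + `|c1| + 1)%N => k kn.
  apply: hom_exact_dual.
  unshelve epose (Q' := @Cplx R (fun i => restr (fc Q i) : lmodType R)
    (fun i => restr_fun (cd (fc Q) i)) _).
    by move=> i x; apply: (@cdK _ (fc Q)).
  apply: (nP Q' (c1 - 1)) => [i|k' k'c|].
  - exact: restr_dual_basis A_proj (rv_dual_basis A _).
  - apply: exact_loc_exact => x x0.
    by have [|y yE] := resolution_exact qq Xc1 (k := k') _ x0; [lia | exists y].
  - by lia.
exists n.+1 => i il.
apply/(proj2 (@dhom_trivialP A Q X _ q qq)) => a.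
have [||s ms sa] := @local_null R A m (fc Q) (shiftn (C := Db_mod A) i (stalk omega_fg)) (1 - i%:Z) a.
- by move=> j jl; rewrite shiftn_obj; apply: stalk_zero; lia.
- move=> k kl; rewrite shiftn_obj; have [e|/eqP ne] := eqVneq (k + 1 + i%:Z) 0.
    by rewrite e; apply: nP; lia.
  by apply: hom_exact_zero; apply: stalk_zero.
- by apply: iso_source qq _ sa; apply: X_iso.
Qed.

Section RightBound.
Variable m : prime_ideal R.
Hypothesis m_max : maximal_ideal m.
Local Notation S := (loc_set A m).
Local Notation S' := (loc_set (opp_alg A) m).

Local Notation col n := ({ffun 'I_n -> restr omega} : lmodType R).

Fact colmul_linear a b (M : 'M[A]_(a, b)) :
  linear (fun w : col b => [ffun i => \sum_j M i j *: (w j : omega)] : col a).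
Proof.
move=> r x y; apply/ffunP => i; rewrite !ffunE.
apply: etrans (_ : _ = alg_map A r *: (\sum_j M i j *: (x j : omega)) + \sum_j M i j *: (y j : omega)) _ => //.
rewrite scaler_sumr -big_split; apply: eq_bigr => j _; rewrite !ffunE.
apply: etrans (_ : _ = M i j *: (alg_map A r *: (x j : omega) + (y j : omega))) _ => //.
by rewrite scalerDr !scalerA alg_map_central.
Qed.

Definition colmul a b (M : 'M[A]_(a, b)) : {linear col b -> col a} := Lin (colmul_linear M).

Lemma colmulE a b (M : 'M[A]_(a, b)) w i : colmul M w i = \sum_j M i j *: (w j : omega).
Proof. by rewrite ffunE. Qed.

Lemma colmulM a b c (M : 'M[A]_(a, b)) (N : 'M_(b, c)) w :
  colmul M (colmul N w) = colmul (M *m N) w.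
Proof.
apply/ffunP => i; rewrite !colmulE.
under eq_bigr do rewrite colmulE scaler_sumr.
rewrite exchange_big; apply: eq_bigr => k _; rewrite mxE scaler_suml.
by apply: eq_bigr => j _; rewrite scalerA.
Qed.

(** A complex of right modules stays exact after tensoring with omega when Tor vanishes: [X] lifts
    the cycle [w] along [e], and subtracting a multiple of [q], invisible in omega, makes it a cycle
    over [A]. *)
Lemma colmul_exact n (e : {linear 'rV[A]_n -> omega}) a b c k g (q : 'M[A]_(k, n))
    (t : 'M[A]_(a, b)) (t' : 'M_(b, c)) (t'' : 'M_(c, g)) w :
  (forall y, exists x, e x = y) -> (forall x, e x = 0 <-> exists y, x = y *m q) ->
  t *m t' = 0 -> col_exact t' t'' -> tor_zero S t t' q -> colmul t' w = 0 ->
  exists2 s, ~~ prime_mem m s & exists y, s *: w = colmul t'' y.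
Proof.
move=> e_surj e_ker tK tE H tw; have [x xE] := choice (fun i => e_surj (w i)).
pose X : 'M[A]_(c, n) := \matrix_i x i.
have eX a' (M : 'M[A]_(a', c)) i : e (row i (M *m X)) = colmul M w i.
  rewrite colmulE row_mul mulmx_sum_row linear_sum; apply: eq_bigr => j _.
  by rewrite linZ rowK xE mxE.
have [|D DE] := @choice _ _ (fun i y => row i (t' *m X) = y *m q).
  by move=> i; apply/e_ker; rewrite eX tw ffunE.
have XD : t' *m X = (\matrix_i D i) *m q.
  by apply/row_matrixP => i; rewrite DE row_mul rowK.
have [|_ [s ms ->] [E EE]] := H (\matrix_i D i).
  by rewrite -mulmxA -XD mulmxA tK mul0mx.
have [|F FE] := tE _ (alg_map A s *: X - E *m q).
  rewrite mulmxBr mulmxA -EE -XD (mulmxZr (S := S)) ?subrr //.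
  by exists s.
exists s => //; exists [ffun i => e (row i F)].
apply/ffunP => i; rewrite colmulE ffunE.
have -> : s *: w i = e (row i (alg_map A s *: X)).
  have -> : row i (alg_map A s *: X) = alg_map A s *: x i by apply/rowP => j; rewrite !mxE.
  by rewrite linZ xE.
have -> : alg_map A s *: X = t'' *m F + E *m q by rewrite -FE subrK.
rewrite linearD linearD /= [X in _ + X](_ : _ = 0); last by apply/e_ker; exists (row i E); rewrite row_mul.
rewrite addr0 row_mul mulmx_sum_row linear_sum; apply: eq_bigr => j _.
by rewrite linZ !ffunE mxE.
Qed.

Fact evcol_linear n (x : 'cV[A^c]_n) :
  linear (fun w : col n => \sum_j dual_lin (w j) (x j 0) : R^o).
Proof.
move=> r v w; rewrite scaler_sumr -big_split; apply: eq_bigr => j _.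
rewrite !ffunE; apply: etrans (dual_addE _ _ _) _.
by congr (_ + _); exact: dual_restrZ.
Qed.

(** The pairing of A^n with omega^n. By [evcol_surj] and [evcol_inj] it identifies Hom_R(omega^n, R)
    with A^n. *)
Definition evcol n (x : 'cV[A^c]_n) : {linear col n -> R^o} := Lin (evcol_linear x).

Lemma evcol_mul a b (M : 'M[A^c]_(a, b)) (x : 'cV_b) w :
  evcol x (colmul (op M) w) = evcol (M *m x) w.
Proof.
have E i : dual_lin (colmul (op M) w i) (x i 0) =
    \sum_j dual_lin (w j) ((x i 0 : A) * op M i j).
  rewrite colmulE; apply: etrans (dual_sumE _ _) _.
  by apply: eq_bigr => j _; exact: dual_scaleE.
apply: etrans (eq_bigr _ (fun i _ => E i)) _.
rewrite exchange_big; apply: eq_bigr => j _; rewrite mxE linear_sum.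
by apply: eq_bigr => i _; rewrite mxE.
Qed.

Fact single_linear n (j : 'I_n) :
  linear (fun f : restr omega => [ffun i => if i == j then f else 0] : col n).
Proof.
move=> r f g; apply/ffunP => i; rewrite !ffunE.
by case: eqP => // _; rewrite scaler0 addr0.
Qed.

Definition single n (j : 'I_n) : {linear restr omega -> col n} := Lin (single_linear j).

Lemma singleE n (j : 'I_n) f i : single j f i = if i == j then f else 0.
Proof. by rewrite ffunE. Qed.

Lemma evcol_single n (x : 'cV[A^c]_n) j f : evcol x (single j f) = dual_lin f (x j 0).
Proof.
have E i : dual_lin (single j f i) (x i 0) = if i == j then dual_lin f (x j 0) else 0.
  by rewrite singleE; case: eqP => [->|].
apply: etrans (eq_bigr _ (fun i _ => E i)) _.
by rewrite -big_mkcond big_pred1_eq.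
Qed.

Lemma evcol_inj n (x y : 'cV[A^c]_n) : (forall w, evcol x w = evcol y w) -> x = y.
Proof.
have [k [e [l lP]]] := A_proj; move=> xy; apply/colP => j.
by apply: (dual_separates lP) => f; rewrite -!evcol_single.
Qed.

Lemma evcol_surj n (c : {linear col n -> R^o}) : exists x, forall w, c w = evcol x w.
Proof.
have [k [e [l lP]]] := A_proj.
have [x xE] := choice (fun j => dual_reflexive lP (c \o single j)%FUN).
exists (\col_j x j) => w.
have {1}-> : w = \sum_j single j (w j).
  apply/ffunP => i; rewrite sum_ffunE (bigD1 i) //= big1 => [|j /negbTE ji].
    by rewrite singleE eqxx addr0.
  by rewrite singleE eq_sym ji.
by rewrite linear_sum; apply: eq_bigr => j _; rewrite mxE; apply: xE.
Qed.

Lemma evcolZ n r (x : 'cV[A^c]_n) w :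
  evcol ((alg_map A r : A^c) *: x) w = r * (evcol x w : R).
Proof.
rewrite /= mulr_sumr; apply: eq_bigr => j _; rewrite mxE -dual_restrZ.
by rewrite dual_scaleE.
Qed.

(** Omega is perfect at m, so Tor against it vanishes far out in a right resolution, and tensoring
    with omega keeps the resolution exact there up to [S]. Applying Hom_R(-, R), which is exact at m
    in high degrees, gives Hom of right modules into [A], through the pairing [evcol]. *)
Lemma dual_inj_bound (omega_fg : fg_module omega) : inj_bound (prime_compl m) ->
  @left_bounded (Db_mod A) (stalk omega_fg) -> inj_bound S'.
Proof.
move=> /base_hom_exact[d dP] Yb.
have A_noeth : left_noetherian A := algebra_noetherian A_fg R_noeth.
have [P [e [_ e_surj e_ker P_ex [p pq _]]]] := stalk_cover A_noeth omega_fg.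
have [n nP] := left_bounded_split R_noeth A_fg m_max pq Yb.
(* n counts the shifts up to degree -1 of [P], d is the bound over R, and the rest absorbs index
   offsets. *)
exists (n + d + 2)%N => Q c Q_ex.
have T_ex i : i <= c -> col_exact (op (mx Q (i + 1))) (op (mx Q i)).
  by move=> ic; apply/row_exact_op/Q_ex.
have TK i : op (mx Q (i + 1)) *m op (mx Q i) = 0 by rewrite -opM mxK op0.
have HV (j : nat) : (j <= n)%N -> forall i, i + j%:Z <= c ->
    tor_zero S (op (mx Q (i + 1))) (op (mx Q i)) (mx P (-1 - n%:Z + j%:Z)).
  elim: j => [|j IHj] jn i ic.
    rewrite addr0; apply: perfect_tor_zero; first by apply: T_ex; lia.
    by apply: split_perfect_l (mxK P _) (nP _ _); lia.
  have -> : -1 - n%:Z + j.+1%:Z = -1 - n%:Z + j%:Z + 1 by lia.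
  apply: (tor_zero_up (mxK P _) _ (TK (i + 1))); last by apply: IHj; lia.
    by move=> x; apply: P_ex; lia.
  by apply: T_ex; lia.
unshelve epose (V := @Cplx R (fun i => col (sz Q i)) (fun i => colmul (op (mx Q i))) _).
  move=> i w; rewrite colmulM TK; apply/ffunP => j; rewrite colmulE ffunE.
  by rewrite big1 // => k _; rewrite mxE scale0r.
have omega_proj a : dual_basis (col a).
  have [k [v [l lP]]] := A_proj.
  exact: ffun_dual_basis (dual_dual_basis lP).
have H k : k + d%:Z <= c - n%:Z - 1 -> hom_exact (prime_compl m) (cd V k) (cd V (k + 1)) R^o.
  apply: dP => [i|i ic]; first exact: omega_proj.
  apply: loc_exact_fg R_noeth (fg_dual_basis (omega_proj _)) _ => w w0.
  have T0 : tor_zero S (op (mx Q (i + 1 + 1))) (op (mx Q (i + 1))) (mx P (-1)).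
    by have := HV n (leqnn n) (i + 1); rewrite subrK; apply; lia.
  have ic' : i <= c by lia.
  have [s ms [y yE]] := colmul_exact e_surj e_ker (TK (i + 1)) (T_ex i ic') T0 w0.
  by exists s => //; exists y.
move=> k kc; apply/hom_exact_col => x qx.
have [||r mr [f fE]] := H k _ (evcol x).
- by lia.
- by move=> w; rewrite [LHS]evcol_mul qx /= big1 // => j _; rewrite mxE; exact (linear0 (dual_lin (w j))).
have [y yE] := evcol_surj f; exists (alg_map A r : A^c); first by exists r.
exists y; apply: evcol_inj => w; rewrite evcolZ -evcol_mul -yE.
exact: fE.
Qed.

End RightBound.

Lemma balanced_right_inj_bound (m : prime_ideal R) : maximal_ideal m ->
  @balanced (Db_mod A) -> inj_bound (loc_set (opp_alg A) m).
Proof.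
move=> m_max bal; have [S0|S0] := pselect (loc_set A m 0).
  exact: inj_bound_trivial.
have omega_fg : fg_module omega by have [k [v [l lP]]] := A_proj; exact: dual_fg lP.
have bound m' : maximal_ideal m' -> inj_bound (loc_set A m').
  by move=> m'_max; apply: balanced_inj_bound.
apply: (dual_inj_bound m_max (omega_fg := omega_fg)).
  exact (inj_bound_base A_proj S0 (bound m m_max)).
exact/bal/dual_right_bounded.
Qed.

End DualBounded.

Lemma gorenstein_algebra_balanced (R : comPzRingType) (A : assoc_algebra R) :
  left_noetherian R -> finite_projective A ->
  gorenstein_algebra A <-> @balanced (Db_mod A).
Proof.
move=> R_noeth A_fp; have [A_fg A_projective] := A_fp.
have A_proj := projective_dual_basis A_fg A_projective.
split=> [[_ G]|bal].
  apply: inj_bound_balanced => // m m_max.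
  exact: gorenstein_inj_bound (G m).
(* Maximal ideals suffice: elements outside m are outside p, so vanishing up to the former implies
   vanishing up to the latter. *)
split=> // p _; have [m m_max pm] := exists_maximal_ideal p R_noeth.
have mp s : ~~ prime_mem m s -> ~~ prime_mem p s by apply/contra/pm.
apply: inj_bound_gorenstein => //.
  apply: inj_bound_mono (balanced_inj_bound R_noeth A_fg m_max bal).
  by move=> _ [s ms ->]; exists s => //; apply: mp.
apply: inj_bound_mono (balanced_right_inj_bound R_noeth A_fg A_proj m_max bal).
by move=> _ [s ms ->]; exists s => //; apply: mp.
Qed.

Theorem theorem6p12 (R : comPzRingType) (A B : assoc_algebra R)
    (R_noetherian : left_noetherian R)
    (A_finite_projective : finite_projective A)
    (B_finite_projective : finite_projective B)
    (AB_derived_equivalent : derived_equivalent A B) :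
  gorenstein_algebra A <-> gorenstein_algebra B.
Proof.
rewrite !gorenstein_algebra_balanced //.
exact: triangle_equivalent_balanced.
Qed.
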